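(* Let $G$ be a profinite group, $H$ an open subgroup of $G$, and $S$ a truncation set for $H$. Choose a set $\underline{S}\subseteq S$ of representatives of the $H$-conjugacy classes in $S$ and, for each $V\in\underline{S}$, coset representatives for $G/V$, and let $w:\prod_{V\in\underline{S}}M^{\otimes_R G/V}\to\big(\prod_{U\in S}M^{\otimes_R G/U}\big)^H$ be the corresponding ghost map. Then there is a functor $$W^S_{H\le G}:\mathrm{Mod}\to\mathrm{Ab}_{\mathrm{Haus}}$$ and there are topological quotient maps of underlying spaces $$q:\prod_{V\in\underline{S}}M^{\otimes_R G/V}\twoheadrightarrow W^S_{H\le G}(R;M),$$ natural in $(R;M)$, such that: (i) the ghost map $w$ factors through $q$, inducing a natural additive map $w:W^S_{H\le G}(R;M)\to\big(\prod_{U\in S}M^{\otimes_R G/U}\big)^H$ (also called the ghost map); (ii) for each free object $(T;Q)$ of $\mathrm{Mod}$, the ghost map out of $W^S_{H\le G}(T;Q)$ is an embedding of topological abelian groups, i.e. it induces an isomorphism $W^S_{H\le G}(T;Q)\cong\mathrm{im}(w)\le\big(\prod_{U\in S}Q^{\otimes_T G/U}\big)^H$; (iii) the functor $W^S_{H\le G}$ preserves reflexive coequalisers. Moreover, these properties specify the functor $W^S_{H\le G}$ together with the natural map $w:W^S_{H\le G}(R;M)\to\big(\prod_{U\in S}M^{\otimes_R G/U}\big)^H$ uniquely up to unique natural isomorphism, even if different choices of the representatives $\underline{S}$ or of the coset representatives are made in defining the ghost map on $\prod_{V\in\underline{S}}M^{\otimes_R G/V}$ (that is, if $(W,w)$ and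 $(W',w')$ arise in this way from possibly different choices, there is a unique natural isomorphism $u:W\cong W'$ with $w'u=w$).
   Context: All rings are commutative. $V\le_o G$ means $V$ is an open subgroup. For an $R$-module $M$ and a finite set $X$, $M^{\otimes_R X}$ is the tensor power over $R$ indexed by $X$, regarded as a discrete topological abelian group; products carry the product topology and fixed points the subspace topology. $\mathrm{Ab}_{\mathrm{Haus}}$ is the category of Hausdorff topological abelian groups. $\mathrm{Mod}$ is the category of pairs $(R;M)$ with $R$ a ring and $M$ an $R$-module; a morphism $(R;M)\to(R';M')$ is a ring homomorphism $\alpha:R\to R'$ together with an $R$-linear map $M\to\alpha^*M'$ (restriction of scalars). A free object of $\mathrm{Mod}$ is one isomorphic to $(\mathbb{Z}[X];\mathbb{Z}[X](Y))$ for sets $X,Y$: a free module on $Y$ over the polynomial ring $\mathbb{Z}[X]$. A reflexive coequaliser is a coequaliser of a pair of parallel morphisms having a common section. A truncation set for $H$ is a set $S$ of open subgroups of $H$ that is upwards closed (if $U\in S$ and $U\le U'\le_o H$ then $U'\in S$) and closed under conjugation by elements of $H$. For $V\le_o G$ and $g\in G$, the isomorphism $g\cdot(-):M^{\otimes_R G/V}\to M^{\otimes_R G/gVg^{-1}}$ sends $\bigotimes_{aV}m_{aV}$ to the tensor whose factor at the coset $a(gVg^{-1})$ is $m_{agV}$. These maps give an action of $H$ on $\prod_{U\in S}M^{\otimes_R G/U}$. For $U\le_o V\le_o G$ and coset representatives $\{g_i\}$ of $G/V$, $f_{G/V}:M^{\otimes_R G/V\times V/U}\to M^{\otimes_R G/U}$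 is the isomorphism induced by the bijection $G/V\times V/U\to G/U$, $(g_iV,sU)\mapsto g_isU$. For $n\in M^{\otimes_R G/V}$, $n^{\otimes_R V/U}\in M^{\otimes_R G/V\times V/U}$ is its tensor power indexed by $V/U$. The ghost map $w:\prod_{V\in\underline{S}}M^{\otimes_R G/V}\to\big(\prod_{U\in S}M^{\otimes_R G/U}\big)^H$ is the continuous (not necessarily additive) map with components $$w_U(n)=\sum_{V\in\underline{S}}\ \sum_{hV\in (H/V)^U}h\cdot f_{G/V}\big(n_V^{\otimes_R V/h^{-1}Uh}\big)\qquad(U\in S),$$ where $(H/V)^U=\{hV\in H/V: h^{-1}Uh\le V\}$. *)

(* Defs.v *)
From HB Require Import structures.
From mathcomp Require Import all_boot all_order all_algebra.
From mathcomp.multinomials Require Import -(notations) monalg.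
From mathcomp Require Import all_classical topology_structure compact.
From mathcomp Require Import separation_axioms function_spaces.
From mathcomp Require Import discrete_topology product_topology tvs.

Set Implicit Arguments.
Unset Strict Implicit.
Unset Printing Implicit Defensive.

Import GRing.Theory.

Local Open Scope quotient_scope.
Local Open Scope classical_set_scope.
Local Open Scope ring_scope.

Section Tensor.
Variables (R : comPzRingType) (M : lmodType R) (X : choiceType).

(* [:: (r1, m1); ...; (rk, mk)] stands for \sum_i r_i *: \bigotimes_x m_i x;
   the relation is the congruence generated by commutativity, linearity in the
   coefficient, and linearity in each tensor factor. *)
Definition tens_expr : Type := seq (R * (X -> M)).

Inductive tens_rel : tens_expr -> tens_expr -> Prop :=
| TensRefl s : tens_rel s s
| TensSym s t : tens_rel s t -> tens_rel t s
| TensTrans s t u : tens_rel s t -> tens_rel t u -> tens_rel s u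
| TensCat s s' t t' :
    tens_rel s s' -> tens_rel t t' -> tens_rel (s ++ t) (s' ++ t')
| TensCatC s t : tens_rel (s ++ t) (t ++ s)
| TensCoef0 m : tens_rel [:: (0, m)] [::]
| TensCoefD a b m : tens_rel [:: (a + b, m)] [:: (a, m); (b, m)]
| TensFactorD r m x a b :
    tens_rel [:: (r, dfwith m x (a + b))]
             [:: (r, dfwith m x a); (r, dfwith m x b)]
| TensFactorZ r m x c a :
    tens_rel [:: (r, dfwith m x (c *: a))] [:: (r * c, dfwith m x a)].

HB.instance Definition _ := Choice.on tens_expr.

Definition tens_relb (s t : tens_expr) : bool := `[< tens_rel s t >].

Fact tens_relb_refl : reflexive tens_relb.
Proof. by move=> s; apply/asboolP; apply: TensRefl. Qed.

Fact tens_relb_sym : symmetric tens_relb.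
Proof. by move=> s t; apply/asboolP/asboolP => /TensSym. Qed.

Fact tens_relb_trans : transitive tens_relb.
Proof.
move=> t s u /asboolP st /asboolP tu; apply/asboolP; exact: TensTrans st tu.
Qed.

Canonical tens_equiv :=
  EquivRel tens_relb tens_relb_refl tens_relb_sym tens_relb_trans.

Definition tens : Type := {eq_quot tens_equiv}.

HB.instance Definition _ := Choice.on tens.
HB.instance Definition _ := EqQuotient.on tens.

Lemma tensW (t : tens) : exists s : tens_expr, t = \pi_tens s.
Proof. by exists (repr t); rewrite reprK. Qed.

Lemma tens_piP (s t : tens_expr) :
  (\pi_tens s = \pi_tens t) <-> tens_rel s t.
Proof.
split=> [/eqmodP /asboolP //|st]; apply/eqmodP; exact/asboolP.
Qed.

Lemma tens_reprP (s : tens_expr) : tens_rel (repr (\pi_tens s)) s.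
Proof. by apply/tens_piP; rewrite reprK. Qed.

Definition expr_scale (c : R) (s : tens_expr) : tens_expr :=
  [seq (c * p.1, p.2) | p <- s].

Lemma expr_scale_rel c s t :
  tens_rel s t -> tens_rel (expr_scale c s) (expr_scale c t).
Proof.
elim=> {s t}
  [s|s t _|s t u _ + _|s s' t t' _ + _|s t|m|a b m|r m x a b|r m x d a].
- exact: TensRefl.
- exact: TensSym.
- exact: TensTrans.
- by rewrite /expr_scale !map_cat; exact: TensCat.
- by rewrite /expr_scale !map_cat; exact: TensCatC.
- by rewrite /expr_scale /= mulr0; exact: TensCoef0.
- by rewrite /expr_scale /= mulrDr; exact: TensCoefD.
- exact: TensFactorD.
- by rewrite /expr_scale /= mulrA; exact: TensFactorZ.
Qed.

Definition tens_add (s t : tens) : tens :=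
  \pi_tens (repr s ++ repr t : tens_expr).
Definition tens_zero : tens := \pi_tens ([::] : tens_expr).
Definition tens_scale (c : R) (t : tens) : tens :=
  \pi_tens (expr_scale c (repr t)).
Definition tens_opp (t : tens) : tens := tens_scale (-1) t.

Lemma tens_addE s t :
  tens_add (\pi_tens s) (\pi_tens t) = \pi_tens (s ++ t).
Proof. by apply/tens_piP; apply: TensCat; exact: tens_reprP. Qed.

Lemma tens_scaleE c s : tens_scale c (\pi_tens s) = \pi_tens (expr_scale c s).
Proof. by apply/tens_piP; apply: expr_scale_rel; exact: tens_reprP. Qed.

Fact tens_addA : associative tens_add.
Proof.
move=> s t u; have [{}s ->] := tensW s; have [{}t ->] := tensW t.
have [{}u ->] := tensW u.
by rewrite !tens_addE catA.
Qed.

Fact tens_addC : commutative tens_add.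
Proof.
move=> s t; have [{}s ->] := tensW s; have [{}t ->] := tensW t.
rewrite !tens_addE.
by apply/tens_piP; exact: TensCatC.
Qed.

Fact tens_add0 : left_id tens_zero tens_add.
Proof. by move=> s; have [{}s ->] := tensW s; rewrite tens_addE. Qed.

Fact tens_scaleA a b t : tens_scale a (tens_scale b t) = tens_scale (a * b) t.
Proof.
have [s ->] := tensW t; rewrite !tens_scaleE /expr_scale -map_comp.
by congr (\pi _); apply: eq_map => p /=; rewrite mulrA.
Qed.

Fact tens_scale1 : left_id 1 tens_scale.
Proof.
move=> s; have [{}s ->] := tensW s; rewrite tens_scaleE /expr_scale.
by congr (\pi _); rewrite -[RHS]map_id; apply: eq_map => -[a m]; rewrite mul1r.
Qed.

Fact tens_scaleDr c : {morph tens_scale c : s t / tens_add s t}.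
Proof.
move=> s t; have [{}s ->] := tensW s; have [{}t ->] := tensW t.
by rewrite !(tens_addE, tens_scaleE) /expr_scale map_cat.
Qed.

Fact tens_scaleDl t a b :
  tens_scale (a + b) t = tens_add (tens_scale a t) (tens_scale b t).
Proof.
have [s ->] := tensW t; rewrite !tens_scaleE tens_addE; apply/tens_piP.
elim: s => [|[c m] s IHs] /=; first exact: TensRefl.
apply: (@TensTrans _ ([:: (a * c, m); (b * c, m)]
                      ++ (expr_scale a s ++ expr_scale b s))).
  rewrite -cat1s mulrDl; apply: TensCat => //; exact: TensCoefD.
rewrite -cat1s -[X in tens_rel _ X]cat1s /= -[X in tens_rel X]cat1s.
rewrite -[X in tens_rel _ X]cat1s; apply: TensCat; first exact: TensRefl.
rewrite -[X in tens_rel X]cat1s -[X in tens_rel _ (_ ++ X)]cat1s !catA.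
by apply: TensCat; [exact: TensCatC | exact: TensRefl].
Qed.

Fact tens_scale0 t : tens_scale 0 t = tens_zero.
Proof.
have [s ->] := tensW t; rewrite tens_scaleE; apply/tens_piP.
elim: s => [|[c m] s IHs] /=; first exact: TensRefl.
by rewrite mul0r -cat1s -[[::]]cat0s; apply: TensCat => //; exact: TensCoef0.
Qed.

Fact tens_addN : left_inverse tens_zero tens_opp tens_add.
Proof.
move=> t; rewrite -[X in tens_add _ X]tens_scale1 /tens_opp -tens_scaleDl.
by rewrite addNr tens_scale0.
Qed.

HB.instance Definition _ :=
  GRing.isZmodule.Build tens tens_addA tens_addC tens_add0 tens_addN.
HB.instance Definition _ :=
  GRing.Zmodule_isLmodule.Build R tens
    tens_scaleA tens_scale1 tens_scaleDr tens_scaleDl.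

HB.instance Definition _ := hasNbhs.Build tens principal_filter.
HB.instance Definition _ := Discrete_ofNbhs.Build tens erefl.

Definition pure (m : X -> M) : tens := \pi_tens ([:: (1, m)] : tens_expr).

End Tensor.

Section TensorLift.
Variables (R R' : comPzRingType) (alpha : {rmorphism R -> R'}).
Variables (M : lmodType R) (X : choiceType) (P : lmodType R').

Definition multilinear (phi : (X -> M) -> P) : Prop :=
  forall m x c a b, phi (dfwith m x (c *: a + b)) =
    alpha c *: phi (dfwith m x a) + phi (dfwith m x b).

(* The alpha-semilinear map with pure m |-> phi m; the choice of representative
   is immaterial when phi is multilinear, the only case used. *)
Definition tens_lift (phi : (X -> M) -> P) (t : tens M X) : P :=
  \sum_(p <- repr t) alpha p.1 *: phi p.2.

Variables (phi : (X -> M) -> P) (phiP : multilinear phi).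

Lemma tens_lift_rel (s t : tens_expr M X) : tens_rel s t ->
  \sum_(p <- s) alpha p.1 *: phi p.2 = \sum_(p <- t) alpha p.1 *: phi p.2.
Proof.
have phi0 m x : phi (dfwith m x 0) = 0.
  have := phiP m x (-1) 0 0; rewrite scaler0 addr0 rmorphN rmorph1 scaleN1r.
  by rewrite addNr.
elim=> {s t}
  [//|s t _|s t u _ + _|s s' t t' _ + _|s t|m|a b m|r m x a b|r m x d a] //.
- by move=> ->.
- by move=> IH1 IH2; rewrite !big_cat IH1 IH2.
- by rewrite !big_cat /= addrC.
- by rewrite big_seq1 big_nil rmorph0 scale0r.
- by rewrite big_seq1 big_cons big_seq1 rmorphD scalerDl.
- have := phiP m x 1 a b; rewrite scale1r rmorph1 scale1r => phiD.
  by rewrite big_seq1 big_cons big_seq1 phiD scalerDr.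
- have := phiP m x d a 0; rewrite addr0 phi0 addr0 => phiZ.
  by rewrite !big_seq1 phiZ scalerA rmorphM.
Qed.

Lemma tens_lift_pi (s : tens_expr M X) :
  tens_lift phi (\pi_(tens M X) s) = \sum_(p <- s) alpha p.1 *: phi p.2.
Proof. by apply: tens_lift_rel; exact: tens_reprP. Qed.

Lemma tens_lift_pure m : tens_lift phi (pure m) = phi m.
Proof. by rewrite tens_lift_pi big_seq1 rmorph1 scale1r. Qed.

Lemma tens_liftD : {morph tens_lift phi : s t / s + t}.
Proof.
move=> s t; have [{}s ->] := tensW s; have [{}t ->] := tensW t.
by rewrite [_ + _]tens_addE !tens_lift_pi big_cat.
Qed.

Lemma tens_liftZ c t : tens_lift phi (c *: t) = alpha c *: tens_lift phi t.
Proof.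
have [s ->] := tensW t; rewrite [_ *: _]tens_scaleE !tens_lift_pi big_map.
by rewrite scaler_sumr; apply: eq_bigr => p _; rewrite rmorphM scalerA.
Qed.

End TensorLift.

Lemma pure_multilinear (R : comPzRingType) (M : lmodType R) (X : choiceType) :
  multilinear idfun (@pure R M X).
Proof.
move=> m x c a b /=.
rewrite [c *: pure _]tens_scaleE [X in _ = X]tens_addE; apply/tens_piP.
rewrite /expr_scale /= mulr1.
apply: TensTrans (TensFactorD _ _ _ _ _) _.
rewrite -cat1s -[X in tens_rel _ X]cat1s; apply: TensCat; last exact: TensRefl.
by have := TensFactorZ 1 m x c a; rewrite mul1r.
Qed.

Section TensorMaps.
Variables (R : comPzRingType) (M : lmodType R).

Definition tens_reindex (X Y : choiceType) (psi : Y -> X) :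
    tens M X -> tens M Y :=
  tens_lift idfun (fun m => pure (m \o psi)).

(* For a bijection phi, the isomorphism moving the factor at x to phi x. *)
Definition tens_bij (X Y : choiceType) (phi : X -> Y) : tens M X -> tens M Y :=
  tens_lift idfun
    (fun m => pure (fun y => xget 0 [set m x | x in [set x | phi x = y]])).

Definition tens_curry (X Y : choiceType) :
    tens M (X * Y)%type -> tens (tens M X) Y :=
  tens_lift idfun (fun m => pure (fun y => pure (fun x => m (x, y)))).

Lemma tens_curry_pure (X Y : choiceType) (m : X * Y -> M) :
  tens_curry (pure m) = pure (fun y => pure (fun x => m (x, y))).
Proof.
rewrite /tens_curry tens_lift_pure // => {}m [x y] c a b /=.
have E z : (fun y' => pure (fun x' => dfwith m (x, y) z (x', y'))) =
    dfwith (fun y' => pure (fun x' => m (x', y'))) y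
      (pure (dfwith (fun x' => m (x', y)) x z)).
  apply/funext => y'; case: (eqVneq y y') => [<-|yy'].
    rewrite dfwithin; congr pure; apply/funext=> x'.
    case: (eqVneq x x') => [<-|xx']; first by rewrite !dfwithin.
    by rewrite !dfwithout // xpair_eqE negb_and xx'.
  rewrite dfwithout //; congr pure; apply/funext=> x'.
  by rewrite dfwithout // xpair_eqE negb_and yy' orbT.
by rewrite !E pure_multilinear pure_multilinear.
Qed.

(* tens_curry is the canonical isomorphism when Y is finite, and the tensor
   power \bigotimes_(y in Y) n is transported along its inverse. *)
Definition tens_pow (X Y : choiceType) (n : tens M X) : tens M (X * Y)%type :=
  xget 0 [set t | tens_curry t = pure (fun _ : Y => n)].

End TensorMaps.

HB.mixin Record isTopologicalGroup G & Topological G & Group G := {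
  mulg_continuous : continuous (fun x : G * G => (x.1 * x.2)%g);
  invg_continuous : continuous (fun x : G => (x^-1)%g)
}.

#[short(type="topologicalGroupType")]
HB.structure Definition TopologicalGroup :=
  {G of Topological G & Group G & isTopologicalGroup G}.

Definition profinite (G : topologicalGroupType) : Prop :=
  [/\ compact [set: G], hausdorff_space G & totally_disconnected [set: G]].

Section Cosets.
Variable G : groupType.
Implicit Types (A U V C : set G) (g a : G).

Definition lcoset g A : set G := [set (g * a)%g | a in A].
Definition rcoset A g : set G := [set (a * g)%g | a in A].
Definition conjs g A : set G := [set (g * a * g^-1)%g | a in A].

Lemma conjsK g A : A = conjs g (conjs g^-1%g A).
Proof.
apply/seteqP; split=> x.
  move=> Ax; exists (g^-1 * x * g)%g.
    by exists x => //; rewrite invgK.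
  by rewrite !mulgA mulgV mul1g -mulgA mulgV mulg1.
by move=> [_ [a Aa <-] <-]; rewrite invgK !mulgA mulgV mul1g -mulgA mulgV mulg1.
Qed.

Definition lcosets A U : set (set G) := [set lcoset a U | a in A].

Definition coset A U : choiceType := {C : set G | C \in lcosets A U}.

Fact coset_shift_proof g V V' (e : V' = conjs g V) (D : coset setT V') :
  rcoset (val D) g \in lcosets setT V.
Proof.
case: D => D /= /set_mem [a _ <-]; apply/mem_set; exists (a * g)%g => //.
rewrite e; apply/seteqP; split=> x.
  move=> [v Vv <-].
  exists (a * (g * v * g^-1))%g; last by rewrite !mulgA mulgVK.
  by exists (g * v * g^-1)%g => //; exists v.
by move=> [_ [_ [v Vv <-] <-] <-]; exists v => //; rewrite !mulgA mulgVK.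
Qed.

(* a(gVg^-1) |-> agV *)
Definition coset_shift g V V' (e : V' = conjs g V) (D : coset setT V') :
  coset setT V := exist _ (rcoset (val D) g) (coset_shift_proof e D).

Fact coset_comb_proof (rep : set G -> G) V U (CD : coset setT V * coset V U) :
  lcoset (rep (val CD.1)) (val CD.2) \in lcosets setT U.
Proof.
case: CD => C [D /= /set_mem [s _ <-]]; apply/mem_set.
exists (rep (val C) * s)%g => //; apply/seteqP; split=> x.
  by move=> [u Uu <-]; exists (s * u)%g; [exists u | rewrite mulgA].
by move=> [_ [u Uu <-] <-]; exists u => //; rewrite mulgA.
Qed.

(* (g_i V, sU) |-> g_i sU *)
Definition coset_comb (rep : set G -> G) V U (CD : coset setT V * coset V U) :
  coset setT U :=
  exist _ (lcoset (rep (val CD.1)) (val CD.2)) (coset_comb_proof rep CD).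

(* The left translation M^{(x) G/V} -> M^{(x) G/V'} by g, where V' = gVg^-1. *)
Definition tens_act (R : comPzRingType) (M : lmodType R) g V V'
    (e : V' = conjs g V) : tens M (coset setT V) -> tens M (coset setT V') :=
  tens_reindex (coset_shift e).

Definition tens_comb (R : comPzRingType) (M : lmodType R) (rep : set G -> G)
    V U : tens M (coset setT V * coset V U)%type -> tens M (coset setT U) :=
  tens_bij (@coset_comb rep V U).

(* (H/V)^U *)
Definition fixed_cosets (H V U : set G) : set (set G) :=
  [set C | exists h, [/\ H h, C = lcoset h V & conjs h^-1%g U `<=` V]].

End Cosets.

Definition open_subgroup (G : topologicalGroupType) (U : set G) : Prop :=
  [/\ open U, U 1%g, forall x y, U x -> U y -> U (x * y)%g
    & forall x, U x -> U x^-1%g].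

Record truncation_set (G : topologicalGroupType) (H : set G)
    (S : set (set G)) : Prop := TruncationSet {
  trunc_sub : forall U, S U -> open_subgroup U /\ U `<=` H;
  trunc_up : forall U V,
    S U -> open_subgroup V -> U `<=` V -> V `<=` H -> S V;
  trunc_conj : forall U h, S U -> H h -> S (conjs h U)
}.

Record category := Category {
  obj :> Type;
  mor : obj -> obj -> Type;
  idc : forall A, mor A A;
  compc : forall A B C, mor B C -> mor A B -> mor A C;
  comp1c : forall A B (f : mor A B), compc (idc B) f = f;
  compc1 : forall A B (f : mor A B), compc f (idc A) = f;
  compA : forall A B C D (f : mor A B) (g : mor B C) (h : mor C D),
    compc h (compc g f) = compc (compc h g) f
}.
Arguments mor {c}.
Arguments idc {c}.
Arguments compc {c A B C}.

Definition inverses (C : category) (A B : C) (f : mor A B) (g : mor B A) :=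
  compc g f = idc A /\ compc f g = idc B.
Definition is_iso (C : category) (A B : C) (f : mor A B) :=
  exists g, inverses f g.
Definition isomorphic (C : category) (A B : C) :=
  exists f : mor A B, is_iso f.

Definition is_coequaliser (C : category) (A B Q : C) (f g : mor A B)
    (e : mor B Q) : Prop :=
  compc e f = compc e g /\
  forall (D : C) (h : mor B D), compc h f = compc h g ->
    exists! k : mor Q D, compc k e = h.

Record functor (C D : category) := Functor {
  funct_obj :> C -> D;
  funct_map : forall A B, mor A B -> mor (funct_obj A) (funct_obj B);
  funct_id : forall A, funct_map (idc A) = idc (funct_obj A);
  funct_comp : forall A B E (f : mor A B) (g : mor B E),
    funct_map (compc g f) = compc (funct_map g) (funct_map f)
}.
Arguments funct_map {C D} _ {A B}.

Definition preserves_reflexive_coequalisers (C D : category)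
    (F : functor C D) : Prop :=
  forall (A B Q : C) (f g : mor A B) (e : mor B Q),
    (exists s : mor B A, compc f s = idc B /\ compc g s = idc B) ->
    is_coequaliser f g e ->
    is_coequaliser (funct_map F f) (funct_map F g) (funct_map F e).

Record nat_trans (C D : category) (F F' : functor C D) := NatTrans {
  ntc :> forall A, mor (F A) (F' A);
  ntc_nat : forall A B (f : mor A B),
    compc (ntc B) (funct_map F f) = compc (funct_map F' f) (ntc A)
}.

Definition is_nat_iso (C D : category) (F F' : functor C D)
    (u : nat_trans F F') : Prop :=
  forall A, is_iso (u A).

Record mod_obj := ModObj {
  base_ring : comPzRingType;
  module :> lmodType base_ring
}.

Record mod_hom (A B : mod_obj) := ModHom {
  ring_map : {rmorphism base_ring A -> base_ring B};
  module_map : {additive A -> B};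
  module_mapZ : forall r m, module_map (r *: m) = ring_map r *: module_map m
}.

Lemma rmorphism_ext (R R' : comPzRingType) (f g : {rmorphism R -> R'}) :
  f =1 g -> f = g.
Proof.
case: f => f [[f1] [f2]]; case: g => g [[g1] [g2]] /= /funext fg.
case: _ / fg in g1 g2 *.
by rewrite (Prop_irrelevance f1 g1) (Prop_irrelevance f2 g2).
Qed.

Lemma additive_ext (U V : zmodType) (f g : {additive U -> V}) :
  f =1 g -> f = g.
Proof.
case: f => f [[f1]]; case: g => g [[g1]] /= /funext fg.
by case: _ / fg in g1 *; rewrite (Prop_irrelevance f1 g1).
Qed.

Lemma mod_hom_ext (A B : mod_obj) (f g : mod_hom A B) :
  ring_map f =1 ring_map g -> module_map f =1 module_map g -> f = g.
Proof.
case: f => f f' fZ; case: g => g g' gZ /= /rmorphism_ext fg /additive_ext fg'.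
case: _ / fg in gZ *; case: _ / fg' in gZ *.
by rewrite (Prop_irrelevance fZ gZ).
Qed.

Definition mod_id (A : mod_obj) : mod_hom A A :=
  @ModHom A A idfun idfun (fun _ _ => erefl).

Fact mod_comp_proof (A B C : mod_obj) (g : mod_hom B C) (f : mod_hom A B) r m :
  (module_map g \o module_map f) (r *: m) =
  (ring_map g \o ring_map f) r *: (module_map g \o module_map f) m.
Proof. by rewrite /= !module_mapZ. Qed.

Definition mod_comp (A B C : mod_obj) (g : mod_hom B C) (f : mod_hom A B) :
    mod_hom A C :=
  @ModHom A C (ring_map g \o ring_map f) (module_map g \o module_map f)
    (mod_comp_proof g f).

Definition Mod : category.
Proof.
by apply: (@Category mod_obj mod_hom mod_id mod_comp) => *; exact: mod_hom_ext.
Defined.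

(* (Z[X]; Z[X](Y)) : the polynomial ring is the monoid algebra of the
   commutative monomials in X, the free module the finitely supported
   functions from Y. *)
Definition polyZ (X : choiceType) : comPzRingType := malg (cmonom X) int.
Definition free_mod (X Y : choiceType) : Mod :=
  @ModObj (polyZ X) (malg Y (malg (cmonom X) int)).
Definition is_free (A : Mod) : Prop :=
  exists X Y : choiceType, isomorphic A (free_mod X Y).

Record ab_haus_obj := AbHausObj {
  ab_group :> topologicalZmodType;
  ab_hausdorff : hausdorff_space ab_group
}.

Record ab_haus_hom (A B : ab_haus_obj) := AbHausHom {
  ab_map :> {additive A -> B};
  ab_continuous : continuous ab_map
}.

Lemma ab_haus_hom_ext (A B : ab_haus_obj) (f g : ab_haus_hom A B) :
  f =1 g -> f = g.
Proof.
case: f => f fc; case: g => g gc /= /additive_ext fg.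
by case: _ / fg in gc *; rewrite (Prop_irrelevance fc gc).
Qed.

Definition ab_haus_id (A : ab_haus_obj) : ab_haus_hom A A :=
  @AbHausHom A A idfun (fun x => cvg_id).

Definition ab_haus_comp (A B C : ab_haus_obj) (g : ab_haus_hom B C)
    (f : ab_haus_hom A B) : ab_haus_hom A C :=
  @AbHausHom A C (g \o f)
    (fun x => continuous_comp (@ab_continuous _ _ f x)
                              (@ab_continuous _ _ g (f x))).

Definition AbHaus : category.
Proof.
apply: (@Category ab_haus_obj ab_haus_hom ab_haus_id ab_haus_comp) => *;
  exact: ab_haus_hom_ext.
Defined.

Definition tens_map (A B : Mod) (f : mor A B) (X : choiceType) :
    tens A X -> tens B X :=
  tens_lift (ring_map f) (fun m => pure (module_map f \o m)).

Definition quotient_map (A B : topologicalType) (f : A -> B) : Prop :=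
  (forall y, exists x, f x = y) /\
  forall O : set B, open O <-> open (f @^-1` O).

Definition embedding (A B : topologicalType) (f : A -> B) : Prop :=
  injective f /\
  forall O : set A, open O <-> exists2 O' : set B, open O' & O = f @^-1` O'.

Section Ghost.
Variables (G : topologicalGroupType) (H : set G) (S : set (set G)).

(* A set of representatives of the H-conjugacy classes in S, and coset
   representatives rep V C for the cosets C in G/V. *)
Record ghost_choice := GhostChoice {
  reps : set (set G);
  reps_sub : reps `<=` S;
  reps_uniq : forall U, S U ->
    exists! V, reps V /\ exists2 h, H h & V = conjs h U;
  rep : set G -> set G -> G;
  rep_coset : forall V C, reps V -> lcosets setT V C -> C (rep V C)
}.

(* \prod_(V in T) M^{(x) G/V} *)
Definition tens_prod (T : set (set G)) (A : Mod) : topologicalType :=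
  prod_topology (fun V : T => tens A (coset setT (val V))).

Definition tens_prod_map (T : set (set G)) (A B : Mod) (f : mor A B)
    (n : tens_prod T A) : tens_prod T B :=
  fun V => tens_map f (n V).

Definition H_fixed (A : Mod) (x : tens_prod S A) : Prop :=
  forall h, H h -> forall (U U' : S) (e : val U' = conjs h (val U)),
    x U' = tens_act e (x U).

(* The summand does not depend on the representative h of the coset C; for
   open U only finitely many V contribute. *)
Definition ghost (c : ghost_choice) (A : Mod) (n : tens_prod (reps c) A) :
    tens_prod S A :=
  fun U => \sum_(V \in [set: set_type (reps c)])
    \sum_(C \in fixed_cosets H (val V) (val U))
      let h := xget 1%g C in
      tens_act (conjsK h (val U))
        (tens_comb (rep c (val V))
          (tens_pow (coset (val V) (conjs h^-1%g (val U))) (n V))).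

Record is_witt (c : ghost_choice) (W : functor Mod AbHaus)
    (q : forall A : Mod, tens_prod (reps c) A -> W A)
    (w : forall A : Mod, W A -> tens_prod S A) : Prop := IsWitt {
  q_quotient : forall A, quotient_map (q A);
  q_natural : forall (A B : Mod) (f : mor A B) n,
    q B (tens_prod_map f n) = funct_map W f (q A n);
  w_ghost : forall A n, w A (q A n) = ghost n;
  w_fixed : forall A x, H_fixed (w A x);
  w_additive : forall A x y U, w A (x + y) U = w A x U + w A y U;
  w_continuous : forall A, continuous (w A);
  w_natural : forall (A B : Mod) (f : mor A B) x,
    w B (funct_map W f x) = tens_prod_map f (w A x);
  w_embedding : forall A, is_free A -> embedding (w A);
  W_coequalisers : preserves_reflexive_coequalisers W
}.

End Ghost.

(* Main.v *)
(* The ghost map out of a free object is determined by its image, which does not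
   depend on the choices: an H-fixed x is a ghost vector if and only if, for every
   U in S and every labelling y of G/U by basis elements, the y-coefficients of x at
   the subgroups between U and N_H(U) that are cyclic over U satisfy a divisibility
   of the kind of Dwork's lemma, by the order of the stabiliser of y in N_H(U)/U
   (necklace_congruence gives necessity; sufficiency is a correction by induction on
   the index of U).  These congruences are additive, so the image is a group, and the
   correction is local, so the ghost map is open onto its image.

   For arbitrary A, let W A be the image of the ghost map of the free object freeM A
   on the elements of A, modulo the closed subgroup generated by the differences
   ghost x - ghost y for x, y with the same image over A.  A splitting of
   freeM A -> A turns the ghost map of W A into an embedding for free A.  Reflexive
   coequalisers are preserved because the tensor powers of a reflexive coequaliser
   are exact on underlying sets.  Uniqueness holds on free objects, where both
   functors are the same subgroup of the ghost side, and extends to A along the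
   reflexive coequaliser freeM (freeM A) => freeM A -> A. *)

From HB Require Import structures.
From mathcomp Require Import all_boot all_fingroup.
Require Import Defs.
From mathcomp Require Import all_boot all_order all_algebra.
From mathcomp Require Import finmap.
From mathcomp.multinomials Require Import -(notations) monalg.
From mathcomp Require Import all_classical topology_structure compact.
From mathcomp Require Import initial_topology supremum_topology.
From mathcomp Require Import separation_axioms function_spaces.
From mathcomp Require Import discrete_topology product_topology quotient_topology tvs.

Set Implicit Arguments.
Unset Strict Implicit.
Unset Printing Implicit Defensive.

Import GRing.Theory.

Local Open Scope quotient_scope.
Local Open Scope classical_set_scope.
Local Open Scope ring_scope.

(** The obstacle is that [ghost] is not additive, so sums in W have to be computed through its
    image, and that the image is a group can only come from a description without choices. Cyclic
    groups enter through Cauchy-Frobenius counting: a labelling of G/U fixed by p in N_H(U)/U is a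
    labelling of the p-orbits, that is of G/W with W the group generated over U by a lift of p. As
    N_H(U)/U acts freely, each orbit has #[p] points and a product of monomials constant on orbits
    is a #[p]-th power; the operation [psi] of Z[X] accounts for these powers. The order of the
    stabiliser is the right modulus because the component at V enters coordinate V as the sum of its
    translates under N_H(V)/V, and an invariant tensor is such a sum exactly when each y-coefficient
    is divisible by the order of the stabiliser of y. Closing the subgroup of relations makes W
    Hausdorff, but a map out of W must then respect limits of relations. Openness of the ghost map
    onto its image handles this: a limit on the ghost side is replaced by a nearby relation with a
    nearby preimage. *)

Section FiniteChoice.
Variables (Y : choiceType) (finY : finite_set [set: Y]).

Let s : seq Y := finmap.enum_fset (fset_set [set: Y]).

Let sP y : y \in s. Proof. by rewrite in_fset_set // in_setT. Qed.

Let sK : pcancel (index^~ s) (onth s).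
Proof. by move=> y; rewrite onthE (nth_map y) ?nth_index ?index_mem // sP. Qed.

Let s_axiom : Finite.axiom s.
Proof. by move=> y; rewrite count_uniq_mem ?sP //; exact: finmap.fset_uniq. Qed.

Definition fin_of : finType :=
  HB.pack (Choice.sort Y) (Choice_isCountable.Build Y sK) (isFinite.Build Y s_axiom).

End FiniteChoice.

(** Lets tensor identities over a finite index type be proved for a [finType], where sums over
    finite functions exist, without transport along a bijection: once Y is destructed, its structure
    is convertible to that of [fin_of finY]. *)
Lemma finite_choice_ind (P : choiceType -> Prop) :
  (forall F : finType, P F) ->
  forall Y : choiceType, finite_set [set: Y] -> P Y.
Proof.
move=> PF [T [hC hE]] finY; set Y := Choice.Pack _ in finY *.
exact: (PF (fin_of finY)).
Qed.

Section AdditiveMorph.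
Variables (V W : zmodType) (f : V -> W) (fD : {morph f : x y / x + y}).

Lemma morphD0 : f 0 = 0.
Proof. by apply: (addIr (f 0)); rewrite -fD !add0r. Qed.

Lemma morphDN x : f (- x) = - f x.
Proof. by apply: (addIr (f x)); rewrite -fD !addNr morphD0. Qed.

Lemma morphDB x y : f (x - y) = f x - f y.
Proof. by rewrite fD morphDN. Qed.

Lemma morphD_sum (I : Type) (r : seq I) (P : pred I) (F : I -> V) :
  f (\sum_(i <- r | P i) F i) = \sum_(i <- r | P i) f (F i).
Proof. exact: (big_morph f fD morphD0). Qed.

Lemma morphD_mulrn x n : f (x *+ n) = f x *+ n.
Proof. by elim: n => [|n IH]; rewrite ?morphD0 // !mulrS fD IH. Qed.

Lemma morphD_fsum (I : choiceType) (A : set I) (F : I -> V) : finite_set A ->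
  f (\sum_(i \in A) F i) = \sum_(i \in A) f (F i).
Proof. by move=> finA; rewrite !fsbig_finite // morphD_sum. Qed.

End AdditiveMorph.

(** * Induction, reindexing and base change for tensors *)

Section TensGeneral.
Variables (R : comPzRingType) (M : lmodType R).

(** Summands indexed by an ordinal allow tensor powers to be expanded over finite functions into
    ['I_n]. *)
Lemma tens_decomp (X : choiceType) (t : tens M X) :
  exists n (r : 'I_n -> R) (m : 'I_n -> X -> M),
    t = \sum_(i < n) r i *: pure (m i).
Proof.
have [s ->] := tensW t.
exists (size s), (fun i => (tnth (in_tuple s) i).1),
  (fun i => (tnth (in_tuple s) i).2).
rewrite -(big_tuple _ _ (in_tuple s) xpredT (fun p => p.1 *: pure p.2)) /=.
elim: s => [|[a m] s IHs]; first by rewrite big_nil.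
rewrite big_cons -IHs.
have <- := @tens_addE R M X [:: (a, m)] s; congr (_ + _).
by rewrite [RHS]tens_scaleE /expr_scale /= mulr1.
Qed.

Lemma tens_ind (X : choiceType) (P : tens M X -> Prop) :
  P 0 -> (forall t u, P t -> P u -> P (t + u)) ->
  (forall a m, P (a *: pure m)) -> forall t, P t.
Proof.
move=> P0 PD Pp t; have [n [r [m ->]]] := tens_decomp t.
by elim/big_ind: _.
Qed.

End TensGeneral.

Lemma tens_ext (R : comPzRingType) (M : lmodType R) (X : choiceType)
    (W : zmodType) (f g : tens M X -> W) :
  {morph f : x y / x + y} -> {morph g : x y / x + y} ->
  (forall a m, f (a *: pure m) = g (a *: pure m)) -> f =1 g.
Proof.
move=> fD gD fg; apply: tens_ind => //; first by rewrite !morphD0.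
by move=> t u ft fu; rewrite fD gD ft fu.
Qed.

(* dfwith is dependently typed; this is its pointwise description for
   functions into a fixed type. *)
Lemma dfwithE (X : eqType) (M : Type) (m : X -> M) x a y :
  dfwith m x a y = if y == x then a else m y.
Proof.
by have [->|yx] := eqVneq y x; rewrite ?dfwithin // dfwithout // eq_sym.
Qed.

Section Reindex.
Variables (R : comPzRingType) (M : lmodType R).

Section Bij.
Variables (X Y : choiceType) (psi : Y -> X) (psiB : bijective psi).

Lemma reindex_multilinear :
  multilinear idfun (fun m : X -> M => pure (m \o psi)).
Proof.
case: psiB => phi psiK phiK m x c a b.
have E z : dfwith m x z \o psi = dfwith (m \o psi) (phi x) z.
  by apply/funext => y /=; rewrite !dfwithE /= -(can2_eq psiK phiK).
by rewrite !E pure_multilinear.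
Qed.

Lemma tens_reindexD : {morph @tens_reindex R M _ _ psi : t u / t + u}.
Proof. exact: (tens_liftD reindex_multilinear). Qed.

Lemma tens_reindexZ a t :
  tens_reindex psi (a *: t) = a *: tens_reindex psi t :> tens M Y.
Proof. exact: (tens_liftZ reindex_multilinear). Qed.

Lemma tens_reindex_pure m :
  tens_reindex psi (pure m) = pure (m \o psi) :> tens M Y.
Proof. exact: (tens_lift_pure reindex_multilinear). Qed.

End Bij.

Lemma tens_reindex_comp (X Y Z : choiceType) (psi : Y -> X) (chi : Z -> Y)
    (t : tens M X) : bijective psi -> bijective chi ->
  tens_reindex chi (tens_reindex psi t) = tens_reindex (psi \o chi) t.
Proof.
move=> psiB chiB; have compB := bij_comp psiB chiB; move: t.
apply: tens_ext; try by move=> t u; rewrite !tens_reindexD.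
by move=> a m; rewrite !tens_reindexZ // !tens_reindex_pure.
Qed.

(** For a bijection the value chosen by [xget] in [tens_bij] is the only candidate and the default 0
    never occurs. *)
Lemma tens_bijE (X Y : choiceType) (phi : X -> Y) (psi : Y -> X) :
  cancel phi psi -> cancel psi phi ->
  @tens_bij R M _ _ phi = tens_reindex psi.
Proof.
move=> phiK psiK; rewrite /tens_bij /tens_reindex; congr (tens_lift _ _).
apply/funext => m; congr pure; apply/funext => y /=.
case: xgetP => [z -> [x /= <- <-]|/(_ (m (psi y))) []]; first by rewrite phiK.
by exists (psi y) => //=; rewrite psiK.
Qed.

End Reindex.

Section TensMap.
Variables (A B : Mod) (f : mor A B) (X : choiceType).

Lemma map_multilinear :
  multilinear (ring_map f) (fun m : X -> A => pure (module_map f \o m)).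
Proof.
move=> m x c a b.
have E z : module_map f \o dfwith m x z = dfwith (module_map f \o m) x (module_map f z).
  by apply/funext => y /=; rewrite !dfwithE; case: ifP.
by rewrite !E raddfD module_mapZ pure_multilinear.
Qed.

Lemma tens_mapD : {morph @tens_map A B f X : t u / t + u}.
Proof. exact: (tens_liftD map_multilinear). Qed.

Lemma tens_mapZ a t : @tens_map A B f X (a *: t) = ring_map f a *: tens_map f t.
Proof. exact: (tens_liftZ map_multilinear). Qed.

Lemma tens_map_pure m :
  @tens_map A B f X (pure m) = pure (module_map f \o m).
Proof. exact: (tens_lift_pure map_multilinear). Qed.

Lemma tens_map_surj :
  (forall r, exists r', ring_map f r' = r) ->
  (forall m, exists m', module_map f m' = m) ->
  forall t, exists u, @tens_map A B f X u = t.
Proof.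
move=> fr fm; apply: tens_ind.
- by exists 0; rewrite (morphD0 tens_mapD).
- by move=> _ _ [t <-] [u <-]; exists (t + u); rewrite tens_mapD.
- move=> a m; have [b <-] := fr a.
  have [m' m'E] := choice (fun x => fm (m x)).
  exists (b *: pure m'); rewrite tens_mapZ tens_map_pure; congr (_ *: pure _).
  exact/funext.
Qed.

End TensMap.

Lemma tens_map_id (A : Mod) (X : choiceType) (t : tens A X) :
  tens_map (idc A) t = t.
Proof.
move: t; apply: tens_ind => [|t u tE uE|a m]; first by rewrite (morphD0 (@tens_mapD _ _ _ _)).
  by rewrite tens_mapD tE uE.
by rewrite tens_mapZ tens_map_pure.
Qed.

Lemma tens_map_comp (A B C : Mod) (f : mor A B) (g : mor B C) (X : choiceType)
    (t : tens A X) : tens_map (compc g f) t = tens_map g (tens_map f t).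
Proof.
move: t; apply: tens_ext; try by move=> t u; rewrite !tens_mapD.
by move=> a m; rewrite !(tens_mapZ, tens_map_pure).
Qed.

Lemma tens_map_reindex (A B : Mod) (f : mor A B) (X Y : choiceType)
    (psi : Y -> X) (t : tens A X) : bijective psi ->
  tens_map f (tens_reindex psi t) = tens_reindex psi (tens_map f t).
Proof.
move=> psiB; move: t.
apply: tens_ext; try by move=> t u; rewrite !(tens_mapD, tens_reindexD).
by move=> a m;
  rewrite !(tens_mapZ, tens_reindexZ, tens_map_pure, tens_reindex_pure).
Qed.

(** * Tensor powers of tensors *)

Section Multilinear.
Variables (R : comPzRingType) (P Q : lmodType R) (F : finType).
Variables (Phi : (F -> P) -> Q) (PhiP : multilinear idfun Phi).

Lemma multilinear0 m x : m x = 0 -> Phi m = 0.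
Proof.
move=> mx0; have <- : dfwith m x 0 = m.
  by apply/funext => y; rewrite dfwithE; case: eqP => [->|].
have := PhiP m x (-1) 0 0; rewrite scaler0 addr0 => ->.
by rewrite scaleN1r addNr.
Qed.

Lemma multilinear_sum m x n (u : 'I_n -> P) :
  Phi (dfwith m x (\sum_(i < n) u i)) = \sum_(i < n) Phi (dfwith m x (u i)).
Proof.
apply: (big_morph (fun a => Phi (dfwith m x a))) => [a b|].
  by have := PhiP m x 1 a b; rewrite /= !scale1r.
by apply: (@multilinear0 _ x); rewrite dfwithE eqxx.
Qed.

Lemma multilinear_expand n (u : 'I_n -> F -> P) :
  Phi (fun y => \sum_(i < n) u i y) =
  \sum_(phi : {ffun F -> 'I_n}) Phi (fun y => u (phi y) y).
Proof.
(* Arguments outside s are frozen at w, and phi is prescribed there by phi0, so each choice on s is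
   counted once although phi ranges over functions on all of F. *)
have key (s : seq F) : uniq s -> forall (w : F -> P) (phi0 : {ffun F -> 'I_n}),
    Phi (fun y => if y \in s then \sum_(i < n) u i y else w y) =
    \sum_(phi : {ffun F -> 'I_n} | [forall y, (y \notin s) ==> (phi y == phi0 y)])
      Phi (fun y => if y \in s then u (phi y) y else w y).
  elim: s => [_|y0 s IHs /andP[y0s us]] w phi0.
    rewrite (big_pred1 phi0) // => phi; apply/forallP/eqP => /= [E|->] //.
    by apply/ffunP => y; apply/eqP/E.
  have -> : (fun y => if y \in y0 :: s then \sum_(i < n) u i y else w y) =
      dfwith (fun y => if y \in s then \sum_(i < n) u i y else w y) y0
        (\sum_(i < n) u i y0).
    by apply/funext => y; rewrite dfwithE inE; case: eqP => [->|].
  rewrite multilinear_sum (partition_big (fun phi : {ffun F -> 'I_n} => phi y0) xpredT) //=.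
  apply: eq_bigr => i _.
  have -> : dfwith (fun y => if y \in s then \sum_(i < n) u i y else w y) y0 (u i y0)
      = (fun y => if y \in s then \sum_(i < n) u i y else (if y == y0 then u i y0 else w y)).
    apply/funext => y; rewrite dfwithE; case: eqP => // ->.
    by rewrite (negPf y0s).
  rewrite (IHs us _ [ffun y => if y == y0 then i else phi0 y]).
  apply: eq_big => [phi|phi phiP].
    apply/idP/idP => [/forallP E|/andP[/forallP E /eqP <-]].
      apply/andP; split; last by have := E y0; rewrite y0s ffunE eqxx.
      apply/forallP => y; have := E y; rewrite inE ffunE negb_or.
      by case: (eqVneq y y0).
    apply/forallP => y; have := E y; rewrite inE ffunE negb_or.
    by case: (eqVneq y y0) => [->|//] /= _; rewrite eqxx implybT.
  congr Phi; apply/funext => y; rewrite inE; case: eqP => [->|] //=.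
  rewrite (negPf y0s); have /forallP/(_ y0) := phiP.
  by rewrite y0s ffunE eqxx => /eqP ->.
have [phi0 _|no] := pickP {: {ffun F -> 'I_n}}.
  have := key (enum F) (enum_uniq F) (fun=> 0) phi0.
  under eq_bigl => phi.
    have -> : [forall y, (y \notin enum F) ==> (phi y == phi0 y)] = true.
      by apply/forallP => y; rewrite mem_enum.
    over.
  have -> : (fun y => if y \in enum F then \sum_(i < n) u i y else 0) =
     (fun y => \sum_(i < n) u i y) by apply/funext => y; rewrite mem_enum.
  move=> ->; apply: eq_bigr => phi _; congr Phi; apply/funext => y.
  by rewrite mem_enum.
(* If no function from F to ['I_n] exists, then n = 0 and F is inhabited, so Phi has a zero
   argument. *)
rewrite big_pred0; last by move=> phi; have := no phi.
have [x _|noF] := pickP F; last first.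
  have F0 : F -> False by move=> x; have := noF x.
  by have := no [ffun x => False_rect _ (F0 x)].
apply: (@multilinear0 _ x); case: n u no key => [|n] u no _; first by rewrite big_ord0.
by have := no [ffun _ => ord0].
Qed.

Lemma multilinear_scale (r : F -> R) (u : F -> P) :
  Phi (fun y => r y *: u y) = (\prod_y r y) *: Phi u.
Proof.
have key (s : seq F) : uniq s ->
    Phi (fun y => if y \in s then r y *: u y else u y) = (\prod_(y <- s) r y) *: Phi u.
  elim: s => [_|y0 s IHs /andP[y0s us]]; first by rewrite big_nil scale1r.
  rewrite big_cons -scalerA -IHs //.
  have -> : (fun y => if y \in y0 :: s then r y *: u y else u y) =
      dfwith (fun y => if y \in s then r y *: u y else u y) y0 (r y0 *: u y0 + 0).
    by apply/funext => y; rewrite dfwithE inE addr0; case: eqP => [->|].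
  rewrite PhiP [X in _ + X](@multilinear0 _ y0) ?addr0 /=; last by rewrite dfwithE eqxx.
  congr (_ *: Phi _); apply/funext => y; rewrite dfwithE; case: eqP => // ->.
  by rewrite (negPf y0s).
rewrite -[RHS]/((\prod_(y <- index_enum F) r y) *: _).
rewrite -key ?index_enum_uniq //; congr Phi; apply/funext => y.
by rewrite mem_index_enum.
Qed.

End Multilinear.

Section Merge.
Variables (R : comPzRingType) (M : lmodType R) (X : choiceType).

Section Fold.
Variable Y : choiceType.

Let upd (m : X * Y -> M) (y : Y) (mx : X -> M) : X * Y -> M :=
  fun p => if p.2 == y then mx p.1 else m p.

(** The tensors n y are expanded by the universal property one column y at a time, m recording the
    columns already chosen. *)
Fixpoint merge_fold (ys : seq Y) (n : Y -> tens M X) (m : X * Y -> M) :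
    tens M (X * Y)%type :=
  if ys is y :: ys' then
    tens_lift idfun (fun mx => merge_fold ys' n (upd m y mx)) (n y)
  else pure m.

(** No multilinearity is involved, because [tens_lift] sums over one fixed representative of t. *)
Lemma tens_lift_combination (P : lmodType R) (c : R)
    (phi1 phi2 : (X -> M) -> P) (t : tens M X) :
  tens_lift idfun (fun m => c *: phi1 m + phi2 m) t =
  c *: tens_lift idfun phi1 t + tens_lift idfun phi2 t.
Proof.
rewrite /tens_lift scaler_sumr -big_split /=; apply: eq_bigr => p _.
by rewrite scalerDr !scalerA mulrC.
Qed.

(** Column y is never overwritten, so changing an entry in it commutes with all later updates, and
    linearity passes through each lift. *)
Lemma merge_fold_factor ys n (m : X * Y -> M) x y (c : R) (a b : M) : y \notin ys ->
  merge_fold ys n (dfwith m (x, y) (c *: a + b)) =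
  c *: merge_fold ys n (dfwith m (x, y) a) + merge_fold ys n (dfwith m (x, y) b).
Proof.
elim: ys m => [|y' ys IHs] m /=; first by rewrite pure_multilinear.
rewrite inE negb_or => /andP[yy' yys]; rewrite -tens_lift_combination.
congr (tens_lift _ _ _); apply/funext => mx.
have E z : upd (dfwith m (x, y) z) y' mx = dfwith (upd m y' mx) (x, y) z.
  apply/funext => p; rewrite /upd !dfwithE /=; case: eqP => [py'|//].
  by case: eqP => // pE; move: yy'; rewrite -py' pE eqxx.
by rewrite !E IHs.
Qed.

Lemma merge_fold_multilinear ys n m y : y \notin ys ->
  multilinear idfun (fun mx => merge_fold ys n (upd m y mx)).
Proof.
move=> yys mx x c a b.
have E z : upd m y (dfwith mx x z) = dfwith (upd m y mx) (x, y) z.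
  apply/funext => -[x' y']; rewrite /upd !dfwithE /= xpair_eqE.
  by case: (eqVneq y' y); rewrite ?andbF ?andbT.
by rewrite !E merge_fold_factor.
Qed.

Lemma merge_fold_out ys (n : Y -> tens M X) m y (z : tens M X) : y \notin ys ->
  merge_fold ys (dfwith n y z) m = merge_fold ys n m.
Proof.
elim: ys m => [|y' ys IHs] m //=; rewrite inE negb_or => /andP[yy' yys].
rewrite dfwithE eq_sym (negPf yy'); congr (tens_lift _ _ _).
by apply/funext => mx; rewrite IHs.
Qed.

Lemma merge_fold_in ys (n : Y -> tens M X) m y (c : R) (a b : tens M X) : uniq ys -> y \in ys ->
  merge_fold ys (dfwith n y (c *: a + b)) m =
  c *: merge_fold ys (dfwith n y a) m + merge_fold ys (dfwith n y b) m.
Proof.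
elim: ys m => [|y' ys IHs] m //= /andP[y'ys us]; rewrite inE.
case: (eqVneq y y') => [-> _|yy' /= yys].
  have E z : (fun mx => merge_fold ys (dfwith n y' z) (upd m y' mx)) =
             (fun mx => merge_fold ys n (upd m y' mx)).
    by apply/funext => mx; rewrite merge_fold_out.
  rewrite !E !dfwithE eqxx tens_liftD ?tens_liftZ //; exact: merge_fold_multilinear.
rewrite !dfwithE eq_sym (negPf yy') -tens_lift_combination.
by congr (tens_lift _ _ _); apply/funext => mx; rewrite IHs.
Qed.

Lemma merge_fold_pure ys (p : Y -> X -> M) m : uniq ys ->
  merge_fold ys (fun y => pure (p y)) m =
  pure (fun xy => if xy.2 \in ys then p xy.2 xy.1 else m xy).
Proof.
elim: ys m => [|y ys IHs] m /=; first by move=> _; congr pure; apply/funext => -[].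
move=> /andP[yys us]; rewrite tens_lift_pure; last exact: merge_fold_multilinear.
rewrite IHs //; congr pure; apply/funext => -[x y']; rewrite /upd inE /=.
by case: eqP => [->|//] /=; rewrite (negPf yys).
Qed.

End Fold.

Variable F : finType.

(* The inverse of tens_curry on pure tensors. *)
Definition tens_merge (n : F -> tens M X) : tens M (X * F)%type :=
  merge_fold (enum F) n (fun=> 0).

Lemma merge_multilinear : multilinear idfun tens_merge.
Proof.
move=> n y c a b.
by rewrite /tens_merge merge_fold_in ?enum_uniq ?mem_enum.
Qed.

Lemma merge_pure (p : F -> X -> M) :
  tens_merge (fun y => pure (p y)) = pure (fun xy => p xy.2 xy.1).
Proof.
rewrite /tens_merge merge_fold_pure ?enum_uniq //; congr pure.
by apply/funext => xy; rewrite mem_enum.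
Qed.

Lemma curry_multilinear :
  multilinear idfun (fun m : X * F -> M => pure (fun y => pure (fun x => m (x, y)))).
Proof.
move=> m [x y] c a b.
have E z : (fun y' => pure (fun x' => dfwith m (x, y) z (x', y'))) =
    dfwith (fun y' => pure (fun x' => m (x', y'))) y
      (pure (dfwith (fun x' => m (x', y)) x z)).
  apply/funext => y'; rewrite dfwithE; case: eqP => [->|/eqP yy'].
    by congr pure; apply/funext => x'; rewrite !dfwithE xpair_eqE eqxx andbT.
  by congr pure; apply/funext=> x'; rewrite dfwithE xpair_eqE (negPf yy') andbF.
by rewrite !E pure_multilinear pure_multilinear.
Qed.

Lemma tens_curryD : {morph @tens_curry R M X F : t u / t + u}.
Proof. exact: tens_liftD curry_multilinear. Qed.

Lemma tens_curryZ a t :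
  tens_curry (a *: t) = a *: tens_curry t :> tens (tens M X) F.
Proof. exact: (tens_liftZ curry_multilinear). Qed.

Lemma tens_curry_inj : injective (@tens_curry R M X F).
Proof.
apply: (@can_inj _ _ _ (tens_lift idfun tens_merge)); apply: tens_ind.
- by rewrite (morphD0 tens_curryD) (morphD0 (tens_liftD merge_multilinear)).
- move=> t u tE uE.
  by rewrite tens_curryD (tens_liftD merge_multilinear) tE uE.
- move=> a m; rewrite tens_curryZ (tens_liftZ merge_multilinear) tens_curry_pure.
  rewrite (tens_lift_pure merge_multilinear) merge_pure; congr (_ *: pure _).
  by apply/funext => -[].
Qed.

Lemma merge_expand n (r : 'I_n -> R) (m : 'I_n -> X -> M) :
  tens_merge (fun=> \sum_(i < n) r i *: pure (m i)) =
  \sum_(phi : {ffun F -> 'I_n})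
    (\prod_y r (phi y)) *: pure (fun xy => m (phi xy.2) xy.1).
Proof.
rewrite (multilinear_expand merge_multilinear (fun i _ => r i *: pure (m i))).
apply: eq_bigr => phi _; rewrite (multilinear_scale merge_multilinear).
by rewrite (merge_pure (fun y => m (phi y))).
Qed.

Lemma tens_curry_merge (n : tens M X) :
  tens_curry (tens_merge (fun=> n)) = pure (fun=> n).
Proof.
have [k [r [m ->]]] := tens_decomp n.
have pM := @pure_multilinear R (tens M X : lmodType R) F.
rewrite merge_expand (multilinear_expand pM (fun i _ => r i *: pure (m i))).
rewrite (morphD_sum tens_curryD); apply: eq_bigr => phi _.
rewrite (multilinear_scale pM) tens_curryZ; congr (_ *: _).
by rewrite tens_curry_pure.
Qed.

(** [tens_curry_merge] provides a preimage for the choice in [tens_pow], and injectivity of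
    [tens_curry] makes it the only one. *)
Lemma tens_powE (n : tens M X) : tens_pow F n = tens_merge (fun=> n).
Proof.
rewrite /tens_pow; case: xgetP => [t -> tE|/(_ _ (tens_curry_merge n)) //].
by apply: tens_curry_inj; rewrite tens_curry_merge.
Qed.

Lemma tens_pow_expand n (r : 'I_n -> R) (m : 'I_n -> X -> M) :
  tens_pow F (\sum_(i < n) r i *: pure (m i)) =
  \sum_(phi : {ffun F -> 'I_n})
    (\prod_y r (phi y)) *: pure (fun xy => m (phi xy.2) xy.1).
Proof. by rewrite tens_powE merge_expand. Qed.

End Merge.

Section PowFinite.
Variables (R : comPzRingType) (M : lmodType R) (X : choiceType).

Lemma pairB (D D' : choiceType) (s : D -> D') : bijective s ->
  bijective (fun p : X * D => (p.1, s p.2)).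
Proof.
move=> [t st ts]; exists (fun p => (p.1, t p.2)) => -[x d] /=; first by rewrite st.
by rewrite ts.
Qed.

(** After [tens_curry], which is injective and compatible with both reindexings, the power is a
    constant pure tensor, and this does not see the names of its factors. *)
Lemma tens_pow_reindex (D D' : choiceType) (s : D -> D') (n : tens M X) :
  finite_set [set: D] -> bijective s ->
  tens_reindex (fun p : X * D => (p.1, s p.2)) (tens_pow D' n) = tens_pow D n.
Proof.
move=> finD sB.
have finD' : finite_set [set: D'].
  case: (sB) => t st ts.
  have -> : [set: D'] = s @` [set: D].
    by apply/seteqP; split=> // y _; exists (t y).
  exact: finite_image.
(* Two index types have to become [finType]s, and [finite_choice_ind] replaces only one at a
   time. *)
pose eqn (D D' : choiceType) (s : D -> D') :=
  tens_reindex (fun p : X * D => (p.1, s p.2)) (tens_pow D' n) = tens_pow D n.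
suff fin (F F' : finType) (u : F -> F') : bijective u -> eqn F F' u.
  have ind1 (F : finType) (E : choiceType) : finite_set [set: E] ->
      forall s : F -> E, bijective s -> eqn F E s.
    by apply: (@finite_choice_ind (fun E => forall s : F -> E, bijective s -> eqn F E s))
      => F' u; exact: fin.
  by apply: (@finite_choice_ind (fun E => forall s : E -> D', bijective s -> eqn E D' s))
    finD s sB => F u; exact: ind1.
move=> {s sB finD finD'}; move: u => s sB; rewrite /eqn.
apply: tens_curry_inj; rewrite [tens_pow F n]tens_powE tens_curry_merge.
have -> : pure (fun=> n) = tens_reindex s (pure (fun _ : F' => n)) :> tens _ F.
  by rewrite tens_reindex_pure.
rewrite -tens_curry_merge -tens_powE; move: (tens_pow F' n).
have psB := pairB sB.
apply: tens_ind.
- rewrite (morphD0 (tens_reindexD psB)) (morphD0 (@tens_curryD _ _ _ _)).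
  by rewrite (morphD0 (@tens_curryD _ _ _ _)) (morphD0 (tens_reindexD sB)).
- move=> t u tE uE.
  by rewrite (tens_reindexD psB) !tens_curryD (tens_reindexD sB) tE uE.
- move=> a m; rewrite (tens_reindexZ psB) !tens_curryZ (tens_reindexZ sB).
  by rewrite tens_reindex_pure // !tens_curry_pure tens_reindex_pure.
Qed.

End PowFinite.

Lemma tens_map_pow (A B : Mod) (f : mor A B) (X D : choiceType) (n : tens A X) :
  finite_set [set: D] ->
  tens_map f (tens_pow D n) = tens_pow D (tens_map f n).
Proof.
move: D; apply: finite_choice_ind => F.
have [k [r [m ->]]] := tens_decomp n.
rewrite tens_pow_expand !(morphD_sum (@tens_mapD _ _ f _)).
under [X in tens_pow _ X]eq_bigr do rewrite tens_mapZ tens_map_pure.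
rewrite tens_pow_expand; apply: eq_bigr => phi _.
by rewrite tens_mapZ tens_map_pure rmorph_prod.
Qed.

(** * Cosets and the ghost map *)

Section SubgroupCosets.
Variable G : groupType.
Implicit Types (A U V C : set G) (g h a : G).

Definition subgroup U : Prop :=
  [/\ U 1%g, forall x y, U x -> U y -> U (x * y)%g & forall x, U x -> U x^-1%g].

Lemma lcosetP a U x : lcoset a U x <-> U (a^-1 * x)%g.
Proof.
split=> [[u Uu <-]|Ux]; first by rewrite mulKg.
by exists (a^-1 * x)%g; rewrite // mulVKg.
Qed.

Lemma rcosetP a U x : rcoset U a x <-> U (x * a^-1)%g.
Proof.
split=> [[u Uu <-]|Ux]; first by rewrite mulgK.
by exists (x * a^-1)%g; rewrite // mulgVK.
Qed.

Lemma conjsP g U x : conjs g U x <-> U (g^-1 * x * g)%g.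
Proof.
split=> [[u Uu <-]|Ux]; first by rewrite !mulgA mulVg mul1g mulgVK.
by exists (g^-1 * x * g)%g; rewrite // !mulgA mulgV mul1g mulgK.
Qed.

Lemma lcosetM a b U : lcoset (a * b)%g U = lcoset a (lcoset b U).
Proof. by apply/seteqP; split=> x /=; rewrite !lcosetP invgM mulgA. Qed.

Lemma conjsM a b U : conjs (a * b)%g U = conjs a (conjs b U).
Proof. by apply/seteqP; split=> x /=; rewrite !conjsP invgM !mulgA. Qed.

Lemma conjs1 U : conjs 1%g U = U.
Proof. by apply/seteqP; split=> x /=; rewrite conjsP invg1 mul1g mulg1. Qed.

Lemma conjs_eq g U V : V = conjs g U <-> U = conjs g^-1%g V.
Proof.
by split=> ->; rewrite -conjsM ?mulVg ?mulgV conjs1.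
Qed.

Lemma rcoset_lcoset a g U : rcoset (lcoset a U) g = lcoset (a * g)%g (conjs g^-1%g U).
Proof.
apply/seteqP; split=> x; rewrite rcosetP !lcosetP conjsP;
  by rewrite invgK invgM !mulgA mulgV mul1g.
Qed.

Lemma subgroup_conjs g U : subgroup U -> subgroup (conjs g U).
Proof.
move=> [U1 UM UV]; split=> [|x y|x]; rewrite !conjsP.
- by rewrite mulg1 mulVg.
- by move=> Ux Uy; have := UM _ _ Ux Uy; rewrite !mulgA mulgK.
- by move=> /UV; rewrite !invgM invgK mulgA.
Qed.

Section Fixed.
Variables (U : set G) (U_ : subgroup U).

Lemma subgroup1 : U 1%g. Proof. by case: U_. Qed.
Lemma subgroupM x y : U x -> U y -> U (x * y)%g.
Proof. by case: U_ => _ + _; apply. Qed.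
Lemma subgroupV x : U x -> U x^-1%g.
Proof. by case: U_ => _ _; apply. Qed.
Lemma subgroupVE x : U x^-1%g <-> U x.
Proof. by split=> /subgroupV //; rewrite invgK. Qed.
Lemma subgroupMr x y : U y -> U (x * y)%g <-> U x.
Proof.
move=> Uy; split=> [Uxy|Ux]; last exact: subgroupM.
by have := subgroupM Uxy (subgroupV Uy); rewrite mulgK.
Qed.
Lemma subgroupMl x y : U x -> U (x * y)%g <-> U y.
Proof.
move=> Ux; split=> [Uxy|Uy]; last exact: subgroupM.
by have := subgroupM (subgroupV Ux) Uxy; rewrite mulKg.
Qed.

Lemma lcoset_refl a : lcoset a U a.
Proof. by rewrite lcosetP mulVg; exact: subgroup1. Qed.

Lemma lcoset_eq a b : lcoset a U b -> lcoset b U = lcoset a U.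
Proof.
rewrite lcosetP => Uab; apply/seteqP; split=> x; rewrite !lcosetP => Ux.
  by have := subgroupM Uab Ux; rewrite -mulgA mulVKg.
have := subgroupM (subgroupV Uab) Ux.
by rewrite invgM invgK -mulgA mulVKg.
Qed.

Lemma lcoset_eqP a b : lcoset a U = lcoset b U <-> U (a^-1 * b)%g.
Proof.
split=> [E|Uab]; last by rewrite -(@lcoset_eq a b) //; exact/lcosetP.
by apply/lcosetP; rewrite E; exact: lcoset_refl.
Qed.

Lemma lcosetMr a u : U u -> lcoset (a * u)%g U = lcoset a U.
Proof. by move=> Uu; apply: lcoset_eq; apply/lcosetP; rewrite mulKg. Qed.

Lemma conjs_id u : U u -> conjs u U = U.
Proof.
move=> Uu; apply/seteqP; split=> x; rewrite conjsP subgroupMr // subgroupMl //;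
  exact: subgroupV.
Qed.

End Fixed.

Lemma lcosets_mem A U a : A a -> lcoset a U \in lcosets A U.
Proof. by move=> Aa; apply/mem_set; exists a. Qed.

Definition mkcoset A U a (Aa : A a) : coset A U :=
  exist _ (lcoset a U) (lcosets_mem U Aa).

Definition lc U a : coset setT U := @mkcoset setT U a I.

Lemma cosetW A U (C : coset A U) : exists2 a, A a & val C = lcoset a U.
Proof. by case: C => C /= /set_mem[a Aa <-]; exists a. Qed.

Lemma lcW U (C : coset setT U) : exists a, C = lc U a.
Proof. by have [a _ Ca] := cosetW C; exists a; apply: val_inj. Qed.

Lemma lc_eqP U a b : subgroup U -> lc U a = lc U b <-> U (a^-1 * b)%g.
Proof.
move=> U_; rewrite -lcoset_eqP //; split=> [/(congr1 val)//|E].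
exact: val_inj.
Qed.

Fact comb_proof (rep : set G -> G) V A U (CD : coset setT V * coset A U) :
  lcoset (rep (val CD.1)) (val CD.2) \in lcosets setT U.
Proof.
by case: CD => C D; have [s _ ->] := cosetW D; rewrite -lcosetM; exact: lcosets_mem.
Qed.

(* Generalizes coset_comb from A = V to the right cosets A = V h^-1. *)
Definition comb (rep : set G -> G) V A U (CD : coset setT V * coset A U) :
  coset setT U := exist _ (lcoset (rep (val CD.1)) (val CD.2)) (comb_proof rep CD).

Lemma coset_combE (rep : set G -> G) V U : @coset_comb G rep V U = @comb rep V V U.
Proof. by apply/funext => CD; apply: val_inj. Qed.

(** For C = hV this is V h^-1, the right coset that replaces a chosen h in the summand of the ghost
    map. *)
Definition invs C : set G := [set x | C x^-1%g].

Lemma invs_lcoset h V : subgroup V -> invs (lcoset h V) = rcoset V h^-1%g.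
Proof.
move=> V_; apply/seteqP; split=> x.
  by move=> /lcosetP; rewrite rcosetP invgK -invgM subgroupVE.
by rewrite rcosetP invgK => Vx; apply/lcosetP; rewrite -invgM subgroupVE.
Qed.

Section CombBijective.
Variables (rep : set G -> G) (V U : set G) (h : G).
Hypotheses (V_ : subgroup V) (U_ : subgroup U) (hU : conjs h^-1%g U `<=` V).
Hypothesis (repP : forall C, lcosets setT V C -> C (rep C)).

Let rep_lc a : lcoset (rep (lcoset a V)) V = lcoset a V.
Proof. by apply: lcoset_eq => //; apply: repP; exists a. Qed.

(** Each a is uniquely r s with r the representative of a h V and s in V h^-1. The hypothesis [hU]
    says that V h^-1 is a union of left cosets of U. *)
Lemma comb_bij : bijective (@comb rep V (rcoset V h^-1%g) U).
Proof.
rewrite -setTT_bijective; split=> //.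
- move=> [C D] [C' D'] _ _ /(congr1 val) /=.
  have [a aE] := lcW C; have [a' aE'] := lcW C'.
  have [s /rcosetP sV sE] := cosetW D; have [s' /rcosetP sV' sE'] := cosetW D'.
  rewrite invgK in sV; rewrite invgK in sV'.
  rewrite sE sE' -!lcosetM => E.
  have CC' : C = C'.
    rewrite aE aE' /=; apply: val_inj => /=; rewrite -(rep_lc a) -(rep_lc a').
    move: E; rewrite aE aE' /= => E.
    set r := rep _ in E *; set r' := rep _ in E *.
    have [u Uu ru] : lcoset (r * s)%g U (r' * s')%g by rewrite E; exact: lcoset_refl.
    (* Since s h lies in V, the V-coset of r can be read off from r s, which E determines up to
       U. *)
    have -> : lcoset r V = lcoset (r * s * h)%g V by rewrite -mulgA lcosetMr.
    have -> : lcoset r' V = lcoset (r' * s' * h)%g V by rewrite -mulgA [RHS]lcosetMr.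
    rewrite -ru; apply/lcoset_eqP => //.
    move: (r * s)%g => t; rewrite invgM !mulgA mulgVK; apply: hU; apply/conjsP.
    by rewrite invgK !mulgA mulgV mul1g mulgK.
  congr (_, _) => //; apply: val_inj; rewrite sE sE'.
  move: E; rewrite -CC' => E; apply/lcoset_eqP => //; move/lcoset_eqP: E => /(_ U_).
  by rewrite invgM -mulgA mulKg.
- move=> E _; have [a ->] := lcW E.
  set r := rep (lcoset (a * h)%g V).
  have Vr : V ((a * h)^-1 * r)%g by apply/lcosetP; apply: repP; exists (a * h)%g.
  have Ar : rcoset V h^-1%g (r^-1 * a)%g.
    by apply/rcosetP; rewrite invgK -mulgA -subgroupVE // invgM invgK.
  exists (lc V (a * h)%g, mkcoset U Ar) => //.
  by apply: val_inj; rewrite /= -lcosetM mulVKg.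
Qed.

End CombBijective.

Lemma coset_shift_bij g V V' (e : V' = conjs g V) : bijective (coset_shift e).
Proof.
have e' : V = conjs g^-1%g V' := (conjs_eq g V V').1 e.
exists (coset_shift e') => D; apply: val_inj => /=; apply/seteqP; split=> x /=;
  by rewrite !rcosetP ?invgK ?mulgK ?mulgVK.
Qed.

(** With A = V h^-1 the translation by h is already included, so the summand depends on hV alone. *)
Definition tens_term (R : comPzRingType) (M : lmodType R) rep V A U
    (n : tens M (coset setT V)) : tens M (coset setT U) :=
  tens_bij (@comb rep V A U) (tens_pow (coset A U) n).

Lemma tens_termE (R : comPzRingType) (M : lmodType R) rep V A U
    (psi : coset setT U -> coset setT V * coset A U) :
  cancel (@comb rep V A U) psi -> cancel psi (@comb rep V A U) ->
  @tens_term R M rep V A U = fun n => tens_reindex psi (tens_pow (coset A U) n).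
Proof.
by move=> combK psiK; apply/funext => n; rewrite /tens_term (tens_bijE _ combK psiK).
Qed.

Fact coset_rshift_proof g A A' U U' (e : U' = conjs g U) (eA : A' = rcoset A g^-1%g)
    (D : coset A U) : rcoset (val D) g^-1%g \in lcosets A' U'.
Proof.
have [a Aa ->] := cosetW D; rewrite rcoset_lcoset invgK -e; apply: lcosets_mem.
by rewrite eA; apply/rcosetP; rewrite invgK mulgVK.
Qed.

Definition coset_rshift g A A' U U' (e : U' = conjs g U)
    (eA : A' = rcoset A g^-1%g) (D : coset A U) : coset A' U' :=
  exist _ (rcoset (val D) g^-1%g) (coset_rshift_proof e eA D).

Lemma coset_rshift_bij g A A' U U' (e : U' = conjs g U)
  (eA : A' = rcoset A g^-1%g) : bijective (coset_rshift e eA).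
Proof.
have e' : U = conjs g^-1%g U' := (conjs_eq g U U').1 e.
have eA' : A = rcoset A' g^-1^-1%g.
  by rewrite eA; apply/seteqP; split=> x; rewrite !rcosetP ?invgK ?mulgK ?mulgVK.
exists (coset_rshift e' eA') => D; apply: val_inj => /=; apply/seteqP; split=> x /=;
  by rewrite !rcosetP ?invgK ?mulgK ?mulgVK.
Qed.

Lemma lcoset_rcoset a g A : lcoset a (rcoset A g) = rcoset (lcoset a A) g.
Proof.
by apply/seteqP; split=> x; rewrite lcosetP !rcosetP lcosetP mulgA.
Qed.

(** The action of g multiplies cosets on the right, whereas [comb] multiplies by a representative on
    the left; the two commute, and only the right factor moves, from A/U to A g^-1/gUg^-1. *)
Lemma tens_act_term (R : comPzRingType) (M : lmodType R) rep V A A' g U U'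
    (e : U' = conjs g U) (n : tens M (coset setT V)) :
  A' = rcoset A g^-1%g ->
  bijective (@comb rep V A U) -> bijective (@comb rep V A' U') ->
  finite_set [set: coset A U] ->
  tens_act e (tens_term rep A U n) = tens_term rep A' U' n.
Proof.
move=> eA cB [psi' combK' psiK'] finAU; case: (cB) => psi combK psiK.
have shB := coset_shift_bij e.
have psiB : bijective psi by exists (@comb rep V A U).
rewrite (tens_termE _ combK psiK) (tens_termE _ combK' psiK') /tens_act.
rewrite tens_reindex_comp //.
have sB := coset_rshift_bij e eA.
rewrite -(tens_pow_reindex n finAU sB) tens_reindex_comp; last 2 first.
- exact: pairB.
- exact: bij_comp.
congr (tens_reindex _ _); apply/funext => E /=.
apply: (can_inj combK'); rewrite psiK'; apply: val_inj => /=.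
have /(congr1 val) /= := psiK (coset_shift e E).
rewrite lcoset_rcoset => ->; apply/seteqP; split=> x /=;
  by rewrite !rcosetP ?invgK ?mulgK ?mulgVK.
Qed.

End SubgroupCosets.

Section OpenSubgroups.
Variables (G : topologicalGroupType).
Hypothesis G_compact : compact [set: G].
Implicit Types (U V W : set G).

Lemma open_subgroupW U : open_subgroup U -> subgroup U.
Proof. by case. Qed.

Lemma mull_continuous a : continuous (fun x : G => (a * x)%g).
Proof.
move=> x.
apply: (@continuous_comp _ _ _ (fun x : G => (a, x)) (fun x : G * G => (x.1 * x.2)%g)).
  by apply: cvg_pair; [exact: cvg_cst | exact: cvg_id].
exact: mulg_continuous.
Qed.

Lemma mulr_continuous a : continuous (fun x : G => (x * a)%g).
Proof.
move=> x.
apply: (@continuous_comp _ _ _ (fun x : G => (x, a)) (fun x : G * G => (x.1 * x.2)%g)).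
  by apply: cvg_pair; [exact: cvg_id | exact: cvg_cst].
exact: mulg_continuous.
Qed.

Lemma lcoset_open a U : open U -> open (lcoset a U).
Proof.
move=> oU; have -> : lcoset a U = (fun x => (a^-1 * x)%g) @^-1` U.
  by apply/seteqP; split=> x /=; rewrite lcosetP.
exact: ((continuousP _).1 (@mull_continuous _)).
Qed.

Lemma open_subgroup_conjs a U : open_subgroup U -> open_subgroup (conjs a U).
Proof.
move=> oU; have [U1 UM UV] := subgroup_conjs a (open_subgroupW oU); split=> //.
case: oU => oU _ _ _.
have -> : conjs a U = (fun x => (a^-1 * x)%g) @^-1` ((fun x => (x * a)%g) @^-1` U).
  by apply/seteqP; split=> x /=; rewrite conjsP.
apply: ((continuousP _).1 (@mull_continuous _)).
exact: ((continuousP _).1 (@mulr_continuous _)).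
Qed.

(** The cosets cover G by open sets, and cosets that meet coincide, so a finite subcover lists all
    of them. *)
Lemma finite_lcosets A U : open_subgroup U -> finite_set (lcosets A U).
Proof.
move=> oU; have U_ := open_subgroupW oU; case: oU => oU _ _ _.
pose PG : ptopologicalType := HB.pack G (isPointed.Build G 1%g).
have : @compact PG [set: G] by [].
pose f (a : G) : set PG := lcoset a U.
rewrite compact_cover cover_compactE => /(_ G setT f).
case=> [||D _ cov].
- by exists f => a _; [exact: lcoset_open | apply/seteqP; split=> [x|x []]].
- by move=> x _; exists x => //; exact: lcoset_refl.
apply: sub_finite_set (finite_image f (finite_fset D)).
move=> _ [a _ <-]; have [b Db Uba] := cov a I.
by exists b => //; rewrite /f (lcoset_eq U_ Uba).
Qed.

Lemma finite_coset A U : open_subgroup U -> finite_set [set: coset A U].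
Proof.
move=> oU.
have -> : [set: coset A U] = val @^-1` lcosets A U.
  by apply/seteqP; split=> // C _; exact/set_mem/(valP C).
by apply: finite_preimage; [move=> C D _ _; exact: val_inj | exact: finite_lcosets].
Qed.

Definition overgroups U : set (set G) := [set W | subgroup W /\ U `<=` W].

(** An overgroup is the union of the left cosets of U that it contains, hence is determined by a
    subset of the finite set G/U. *)
Lemma finite_overgroups U : open_subgroup U -> finite_set (overgroups U).
Proof.
move=> oU; have U_ := open_subgroupW oU.
have [D DE] : exists D : {fset set G}, lcosets setT U = [set` D].
  by apply/finite_fsetP; exact: finite_lcosets.
apply: sub_finite_set
  (finite_image (fun E : {fset set G} => \bigcup_(C in [set` E]) C)
                (finite_fset (fpowerset D))).
move=> W [W_ UW]; pose P (C : set G) := `[< C `<=` W >].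
exists [fset C in D | P C]%fset.
  by rewrite /= fpowersetE; apply/fsubsetP => C; rewrite !inE => /andP[].
apply/seteqP; split=> [x [C /=]|x Wx].
  by rewrite !inE => /andP[_ /asboolP]; apply.
exists (lcoset x U); last exact: lcoset_refl.
rewrite /= !inE; apply/andP; split.
  suff : [set` D] (lcoset x U) by [].
  by rewrite -DE; exists x.
apply/asboolP => y /lcosetP /UW Wxy.
by have := subgroupM W_ Wx Wxy; rewrite mulVKg.
Qed.

End OpenSubgroups.

Section GhostTerms.
Variables (G : topologicalGroupType) (H : set G) (S : set (set G)).
Hypotheses (G_compact : compact [set: G]) (H_ : open_subgroup H).
Hypothesis (S_ : truncation_set H S).
Variable c : ghost_choice H S.

Let Hg := open_subgroupW H_.

Lemma trunc_open (U : S) : open_subgroup (val U).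
Proof. by have [] := trunc_sub S_ (set_mem (valP U)). Qed.

Lemma reps_open (V : reps c) : open_subgroup (val V).
Proof. by have [] := trunc_sub S_ (reps_sub (set_mem (valP V))). Qed.

Lemma reps_eq (V V' : reps c) h h' : H h -> H h' ->
  conjs h (val V) = conjs h' (val V') -> V = V'.
Proof.
move=> Hh Hh' E; apply: val_inj.
have SW : S (conjs h (val V)).
  exact: (trunc_conj S_) (reps_sub (set_mem (valP V))) Hh.
have [W [_ Wu]] := reps_uniq c SW.
rewrite -(Wu (val V)) ?(Wu (val V')) //.
  split; first exact/set_mem/(valP V').
  by exists h'^-1%g; [exact: subgroupV | exact: (conjs_eq _ _ _).1 E].
split; first exact/set_mem/(valP V).
by exists h^-1%g; [exact: subgroupV | exact: (conjs_eq _ _ _).1 erefl].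
Qed.

Lemma fixed_cosetsP V U C : subgroup V -> fixed_cosets H V U C -> forall h, C h ->
  C = lcoset h V /\ conjs h^-1%g U `<=` V.
Proof.
move=> V_ [h0 [Hh0 -> UV]] h Ch; split.
  by rewrite (lcoset_eq V_ Ch).
have [v Vv <-] := Ch; move=> x /conjsP; rewrite invgK => Ux.
rewrite -(conjs_id V_ (subgroupV V_ Vv)); apply/conjsP.
rewrite invgK; apply: UV; apply/conjsP; rewrite invgK.
by move: Ux; rewrite invgM !mulgA.
Qed.

Definition ghost_supp (U : set G) : set (reps c) :=
  [set V | fixed_cosets H (val V) U !=set0].

Lemma fixed_cosets_sub V U U' : U' `<=` U ->
  fixed_cosets H V U `<=` fixed_cosets H V U'.
Proof.
move=> UU' _ [h [Hh -> UV]]; exists h; split=> //.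
by move=> x /conjsP Ux; apply: UV; apply/conjsP/UU'.
Qed.

Lemma finite_fixed_cosets (V : reps c) U : finite_set (fixed_cosets H (val V) U).
Proof.
apply: sub_finite_set (finite_lcosets G_compact setT (reps_open V)).
by move=> _ [h [_ -> _]]; exists h.
Qed.

(** Each V in the support has an H-conjugate above U, this conjugate determines the representative
    V, and U has finitely many overgroups. *)
Lemma finite_ghost_supp U : open_subgroup U -> finite_set (ghost_supp U).
Proof.
move=> oU; pose isW (V : reps c) W := overgroups U W /\ exists2 h, H h & W = conjs h (val V).
(* The default [set0] is harmless: it does not contain 1, so it is not an overgroup. *)
pose f V := xget set0 (isW V).
have fP V : overgroups U (f V) -> exists2 h, H h & f V = conjs h (val V).
  rewrite /f; case: xgetP => [W -> [_ ?] //|_ [[] //]].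
apply: (@sub_finite_set _ _ (f @^-1` overgroups U)).
  move=> V [_ [h [Hh _ UV]]] /=; rewrite /f.
  suff /(xgetI set0) [] : isW V (conjs h (val V)) by [].
  split; last by exists h.
  split; first exact: subgroup_conjs (open_subgroupW (reps_open V)).
  by move=> x Ux; apply/conjsP/UV/conjsP; rewrite invgK !mulgA mulgV mul1g mulgK.
apply: finite_preimage; last exact: finite_overgroups.
move=> V V' /set_mem /= VW /set_mem /= VW' E.
have [h Hh fV] := fP _ VW; have [h' Hh' fV'] := fP _ VW'.
by apply: (reps_eq Hh Hh'); rewrite -fV -fV'.
Qed.

Lemma rep_in (V : reps c) C : lcosets setT (val V) C -> C (rep c (val V) C).
Proof. by apply: rep_coset; exact/set_mem/(valP V). Qed.

Lemma fixed_comb_bij (V : reps c) U C : subgroup U ->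
  fixed_cosets H (val V) U C ->
  bijective (@comb _ (rep c (val V)) (val V) (invs C) U).
Proof.
move=> U_ [h [_ -> UV]]; have V_ := open_subgroupW (reps_open V).
by rewrite invs_lcoset //; apply: comb_bij => //; exact: rep_in.
Qed.

(** Removes the element h chosen in [ghost]: by [tens_act_term], translating by h turns the term
    with right coset V into the one with V h^-1. *)
Lemma ghost_summandE (A : Mod) (V : reps c) U C (n : tens A (coset setT (val V))) :
  open_subgroup U -> fixed_cosets H (val V) U C ->
  (let h := xget 1%g C in
   tens_act (conjsK h U) (tens_comb (rep c (val V))
     (tens_pow (coset (val V) (conjs h^-1%g U)) n))) =
  tens_term (rep c (val V)) (invs C) U n.
Proof.
move=> oU CU /=; have U_ := open_subgroupW oU; have V_ := open_subgroupW (reps_open V).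
have [h0 [Hh0 CE _]] := CU.
have Ch : C (xget 1%g C) by apply: (xgetI _ (x := h0)); rewrite CE; exact: lcoset_refl.
have [Ch' UV] := fixed_cosetsP V_ CU Ch.
move: (xget 1%g C) Ch' UV => h {}CE UV {Ch Hh0 h0}.
rewrite /tens_comb coset_combE -[tens_bij _ _]/(tens_term _ _ _ _).
have UhV : conjs h^-1%g U = conjs 1%g (conjs h^-1%g U) by rewrite conjs1.
have eq_r1 : val V = rcoset (val V) 1^-1%g.
  by apply/seteqP; split=> x; rewrite rcosetP !invg1 mulg1.
have oU' : open_subgroup (conjs h^-1%g U).
  exact: open_subgroup_conjs.
apply: tens_act_term.
- by rewrite CE invs_lcoset.
- suff : bijective (@comb _ (rep c (val V)) (val V) (rcoset (val V) 1^-1%g) (conjs h^-1%g U)).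
    by rewrite -eq_r1.
  apply: comb_bij => //; first exact: open_subgroupW.
    by rewrite invg1 conjs1.
  exact: rep_in.
- exact: fixed_comb_bij.
- exact: finite_coset.
Qed.

End GhostTerms.

Arguments ghost_supp {G H S} c U _.

(** * Products of discrete spaces and continuity of the ghost map *)

Section ProductOfDiscrete.
Variables (I : choiceType) (K : I -> topologicalType).
Hypothesis K_discrete : forall i (z : K i), nbhs z [set z].

Definition box (x : prod_topology K) (F : set I) : set (prod_topology K) :=
  [set y | forall i, F i -> y i = x i].

Lemma box_nbhs x F : finite_set F -> nbhs x (box x F).
Proof.
move=> finF.
have -> : box x F = \bigcap_(i in F) ((@proj I K i) @^-1` [set x i]).
  by apply/seteqP; split=> y /= xy i Fi; exact: xy.
rewrite -(fset_setK finF); apply: filter_bigI => i _.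
by have := @proj_continuous I K i x [set x i] (K_discrete (x i)).
Qed.

(** A basic open set is a finite intersection of preimages under single projections, so membership
    depends on finitely many coordinates. *)
Lemma nbhs_box x (O : set (prod_topology K)) : nbhs x O ->
  exists2 F, finite_set F & box x F `<=` O.
Proof.
move=> [] P [] [] Q QfinP <- [] V JV Vx sub.
have [L Lsub VL] := QfinP _ JV.
(* To each subbasic set in L is attached the one coordinate that it constrains; [None] serves the
   sets outside L. *)
have /choice[idx idxP] : forall W : set (prod_topology K), exists i : option I,
    W \in L -> exists2 i0, i = Some i0 &
      forall y z : prod_topology K, y i0 = z i0 -> W y -> W z.
  move=> W; have [/Lsub/set_mem [i _ [N oN NW]]|WL] := boolP (W \in L); last by exists None.
  exists (Some i) => _; exists i => // y z yz.
  by rewrite -NW /= yz.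
pose F : set I := Some @^-1` (idx @` [set` L]).
exists F.
  apply: finite_preimage.
    by move=> i j _ _ [].
  exact/finite_image/finite_fset.
move=> y xy; apply: sub; exists V => //=.
suff : (V : set (prod_topology K)) y by [].
rewrite -VL => W WL.
have [i iE Wi] := idxP W WL.
apply: (Wi x); last by move: Vx; rewrite -VL; apply.
by rewrite xy // /F /= -iE; exists W.
Qed.

Lemma local_continuous (T : topologicalType) (f : prod_topology K -> T)
    (F : set I) : finite_set F ->
  (forall x y, (forall i, F i -> y i = x i) -> f y = f x) -> continuous f.
Proof.
move=> finF fP x O Ofx; apply: filterS (box_nbhs x finF) => y xy.
by rewrite /= (fP x y xy); exact: nbhs_singleton.
Qed.

Lemma coord_continuous (T : topologicalType) (f : T -> prod_topology K) :
  (forall i, continuous (fun t => f t i)) -> continuous f.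
Proof.
move=> fc x O /nbhs_box [F finF FO].
apply: (filterS (P := \bigcap_(i in F) [set t | f t i = f x i])).
  by move=> t xt; apply: FO => i Fi; exact: xt.
rewrite -(fset_setK finF); apply: filter_bigI => i _.
exact: fc (K_discrete _).
Qed.

End ProductOfDiscrete.

Section Ghost.
Variables (G : topologicalGroupType) (H : set G) (S : set (set G)).
Hypotheses (G_compact : compact [set: G]) (H_ : open_subgroup H).
Hypothesis (S_ : truncation_set H S).
Variable c : ghost_choice H S.

Definition ghost_term (A : Mod) (V : reps c) U C (n : tens A (coset setT (val V))) :
  tens A (coset setT U) := tens_term (rep c (val V)) (invs C) U n.

(** The freedom in F lets ghost coordinates at different subgroups be written over a common finite
    index set. *)
Lemma ghostE (A : Mod) (n : tens_prod (reps c) A) (U : S) (F : set (reps c)) :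
  finite_set F -> ghost_supp c (val U) `<=` F ->
  ghost n U = \sum_(V \in F) \sum_(C \in fixed_cosets H (val V) (val U))
    ghost_term (val U) C (n V).
Proof.
move=> finF suppF; have oU := trunc_open S_ U.
rewrite /ghost -(@fsbig_widen _ _ _ _ F) //; last first.
  move=> V [_ FV] /=; apply: fsbig1 => C CU; case: FV; apply: suppF.
  by exists C.
apply: eq_fsbigr => V _; apply: eq_fsbigr => C /set_mem CU.
by have := ghost_summandE G_compact S_ (n V) oU CU.
Qed.

Lemma ghost_suppE (A : Mod) (n : tens_prod (reps c) A) (U : S) :
  ghost n U = \sum_(V \in ghost_supp c (val U))
    \sum_(C \in fixed_cosets H (val V) (val U)) ghost_term (val U) C (n V).
Proof.
by apply: ghostE => //; apply: finite_ghost_supp => //; exact: (trunc_open S_).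
Qed.

Lemma tens_term_map (A B : Mod) (f : mor A B) V U C
    (n : tens A (coset setT (val V))) :
  open_subgroup U -> fixed_cosets H (val V) U C ->
  tens_map f (ghost_term (V := V) U C n) = ghost_term U C (tens_map f n).
Proof.
move=> oU CU.
have combB := fixed_comb_bij S_ (open_subgroupW oU) CU.
case: (combB) => psi combK psiK.
have psiB : bijective psi by exists (comb (rep c (val V)) (U := U)).
rewrite /ghost_term !(tens_termE _ combK psiK) tens_map_reindex //.
by rewrite tens_map_pow //; exact: finite_coset.
Qed.

Lemma ghost_natural (A B : Mod) (f : mor A B) (n : tens_prod (reps c) A) :
  ghost (tens_prod_map f n) = tens_prod_map f (ghost n).
Proof.
apply: functional_extensionality_dep => U; have oU := trunc_open S_ U.
have finU := finite_ghost_supp G_compact H_ S_ c oU.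
rewrite ghost_suppE /tens_prod_map ghost_suppE (morphD_fsum (@tens_mapD _ _ f _)) //.
apply: eq_fsbigr => V _; rewrite (morphD_fsum (@tens_mapD _ _ f _)); last first.
  exact: finite_fixed_cosets.
by apply: eq_fsbigr => C /set_mem CU; rewrite tens_term_map.
Qed.

Lemma ghost_local (A : Mod) (n n' : tens_prod (reps c) A) (U : S) :
  (forall V, ghost_supp c (val U) V -> n V = n' V) -> ghost n U = ghost n' U.
Proof.
move=> nn'; rewrite !ghost_suppE; apply: eq_fsbigr => V /set_mem UV.
by rewrite nn'.
Qed.

Lemma ghost_continuous (A : Mod) : continuous (@ghost G H S c A).
Proof.
apply: coord_continuous => [U z|U]; first by [].
apply: (@local_continuous _ _ _ _ _ (ghost_supp c (val U))) => [V z||n n' nn'] //.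
  by apply: finite_ghost_supp => //; exact: (trunc_open S_).
exact: ghost_local.
Qed.

Lemma fixed_cosets_conjs (V U : set G) k : H k ->
  set_bij (fixed_cosets H V U) (fixed_cosets H V (conjs k U)) (lcoset k).
Proof.
move=> Hk; have Hg := open_subgroupW H_; split.
- move=> _ [h [Hh -> UV]]; exists (k * h)%g; split.
  + exact: subgroupM.
  + by rewrite lcosetM.
  + by rewrite invgM conjsM -[conjs k^-1%g _]conjsM mulVg conjs1.
- move=> C D _ _ E; have := congr1 (lcoset k^-1%g) E.
  rewrite -!lcosetM mulVg.
  suff l1 (X : set G) : lcoset 1%g X = X by rewrite !l1.
  by apply/seteqP; split=> x; rewrite lcosetP invg1 mul1g.
- move=> _ [h [Hh -> UV]]; exists (lcoset (k^-1 * h)%g V).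
    exists (k^-1 * h)%g; split=> //; first by apply: subgroupM => //; exact: subgroupV.
    by rewrite invgM invgK conjsM.
  by rewrite -lcosetM mulVKg.
Qed.

(** Translation by k carries the summand of C at U to the summand of kC at kUk^-1, so it only
    permutes the terms. *)
Lemma ghost_fixed (A : Mod) (n : tens_prod (reps c) A) : H_fixed H (ghost n).
Proof.
move=> k Hk U U' e; have oU := trunc_open S_ U; have oU' := trunc_open S_ U'.
have finU := finite_ghost_supp G_compact H_ S_ c oU.
have actD : {morph @tens_act _ _ (module A) _ _ _ e : t u / t + u}.
  by apply: tens_reindexD; exact: coset_shift_bij.
rewrite (@ghostE _ _ _ (ghost_supp c (val U))) //; last first.
  move=> V [C CU]; have [_ _ bij3] := fixed_cosets_conjs (val V) (val U) Hk.
  by move: CU; rewrite e => /bij3 [D DU _]; exists D.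
rewrite ghost_suppE (morphD_fsum actD) //; apply: eq_fsbigr => V _.
rewrite (morphD_fsum actD); last exact: finite_fixed_cosets.
have kB := fixed_cosets_conjs (val V) (val U) Hk; rewrite -e in kB.
rewrite (reindex_fsbig _ _ _ _ kB); apply: eq_fsbigr => C /set_mem CU.
have V_ := open_subgroupW (reps_open S_ V).
apply/esym/tens_act_term.
- by have [h [_ -> _]] := CU; rewrite -lcosetM !invs_lcoset // invgM;
    apply/seteqP; split=> x; rewrite !rcosetP !invgM !invgK mulgA.
- exact: fixed_comb_bij (open_subgroupW oU) CU.
- by apply: fixed_comb_bij (open_subgroupW oU') _ => //; case: kB => + _ _; apply.
- exact: finite_coset.
Qed.

End Ghost.

(** * Coefficients of tensors over free modules *)

Reserved Notation "\prod_ ( i '\in' A ) F"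
  (F at level 36, A at level 60,
           format "'[' \prod_ ( i  '\in'  A ) '/  '  F ']'").
Notation "\prod_ ( i '\in' A ) F" := (\big[*%R/1%R]_(i \in A) F) : ring_scope.

(* A presentation of R as the integral monoid ring of the commutative monoid
   (C, op), with the maps psi k induced by the k-th power maps of C.  The ring
   Z[X] is only used through this interface. *)
Record monoid_ring (R : comPzRingType) (C : choiceType) (one : C)
    (op : Monoid.com_law one) := MonoidRing {
  monom : C -> R;
  mcoef : C -> R -> int;
  mcoefD : forall c, {morph mcoef c : r s / r + s};
  mcoef_monom : forall c c', mcoef c (monom c') = (c == c')%:Z;
  monom1 : monom one = 1;
  monomM : forall c c', monom (op c c') = monom c * monom c';
  monom_ind : forall P : R -> Prop, P 0 ->
    (forall r s, P r -> P s -> P (r + s)) -> (forall r, P r -> P (- r)) ->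
    (forall c, P (monom c)) -> forall r, P r;
  psi : nat -> R -> R;
  psiD : forall k, {morph psi k : r s / r + s};
  psi_monom : forall k c, psi k (monom c) = monom (iter k (op c) one)
}.

Arguments mcoefD {R C one op} m c.
Arguments mcoef_monom {R C one op} m c c'.
Arguments monomM {R C one op} m c c'.
Arguments monom_ind {R C one op} m P.
Arguments psiD {R C one op} m k.
Arguments psi_monom {R C one op} m k c.

(** Spanning is recorded as the induction principle [bvec_ind], the form in which it is applied. *)
Record module_basis (R : comPzRingType) (M : lmodType R) (Y : choiceType) :=
  ModuleBasis {
  bvec : Y -> M;
  bcoord : Y -> M -> R;
  bcoord_lin : forall y r a b, bcoord y (r *: a + b) = r * bcoord y a + bcoord y b;
  bcoord_bvec : forall y y', bcoord y (bvec y') = (y == y')%:R;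
  bvec_ind : forall P : M -> Prop, P 0 ->
    (forall a b, P a -> P b -> P (a + b)) ->
    (forall r y, P (r *: bvec y)) -> forall a, P a
}.

Arguments bcoord_lin {R M Y} m y r a b.
Arguments bcoord_bvec {R M Y} m y y'.
Arguments bvec_ind {R M Y} m P.

Section Evaluation.
Variables (R : comPzRingType) (M : lmodType R) (Y : choiceType).
Variable bM : module_basis M Y.
Variables (J : choiceType) (finJ : finite_set [set: J]).

(** The R-coordinate of a tensor at the basis tensor whose factor at j is the basis vector y j. *)
Definition cf (y : J -> Y) : tens M J -> R :=
  @tens_lift R R idfun M J R^o (fun q => \prod_(j \in [set: J]) bcoord bM (y j) (q j)).

Lemma cf_multilinear (y : J -> Y) :
  @multilinear R R idfun M J R^o
    (fun q => \prod_(j \in [set: J]) bcoord bM (y j) (q j)).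
Proof.
move=> q x c a b /=.
have E z : \prod_(j \in [set: J]) bcoord bM (y j) (dfwith q x z j) =
    bcoord bM (y x) z * \prod_(j \in [set: J] `\ x) bcoord bM (y j) (q j).
  rewrite (fsbigD1 x) //= dfwithE eqxx; congr (_ * _).
  by apply: eq_fsbigr => j /set_mem [_ /eqP jx]; rewrite dfwithE (negPf jx).
by rewrite !E bcoord_lin mulrDl -mulrA.
Qed.

Lemma cfD y : {morph cf y : t u / t + u}.
Proof. exact: (tens_liftD (cf_multilinear y)). Qed.

Lemma cfZ y a t : cf y (a *: t) = a * cf y t.
Proof. exact: (tens_liftZ (cf_multilinear y)). Qed.

Lemma cf_pure y (q : J -> M) :
  cf y (pure q) = \prod_(j \in [set: J]) bcoord bM (y j) (q j).
Proof. exact: (tens_lift_pure (cf_multilinear y)). Qed.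

Variables (C : choiceType) (one : C) (op : Monoid.com_law one).
Variable mR : monoid_ring R op.

Definition tbasis (b : C * (J -> Y)) : tens M J :=
  monom mR b.1 *: pure (bvec bM \o b.2).

Lemma cf_basis y b : cf y (tbasis b) = if y == b.2 then monom mR b.1 else 0.
Proof.
rewrite cfZ cf_pure; case: eqP => [->|yb].
  by rewrite fsbig1 ?mulr1 // => j _; rewrite bcoord_bvec eqxx.
have [j yj] : exists j, y j <> b.2 j by apply/existsNP => E; exact/yb/funext.
rewrite (fsbigD1 j) //= bcoord_bvec; case: eqP => // _.
by rewrite mul0r mulr0.
Qed.

Lemma pure_dfwith0 (q : J -> M) j : pure (dfwith q j 0) = 0.
Proof.
have := @pure_multilinear R M J q j (-1) 0 0.
by rewrite scaler0 addr0 scaleN1r addNr.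
Qed.

Lemma basis_ind (P : tens M J -> Prop) :
  P 0 -> (forall t u, P t -> P u -> P (t + u)) -> (forall t, P t -> P (- t)) ->
  (forall b, P (tbasis b)) -> forall t, P t.
Proof.
move=> P0 PD PN Pb.
have base a (y : J -> Y) : P (a *: pure (bvec bM \o y)).
  elim/(monom_ind mR): a => [|f g Pf Pg|f Pf|c].
  - by rewrite scale0r.
  - by rewrite scalerDl; exact: PD.
  - by rewrite scaleNr; exact: PN.
  - exact: (Pb (c, y)).
(* The list s holds the factors that are not yet basis vectors; they are expanded one at a time. *)
have key (s : seq J) : forall q : J -> M,
    (forall j, j \notin s -> exists y, q j = bvec bM y) ->
    forall a : R, P (a *: pure q).
  elim: s => [|j0 s IHs] q qP a.
    have /choice[y yP] : forall j, exists y, q j = bvec bM y by move=> j; exact: qP.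
    have -> : q = bvec bM \o y by apply/funext.
    exact: base.
  have -> : q = dfwith q j0 (q j0).
    by apply/funext => j; rewrite dfwithE; case: eqP => [->|].
  move: (q j0) => z; move: z a; apply: (bvec_ind bM) => [a|f g Pf Pg a|c y a].
  - by rewrite pure_dfwith0 scaler0.
  - have := @pure_multilinear R M J q j0 1 f g; rewrite !scale1r => /= ->.
    by rewrite scalerDr; exact: PD.
  - have := @pure_multilinear R M J q j0 c (bvec bM y) 0.
    rewrite addr0 pure_dfwith0 addr0 => /= ->; rewrite scalerA.
    apply: IHs => j js; rewrite dfwithE; case: eqP => [_|/eqP jj0]; first by exists y.
    by apply: qP; rewrite inE negb_or jj0.
apply: tens_ind => // a q; apply: (key (fset_set [set: J])) => j.
by rewrite in_fset_set // in_setT.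
Qed.

Definition tcoef (b : C * (J -> Y)) (t : tens M J) : int :=
  mcoef mR b.1 (cf b.2 t).

Lemma tcoefD b : {morph tcoef b : t u / t + u}.
Proof. by move=> t u; rewrite /tcoef cfD mcoefD. Qed.

Lemma tcoef_basis b b' : tcoef b (tbasis b') = (b == b')%:Z.
Proof.
rewrite /tcoef cf_basis; case: b b' => [c y] [c' y'] /=.
rewrite xpair_eqE andbC; case: eqP => _ /=; first by rewrite mcoef_monom.
by rewrite (morphD0 (mcoefD mR c)).
Qed.

(** Allowing every larger B' makes the claim additive in t: the sets of two summands can be
    joined. *)
Lemma basis_expand t : exists B : {fset C * (J -> Y)},
  forall B' : {fset C * (J -> Y)}, {subset B <= B'} ->
    t = \sum_(b <- B') tbasis b *~ tcoef b t.
Proof.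
move: t; apply: basis_ind.
- exists fset0 => B' _; rewrite big1 // => b _.
  by rewrite (morphD0 (tcoefD b)) mulr0z.
- move=> t u [B tB] [B' uB']; exists (B `|` B')%fset => D sD.
  under eq_bigr do rewrite tcoefD mulrzDr.
  rewrite big_split /= -tB -?uB' // => b bB; apply: sD; rewrite inE bB ?orbT //.
- move=> t [B tB]; exists B => D /tB tD; rewrite {1}tD -sumrN.
  by apply: eq_bigr => b _; rewrite (morphDN (tcoefD b)) mulrNz.
- move=> b; exists [fset b]%fset => D /(_ b); rewrite inE eqxx => /(_ isT) bD.
  rewrite (big_fsetD1 b) //= tcoef_basis eqxx mulr1z big1_fset ?addr0 // => b'.
  by rewrite !inE => /andP[/negPf bb' _] _; rewrite tcoef_basis bb' mulr0z.
Qed.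

Lemma tcoef_inj t u : (forall b, tcoef b t = tcoef b u) -> t = u.
Proof.
move=> tu; apply/eqP; rewrite -subr_eq0; apply/eqP.
have [B /(_ B (fun _ => id)) ->] := basis_expand (t - u).
by rewrite big1 // => b _; rewrite (morphDB (tcoefD b)) tu subrr mulr0z.
Qed.

End Evaluation.

Lemma fsbig_finType (R : Type) (idx : R) (op : Monoid.com_law idx) (F : finType)
    (A : set F) (f : F -> R) :
  \big[op/idx]_(i \in A) f i = \big[op/idx]_(i : F | i \in A) f i.
Proof.
rewrite fsbig_mkcond (fsbigE (enum F)) ?enum_uniq //=; last first.
  by move=> i _; rewrite mem_enum.
rewrite big_enum_cond /= [RHS]big_mkcond /=.
by apply: eq_big => i; rewrite in_setT.
Qed.

Lemma big_fsbig (R : Type) (idx : R) (op : Monoid.com_law idx) (F : finType)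
    (P : pred F) (f : F -> R) :
  \big[op/idx]_(i : F | P i) f i = \big[op/idx]_(i \in [set i | P i]) f i.
Proof.
rewrite fsbig_finType; apply: eq_bigl => i.
by apply/idP/idP => [Pi|/set_mem //]; exact: mem_set.
Qed.

Section EvaluationFormulas.
Variables (R : comPzRingType) (M : lmodType R) (Y : choiceType).
Variable bM : module_basis M Y.

Lemma cf_bij (J J' : choiceType) (phi : J -> J') (y : J' -> Y) (t : tens M J) :
  finite_set [set: J] -> finite_set [set: J'] -> bijective phi ->
  cf bM y (tens_bij phi t) = cf bM (y \o phi) t.
Proof.
move=> finJ finJ' phiB; case: (phiB) => psi phiK psiK.
have psiB : bijective psi by exists phi.
rewrite (tens_bijE _ phiK psiK); move: t; apply: tens_ind.
- by rewrite (morphD0 (tens_reindexD psiB)) !(morphD0 (cfD _ _ _)).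
- by move=> t u tE uE; rewrite (tens_reindexD psiB) !cfD // tE uE.
- move=> a m; rewrite (tens_reindexZ psiB) tens_reindex_pure // !cfZ // !cf_pure //.
  rewrite (reindex_fsbigT phi) //; congr (_ * _); apply: eq_fsbigr => j _ /=.
  by rewrite phiK.
Qed.

(** With n written as a sum of pure tensors, the product over d distributes into the sum over
    functions of [tens_pow_expand]. *)
Lemma cf_pow (J D : choiceType) (y : J * D -> Y) (n : tens M J) :
  finite_set [set: J] -> finite_set [set: D] ->
  cf bM y (tens_pow D n) = \prod_(d \in [set: D]) cf bM (fun j => y (j, d)) n.
Proof.
move=> finJ finD; move: D finD y.
apply: (@finite_choice_ind (fun D => forall y : J * D -> Y, _)) => F y.
have finF : finite_set [set: F] by exact: finite_finset.
have finJF : finite_set [set: J * F] by rewrite -setXTT; exact: finite_setX.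
rewrite fsbig_finType; under eq_bigl do rewrite in_setT.
have [k [r [m ->]]] := tens_decomp n.
rewrite tens_pow_expand (morphD_sum (cfD bM finJF y)).
under [RHS]eq_bigr do rewrite (morphD_sum (cfD bM finJ _)).
rewrite bigA_distr_bigA /=; apply: eq_bigr => phi _.
under [RHS]eq_bigr do rewrite cfZ // cf_pure //.
rewrite big_split cfZ //= cf_pure //; congr (_ * _).
transitivity (\prod_(p \in [set: J] `*` [set: F])
    bcoord bM (y (p.1, p.2)) (m (phi p.2) p.1)).
  by rewrite setXTT; apply: eq_fsbigr => -[j d] _.
rewrite -(@pair_fsbig _ _ _ _ _ setT setT
  (fun j (d : F) => bcoord bM (y (j, d)) (m (phi d) j))) //.
rewrite exchange_fsbig // fsbig_finType.
by apply: eq_bigl => d; rewrite in_setT.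
Qed.

Lemma cf_term (G : groupType) rep (V A U : set G) (n : tens M (coset setT V))
    (y : coset setT U -> Y) :
  finite_set [set: coset setT V] -> finite_set [set: coset setT U] ->
  finite_set [set: coset A U] -> bijective (@comb G rep V A U) ->
  cf bM y (tens_term rep A U n) =
  \prod_(d \in [set: coset A U]) cf bM (fun C => y (comb rep (C, d))) n.
Proof.
move=> finV finU finA cB; rewrite /tens_term cf_bij ?cf_pow //.
by rewrite -setXTT; exact: finite_setX.
Qed.

End EvaluationFormulas.

(** * The necklace congruence *)

Local Close Scope classical_set_scope.

Section Necklace.
Variables (R : comPzRingType) (C : choiceType) (one : C) (op : Monoid.com_law one).
Variable mR : monoid_ring R op.

Definition eqmodn (N : nat) (r s : R) := exists z, r = s + z *+ N.

Section Congruence.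
Variable N : nat.
Local Notation "r === s" := (eqmodn N r s) (at level 70).

Lemma eqmodn_refl r : r === r.
Proof. by exists 0; rewrite mul0rn addr0. Qed.

Lemma eqmodnD r r' s s' : r === r' -> s === s' -> r + s === r' + s'.
Proof. by move=> [y ->] [z ->]; exists (y + z); rewrite mulrnDl addrACA. Qed.

Lemma eqmodnM r r' s s' : r === r' -> s === s' -> r * s === r' * s'.
Proof.
move=> [y ->] [z ->]; exists (y * s' + r' * z + y * (z *+ N)).
rewrite mulrDl !mulrDr -addrA; congr (_ + _).
rewrite mulrnAl mulrnAr !mulrnDl mulrnAr mulrnAl mulrnAr.
by rewrite addrA [_ *+ N + _]addrC.
Qed.

Lemma eqmodn_sum (I : Type) (r : seq I) (P : pred I) (f g : I -> R) :
  (forall i, P i -> f i === g i) ->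
  \sum_(i <- r | P i) f i === \sum_(i <- r | P i) g i.
Proof.
move=> fg; apply: (big_ind2 (eqmodn N)) => //; first exact: eqmodn_refl.
exact: eqmodnD.
Qed.

Lemma eqmodn_prod (I : Type) (r : seq I) (P : pred I) (f g : I -> R) :
  (forall i, P i -> f i === g i) ->
  \prod_(i <- r | P i) f i === \prod_(i <- r | P i) g i.
Proof.
move=> fg; apply: (big_ind2 (eqmodn N)) => //; first exact: eqmodn_refl.
exact: eqmodnM.
Qed.

Lemma eqmodn_coef_psi k c r s : r === s ->
  (N%:Z %| mcoef mR c (psi mR k r) - mcoef mR c (psi mR k s))%Z.
Proof.
move=> [z ->]; rewrite (psiD mR) (mcoefD mR) addrC addKr.
rewrite (morphD_mulrn (psiD mR k)) (morphD_mulrn (mcoefD mR c)) -mulr_natr.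
by rewrite natz dvdz_mull.
Qed.

Definition monosum (l : seq C) : R := \sum_(c <- l) monom mR c.

(** Signs disappear modulo N, which turns a ring element into a multiset of monomials that can be
    counted. *)
Lemma monosumP (r : R) : (0 < N)%N -> exists l, r === monosum l.
Proof.
move=> N0; elim/(monom_ind mR): r => [|r s [l rl] [l' sl']|r [l rl]|c].
- by exists [::]; rewrite /monosum big_nil; exact: eqmodn_refl.
- by exists (l ++ l'); rewrite /monosum big_cat; exact: eqmodnD.
(* The negative of r is congruent to (N - 1) r, hence N - 1 copies of l. *)
- exists (flatten (nseq N.-1 l)).
  have -> : monosum (flatten (nseq N.-1 l)) = monosum l *+ N.-1.
    rewrite /monosum big_flatten /= big_nseq.
    by elim: N.-1 => [|k IHk] //=; rewrite IHk mulrS.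
  have [z rE] := rl; exists (- z - monosum l).
  have sN : monosum l *+ N = monosum l *+ N.-1 + monosum l.
    by rewrite -{1}(prednK N0) mulrSr.
  by rewrite rE opprD mulrnBl mulNrn sN opprD addrCA addNKr addrC.
- by exists [:: c]; rewrite /monosum big_seq1; exact: eqmodn_refl.
Qed.

End Congruence.

Section Labelings.
Variables (J : finType) (B : nat) (l : J -> seq C).
Implicit Type th : {ffun J -> option 'I_B}.

(** A labelling th stands for one term of an expanded product: [None] puts j outside the subset, and
    [Some i] selects the i-th monomial of l j. The bound B gives all lists one finite index type. *)
Definition label_dom th : {set J} := [set j | th j]%SET.
Definition label_ok th :=
  [forall j, if th j is Some i then (i < size (l j))%N else true].
Definition label_wt th : C :=
  \big[op/one]_j (if th j is Some i then nth one (l j) i else one).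

Lemma monom_big (I : Type) (r : seq I) (P : pred I) (f : I -> C) :
  monom mR (\big[op/one]_(i <- r | P i) f i) = \prod_(i <- r | P i) monom mR (f i).
Proof. by apply: big_morph; [exact: monomM | exact: monom1]. Qed.

Lemma labelings_expand (P : pred {set J}) :
  (forall j, (size (l j) <= B)%N) ->
  \sum_(D | P D) \prod_(j in D) monosum (l j) =
  \sum_(th | P (label_dom th) && label_ok th) monom mR (label_wt th).
Proof.
move=> lB; rewrite [RHS](partition_big label_dom P) => [|th /andP[]//].
apply: eq_bigr => D PD.
pose Q j (i : option 'I_B) := if i is Some i then (i < size (l j))%N else false.
pose g j (i : option 'I_B) := monom mR (if i is Some i then nth one (l j) i else one).
transitivity (\prod_(j in D) \sum_(i | Q j i) g j i).
  apply: eq_bigr => j _; rewrite /monosum (big_nth one) big_mkord.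
  rewrite (big_ord_widen B (fun i => monom mR (nth one (l j) i))) //.
  rewrite [RHS](reindex_omap Some id) /=; last by case.
  by apply: eq_bigl => i; rewrite eqxx andbT.
rewrite (big_distr_big_dep None); apply: eq_big => [th|th /pfamilyP[/fintype.subsetP thD thQ]].
  apply/pfamilyP/andP => [[/fintype.subsetP thD thQ]|[/andP[_ /forallP thok] /eqP <-]].
    have domE : label_dom th = D.
      apply/setP => j; rewrite inE; apply/idP/idP => [thj|/thQ]; last by case: (th j).
      by apply: thD; rewrite inE; case: (th j) thj.
    split; last by rewrite domE.
    rewrite domE PD; apply/forallP => j.
    have := thQ j; rewrite -domE inE; case: (th j) => //= i /(_ isT); exact.
  split; first by apply/fintype.subsetP => j; rewrite !inE; case: (th j).
  by move=> j; rewrite inE; have := thok j; case: (th j).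
rewrite /label_wt monom_big /= [LHS]big_mkcond /=; apply: eq_bigr => j _.
rewrite /g; case: ifP => // /negP jD.
have := thD j; rewrite inE; case: (th j) => [i /(_ isT)//|_].
by rewrite monom1.
Qed.

End Labelings.

Section Counting.
Variables (J : finType) (K : {group {perm J}}).
Hypothesis K_free : forall (p : {perm J}) j, p \in K -> p j = j -> p = 1%g.

Definition relabel B (th : {ffun J -> option 'I_B}) (p : {perm J}) :
  {ffun J -> option 'I_B} := [ffun j => th (p^-1%g j)].

Lemma relabel1 B : @relabel B ^~ 1%g =1 id.
Proof. by move=> th; apply/ffunP => j; rewrite ffunE invg1 perm1. Qed.

Lemma relabelM B (th : {ffun J -> option 'I_B}) (p q : {perm J}) :
  relabel th (p * q)%g = relabel (relabel th p) q.
Proof. by apply/ffunP => j; rewrite !ffunE invMg permM. Qed.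

Definition relabel_act B := TotalAction (@relabel1 B) (@relabelM B).

Lemma card_porbit_free (p : {perm J}) j : p \in K -> #|porbit p j| = #[p]%g.
Proof.
move=> pK; rewrite porbit.unlock card_in_imset // => q q' qp qp' E.
have sub r : r \in <[p]>%g -> r \in K by apply: fintype.subsetP; rewrite cycle_subG.
apply/eqP; rewrite eq_mulgV1; apply/eqP; apply: (@K_free _ j).
  by rewrite groupM ?groupV ?sub.
by rewrite permM; move: E; rewrite /aperm => ->; rewrite permK.
Qed.

Variables (QQ : {set {set J}}).
Hypothesis QK : forall (p : {perm J}) (D : {set J}),
  p \in K -> D \in QQ -> (p @: D)%SET \in QQ.

Lemma iter_big_op (I : finType) (f : I -> C) n :
  \big[op/one]_i iter n (op (f i)) one = iter n (op (\big[op/one]_i f i)) one.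
Proof.
elim: n => [|n IHn] /=; first by rewrite big1.
by rewrite big_split IHn.
Qed.

Section Fixed.
Variables (p : {perm J}) (pK : p \in K) (J' : finType) (pi : J -> J').
Hypothesis pi_surj : forall k, exists j, pi j = k.
Hypothesis piE : forall j j', (pi j == pi j') = (j' \in porbit p j).
Variables (l : J -> seq C) (l' : J' -> seq C) (l'E : forall j, l' (pi j) = l j).
Variable B : nat.

Let lift (th : {ffun J' -> option 'I_B}) : {ffun J -> option 'I_B} :=
  [ffun j => th (pi j)].

Let lift_inj : injective lift.
Proof.
move=> th th' E; apply/ffunP => k; have [j <-] := pi_surj k.
by have /ffunP/(_ j) := E; rewrite !ffunE.
Qed.

Let lift_dom th : label_dom (lift th) = (pi @^-1: label_dom th)%SET.
Proof. by apply/setP => j; rewrite !inE ffunE. Qed.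

Let lift_ok th : label_ok l (lift th) = label_ok l' th.
Proof.
apply/forallP/forallP => [thok k|thok j]; last by rewrite ffunE -l'E.
by have [j <-] := pi_surj k; have := thok j; rewrite ffunE l'E.
Qed.

(** By freeness every p-orbit has #[p] points, so each monomial chosen for an orbit occurs #[p]
    times. This is the origin of [psi mR #[p]] in the congruence. *)
Let lift_wt th : label_wt l (lift th) = iter #[p]%g (op (label_wt l' th)) one.
Proof.
rewrite /label_wt -iter_big_op (partition_big pi xpredT) //=.
apply: eq_bigr => k _.
have [j0 <-] := pi_surj k; set x := if th (pi j0) is Some i then _ else _.
transitivity (\big[op/one]_(j in porbit p j0) x).
  apply: eq_big => [j|j /eqP jk]; first by rewrite eq_sym piE.
  by rewrite ffunE -l'E jk.
by rewrite big_const card_porbit_free.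
Qed.

(** J' is the set of p-orbits; a labelling fixed by p is constant on them and so factors through
    pi. *)
Lemma card_fixed_labelings m :
  #|('Fix_([set th : {ffun J -> option 'I_B} | [&& label_dom th \in QQ,
        label_ok l th & label_wt l th == m]]%SET | relabel_act B)[p])%g| =
  #|[set th : {ffun J' -> option 'I_B} | ((pi @^-1: label_dom th)%SET \in QQ) &&
        label_ok l' th && (iter #[p]%g (op (label_wt l' th)) one == m)]%SET|.
Proof.
rewrite -(card_imset _ lift_inj); apply: eq_card => th.
apply/idP/imsetP => [|[th' th'S ->]]; last first.
  rewrite inE; apply/andP; split; last first.
    apply/afix1P; apply/ffunP => j; rewrite !ffunE; congr (th' _).
    apply/eqP; rewrite piE -{1}[j](permKV p) -[p (p^-1%g j)]/((p ^+ 1)%g _).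
    exact: mem_porbit.
  by move: th'S; rewrite !inE lift_dom lift_ok lift_wt andbA.
rewrite inE => /andP[thS /afix1P thp].
have thE i j : th ((p ^+ i)%g j) = th j.
  elim: i => [|i IHi]; first by rewrite expg0 perm1.
  rewrite expgSr permM -{1}IHi; set j' := (p ^+ i)%g j.
  by rewrite -{1}thp ffunE permK.
have [s sP] := choice pi_surj.
have th_lift : th = lift [ffun k => th (s k)].
  apply/ffunP => j; rewrite !ffunE.
  have /porbitP[i ->] : s (pi j) \in porbit p j by rewrite -piE sP.
  by rewrite thE.
exists [ffun k => th (s k)] => //.
by move: thS; rewrite {1}th_lift !inE lift_dom lift_ok lift_wt andbA.
Qed.

End Fixed.

(* Modulo #|K| each F j is a sum of monomials.  The c-coefficient of the summand at
   p then counts the p-invariant choices of a subset in QQ and a monomial at each of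
   its points with product c, so the congruence is the Cauchy-Frobenius formula. *)
Lemma necklace_congruence (F : J -> R) (J' : {perm J} -> finType)
    (pi : forall p, J -> J' p) (F' : forall p, J' p -> R) (c : C) :
  (forall p j, p \in K -> F (p j) = F j) ->
  (forall p k, p \in K -> exists j, pi p j = k) ->
  (forall p j j', p \in K -> (pi p j == pi p j') = (j' \in porbit p j)) ->
  (forall p j, p \in K -> F' p (pi p j) = F j) ->
  (#|K|%:Z %| \sum_(p in K) mcoef mR c (psi mR #[p]%g
     (\sum_(D : {set J' p} | (pi p @^-1: D)%SET \in QQ) \prod_(k in D) F' p k)))%Z.
Proof.
move=> FK pi_surj piE F'E; pose N := #|K|.
have N0 : (0 < N)%N by exact: cardG_gt0.
(* The list depends only on the value in R, so the lists inherit the K-invariance of F and the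
   compatibility of F' with pi. *)
have [lst lstP] := choice (fun r => monosumP r N0).
pose l j := lst (F j); pose l' p k := lst (F' p k).
pose B := (\max_j size (l j))%N.
have lB j : (size (l j) <= B)%N by exact: (leq_bigmax j).
pose Sm := [set th : {ffun J -> option 'I_B} | [&& label_dom th \in QQ,
        label_ok l th & label_wt l th == c]]%SET.
have actS : ([acts K, on Sm | relabel_act B])%g.
  apply/actsP => p pK; suff sub q th : q \in K -> th \in Sm -> relabel th q \in Sm.
    move=> th; apply/idP/idP => [thS|]; last exact: sub.
    have := sub p^-1%g _ _ thS; rewrite groupV => /(_ pK).
    by rewrite -[relabel _ _]/(relabel_act B _ _)%g /= -relabelM mulgV relabel1.
  move=> qK; rewrite !inE => /and3P[domQ /forallP thok /eqP thw].
  have -> : label_dom (relabel th q) = (q @: label_dom th)%SET.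
    apply/setP => j; rewrite inE ffunE; apply/idP/imsetP => [thj|[j' + ->]].
      by exists (q^-1%g j); rewrite ?inE // permKV.
    by rewrite inE permK.
  rewrite QK //=; apply/andP; split.
    apply/forallP => j; rewrite ffunE; have := thok (q^-1%g j).
    by rewrite /l FK // groupV.
  rewrite -thw /label_wt (reindex_inj (@perm_inj _ q)) /=; apply/eqP.
  by apply: eq_bigr => j _; rewrite ffunE permK /l FK.
have term p : p \in K -> (N%:Z %| mcoef mR c (psi mR #[p]%g
    (\sum_(D : {set J' p} | (pi p @^-1: D)%SET \in QQ) \prod_(k in D) F' p k)) -
    #|('Fix_(Sm | relabel_act B)[p])%g|%:Z)%Z.
  move=> pK; have l'E j : l' p (pi p j) = l j by rewrite /l' F'E.
  have l'B k : (size (l' p k) <= B)%N by have [j <-] := pi_surj p k pK; rewrite l'E.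
  pose P (D : {set J' p}) := (pi p @^-1: D)%SET \in QQ.
  have -> : #|('Fix_(Sm | relabel_act B)[p])%g|%:Z = mcoef mR c (psi mR #[p]%g
      (\sum_(D | P D) \prod_(k in D) monosum (l' p k))).
    rewrite (labelings_expand P l'B) (morphD_sum (psiD mR _)).
    rewrite (morphD_sum (mcoefD mR c)).
    under eq_bigr do rewrite psi_monom mcoef_monom eq_sym.
    rewrite (card_fixed_labelings pK (pi_surj p ^~ pK)
      (fun j j' => piE p j j' pK) l'E B c) -sum1_card.
    rewrite (big_morph Posz PoszD (erefl _)) [LHS]big_mkcond [RHS]big_mkcond /=.
    apply: eq_bigr => th _; rewrite inE /P.
    by case: (_ \in QQ) => //=; case: (label_ok _ _) => //=; case: (_ == c).
  apply: eqmodn_coef_psi; apply: eqmodn_sum => D _; apply: eqmodn_prod => k _.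
  exact: lstP.
rewrite -[X in (_ %| X)%Z](subrK (\sum_(p in K) #|('Fix_(Sm | relabel_act B)[p])%g|%:Z)).
rewrite -sumrB; apply: rpredD; first by apply: rpred_sum => p; exact: term.
rewrite -(big_morph Posz PoszD (erefl _)) (Frobenius_Cauchy actS) PoszM.
exact: dvdz_mull.
Qed.

End Counting.

End Necklace.

Local Open Scope classical_set_scope.
Local Open Scope ring_scope.

(** * The group N_H(U)/U acting on G/U *)

Section RightTranslation.
Variables (G : groupType) (H U : set G) (H_ : subgroup H) (U_ : subgroup U).
Hypothesis UH : U `<=` H.
Hypothesis finU : finite_set [set: coset setT U].

Definition cosets_fin : finType := fin_of finU.
Notation J := cosets_fin.

(** Right multiplication by h is well defined on G/U only if h normalises U, so the existence of p
    encodes membership in the normaliser. *)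
Definition rtrans (p : {perm J}) (h : G) := forall a, p (lc U a) = lc U (a * h)%g.

Lemma rtrans_conjs p h : rtrans p h -> conjs h U = U.
Proof.
move=> ph; apply/seteqP; split=> u; rewrite conjsP => Uu.
  have : p (lc U u) = p (lc U 1).
    rewrite !ph mul1g; apply/lc_eqP => //; rewrite invgM.
    by have := subgroupV U_ Uu; rewrite !invgM invgK mulgA.
  by move=> /perm_inj/(lc_eqP _ _ U_); rewrite mulg1 subgroupVE.
have : p (lc U u) = p (lc U 1).
  by congr (p _); apply/lc_eqP => //; rewrite mulg1; exact: subgroupV.
rewrite !ph mul1g => /(lc_eqP _ _ U_); rewrite -subgroupVE //.
by rewrite !invgM !invgK mulgA.
Qed.

Lemma rtrans1 u : U u -> rtrans 1%g u.
Proof. by move=> Uu a; rewrite perm1; apply/lc_eqP => //; rewrite mulKg. Qed.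

Lemma rtransM p q h k : rtrans p h -> rtrans q k -> rtrans (p * q)%g (h * k)%g.
Proof. by move=> ph qk a; rewrite permM ph qk mulgA. Qed.

Lemma rtransV p h : rtrans p h -> rtrans p^-1%g h^-1%g.
Proof. by move=> ph a; apply: (@perm_inj _ p); rewrite permKV ph mulgVK. Qed.

Lemma rtransX p h i : rtrans p h -> rtrans (p ^+ i)%g (h ^+ i)%g.
Proof.
move=> ph; elim: i => [|i IHi]; first by rewrite !expg0; apply: rtrans1; exact: subgroup1.
by rewrite !expgS; exact: rtransM.
Qed.

Lemma rtrans_uniq p h h' : rtrans p h -> rtrans p h' -> U (h^-1 * h')%g.
Proof.
by move=> /(_ 1%g); rewrite mul1g => + /(_ 1%g); rewrite mul1g => -> /(lc_eqP _ _ U_).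
Qed.

Lemma rtrans_inj p q h : rtrans p h -> rtrans q h -> p = q.
Proof. by move=> ph qh; apply/perm.permP => E; have [a ->] := lcW E; rewrite ph qh. Qed.

Lemma rtrans_exists h : conjs h U = U -> exists p, rtrans p h.
Proof.
move=> hU; pose f (E : J) : J := coset_shift (esym hU) E.
have f_inj : injective f by apply: bij_inj; exact: coset_shift_bij.
exists (perm f_inj) => a; rewrite permE; apply: val_inj => /=.
by rewrite rcoset_lcoset -{1}hU -conjsM mulVg conjs1.
Qed.

Lemma rtrans_fix p h E : rtrans p h -> p E = E -> p = 1%g.
Proof.
have [a ->] := lcW E; move=> ph; rewrite ph => /(lc_eqP _ _ U_).
rewrite invgM mulgVK -?mulgA ?mulVg ?mulg1 subgroupVE // => Uh.
exact: rtrans_inj ph (rtrans1 Uh).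
Qed.

(* The image of N_H(U) in the permutations of G/U; it is N_H(U)/U. *)
Definition weyl_set : {set {perm J}} :=
  [set p : {perm J} | `[< exists2 h, H h & rtrans p h >]]%SET.

Lemma weylP (p : {perm J}) : reflect (exists2 h, H h & rtrans p h) (p \in weyl_set).
Proof. by rewrite inE; exact: asboolP. Qed.

Lemma weyl_group_set : group_set weyl_set.
Proof.
apply/group_setP; split=> [|p q /weylP[h Hh ph] /weylP[k Hk qk]].
  by apply/weylP; exists 1%g; [exact: subgroup1 | exact: rtrans1 (subgroup1 U_)].
by apply/weylP; exists (h * k)%g; [exact: subgroupM | exact: rtransM].
Qed.
Definition weyl := fingroup.Group weyl_group_set.

Section Stabilizer.
Variables (Y : Type) (y : coset setT U -> Y).

Definition stab_set : {set {perm J}} :=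
  [set p : {perm J} | (p \in weyl) && `[< forall E, y (p E) = y E >]]%SET.

Lemma stabP (p : {perm J}) :
  reflect (p \in weyl /\ forall E, y (p E) = y E) (p \in stab_set).
Proof.
rewrite [p \in stab_set]inE. apply: (iffP idP) => [/andP[pN /asboolP yp] //|[pN yp]].
by apply/andP; split=> //; exact/asboolP.
Qed.

Lemma stab_group_set : group_set stab_set.
Proof.
apply/group_setP; split=> [|p q /stabP[pN yp] /stabP[qN yq]].
  by apply/stabP; split=> [|E]; rewrite ?group1 // perm1.
by apply/stabP; split=> [|E]; [exact: groupM | rewrite permM yq yp].
Qed.
Definition stab := fingroup.Group stab_group_set.

Lemma stab_weyl p : p \in stab -> p \in weyl.
Proof. by move=> /stabP[]. Qed.

End Stabilizer.

Lemma weyl_free (p : {perm J}) E : p \in weyl -> p E = E -> p = 1%g.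
Proof. by move=> /weylP[h _ ph]; exact: rtrans_fix ph. Qed.

(* The subgroup of N_H(U) lying over the cyclic group <[p]> of N_H(U)/U. *)
Definition cyc (p : {perm J}) : set G :=
  [set h | H h /\ exists2 q : {perm J}, q \in <[p]>%g & rtrans q h].

Lemma cyc_subgroup p : subgroup (cyc p).
Proof.
split=> [|h k [Hh [q qp qh]] [Hk [r rp rk]]|h [Hh [q qp qh]]].
- split; first exact: subgroup1.
  by exists 1%g; [exact: group1 | exact: rtrans1 (subgroup1 U_)].
- split; first exact: subgroupM.
  by exists (q * r)%g; [exact: groupM | exact: rtransM].
- split; first exact: subgroupV.
  by exists q^-1%g; [rewrite groupV | exact: rtransV].
Qed.

Lemma sub_cyc p : U `<=` cyc p.
Proof. by move=> u Uu; split; [exact: UH | exists 1%g; [exact: group1 | exact: rtrans1]]. Qed.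

Lemma cyc1 : cyc 1%g = U.
Proof.
apply/seteqP; split=> [h [_ [q]]|]; last exact: sub_cyc.
rewrite cycle1 inE => /eqP -> qh.
by have := rtrans_uniq (rtrans1 (subgroup1 U_)) qh; rewrite invg1 mul1g.
Qed.

Lemma cyc_proper p : p \in weyl -> p != 1%g -> exists2 h, cyc p h & ~ U h.
Proof.
move=> /weylP[h Hh ph] /eqP p1; exists h.
  by split=> //; exists p => //; exact: cycle_id.
by move=> Uh; apply: p1; exact: rtrans_inj ph (rtrans1 Uh).
Qed.

Definition cyc_proj p (E : coset setT U) : coset setT (cyc p) :=
  lc (cyc p) (xget 1%g (val E)).

Lemma xget_lcoset a : lcoset a U (xget 1%g (lcoset a U)).
Proof. by apply: (xgetI _ (x := a)); exact: lcoset_refl. Qed.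

Lemma cyc_projE p a : cyc_proj p (lc U a) = lc (cyc p) a.
Proof.
apply/lc_eqP; first exact: cyc_subgroup.
have := xget_lcoset a; rewrite lcosetP => Uax; apply: sub_cyc => /=.
by rewrite -subgroupVE // invgM invgK.
Qed.

(** For a^-1 b in [cyc p], right translation by it is a power of p, which takes aU to bU; thus the
    fibres of G/U over G/[cyc p] are the p-orbits required by [card_fixed_labelings]. *)
Lemma cyc_proj_eq p E E' : p \in weyl ->
  (cyc_proj p E == cyc_proj p E') = (E' \in porbit p (E : J)).
Proof.
move=> /weylP[h Hh ph]; have [a ->] := lcW E; have [b ->] := lcW E'.
rewrite !cyc_projE; apply/eqP/porbitP => [|[i bE]].
  move=> /(lc_eqP _ _ (cyc_subgroup p)) [_ [q /cycleP[i ->] qab]].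
  by exists i; rewrite qab mulVKg.
apply/lc_eqP; first exact: cyc_subgroup.
have pih := rtransX i ph.
have Hh' : H (h ^+ i)%g.
  elim: i {bE pih} => [|i IHi]; first by rewrite expg0; exact: subgroup1.
  by rewrite expgS; exact: subgroupM.
have : cyc p (h ^+ i)%g by split=> //; exists (p ^+ i)%g => //; exact: mem_cycle.
move: bE; rewrite pih => /esym/(lc_eqP _ _ U_) Ub cpi.
rewrite -(subgroupMr (cyc_subgroup p) _ (sub_cyc p Ub)) in cpi.
by move: cpi; rewrite invgM !mulgA mulgV mul1g.
Qed.

(** The descent of y to G/[cyc p], meaningful when p fixes y; by [cyc_labelE] the element chosen in
    E is then immaterial. *)
Definition cyc_label (Y : Type) (y : coset setT U -> Y) p (E : coset setT (cyc p)) : Y :=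
  y (lc U (xget 1%g (val E))).

Lemma cyc_labelE (Y : Type) (y : coset setT U -> Y) (p : {perm J}) a :
  p \in stab y -> cyc_label y (lc (cyc p) a) = y (lc U a).
Proof.
move=> /stabP[_ yp]; rewrite /cyc_label.
have : lcoset a (cyc p) (xget 1%g (lcoset a (cyc p))).
  by apply: (xgetI _ (x := a)); apply: lcoset_refl; exact: cyc_subgroup.
rewrite lcosetP => -[_ [q /cycleP[i ->] qh]].
rewrite /= -[in LHS](mulVKg a (xget _ _)) -qh.
elim: i {qh} => [|i IHi]; first by rewrite expg0 perm1.
by rewrite expgSr permM yp.
Qed.

End RightTranslation.

(** * The image of the ghost map *)

Section TermProduct.
Variables (R : comPzRingType) (M : lmodType R) (Y : choiceType).
Variables (bM : module_basis M Y) (G : groupType).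

(** A is a union of left cosets of U, so the product can be taken over a subset of G/U. This is the
    shape of a term in [necklace_congruence]. *)
Lemma cf_term_subset rep (V A U : set G) (n : tens M (coset setT V))
    (y : coset setT U -> Y) :
  finite_set [set: coset setT V] -> finite_set [set: coset setT U] ->
  finite_set [set: coset A U] -> bijective (@comb G rep V A U) ->
  subgroup U -> (forall a, A a -> lcoset a U `<=` A) ->
  cf bM y (tens_term rep A U n) =
  \prod_(E \in [set E : coset setT U | val E `<=` A])
     cf bM (fun C => y (comb rep (C, E))) n.
Proof.
move=> finV finU finA cB U_ AU; rewrite cf_term //.
have inclP (d : coset A U) : val d \in lcosets setT U.
  by have [a _ ->] := cosetW d; exact: lcosets_mem.
pose incl (d : coset A U) : coset setT U := exist _ (val d) (inclP d).
have inclB : set_bij [set: coset A U] [set E : coset setT U | val E `<=` A] incl.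
  split=> [d _ /=|d d' _ _ /(congr1 val) /=|E EA].
  - by have [a Aa ->] := cosetW d; exact: AU.
  - exact: val_inj.
  have [a aE] := lcW E; have Aa : A a by apply: EA; rewrite aE; exact: lcoset_refl.
  by exists (mkcoset U Aa) => //; apply: val_inj; rewrite aE.
rewrite (reindex_fsbig _ _ _ _ inclB); apply: eq_fsbigr => d _.
by congr cf; apply/funext => C; congr y; exact: val_inj.
Qed.

End TermProduct.

Section Dwork.
Variables (G : topologicalGroupType) (H : set G) (S : set (set G)).
Hypotheses (G_compact : compact [set: G]) (H_ : open_subgroup H).
Hypothesis (S_ : truncation_set H S).

Let Hg := open_subgroupW H_.

Lemma trunc_subgroup (U : S) : subgroup (val U).
Proof. exact/open_subgroupW/(trunc_open S_). Qed.

Lemma trunc_subH (U : S) : val U `<=` H.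
Proof. by have [] := trunc_sub S_ (set_mem (valP U)). Qed.

Lemma trunc_fin (U : S) : finite_set [set: coset setT (val U)].
Proof. exact: finite_coset (trunc_open S_ U). Qed.

Notation Jfin U := (cosets_fin (trunc_fin U)).
Notation cycU U p := (cyc H (finU := trunc_fin U) p).
Notation stabU U y := (stab Hg (trunc_subgroup U) (trunc_fin U) y).
Notation weylU U := (weyl Hg (trunc_subgroup U) (trunc_fin U)).

Lemma cyc_trunc (U : S) (p : {perm Jfin U}) : cycU U p \in S.
Proof.
have cp := cyc_subgroup Hg (trunc_subgroup U) p.
have Uc := sub_cyc (trunc_subgroup U) (@trunc_subH U) p.
apply/mem_set/(trunc_up S_ (U := val U)).
- exact/set_mem/(valP U).
- have [c1 cM cV] := cp; split=> //.
  have -> : cycU U p = \bigcup_(h in cycU U p) lcoset h (val U).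
    apply/seteqP; split=> [h ch|h [k ck /lcosetP/Uc ckh]].
      by exists h => //; apply: lcoset_refl; exact: trunc_subgroup.
    by have := cM _ _ ck ckh; rewrite mulVKg.
  apply: bigcup_open => h _; apply: lcoset_open.
  by case: (trunc_open S_ U).
- exact: Uc.
- by move=> h [].
Qed.

Definition cyc_in (U : S) (p : {perm Jfin U}) : S := exist _ (cycU U p) (cyc_trunc p).

Variables (A : Mod) (Y : choiceType) (bM : module_basis (module A) Y).
Variables (C : choiceType) (one : C) (op : Monoid.com_law one).
Variable mR : monoid_ring (base_ring A) op.

(* For x = ghost n with n concentrated at one V, the y-coefficient of x at W is a sum
   over the D in H/V fixed by W of a product of coefficients of n over the W-orbits in
   D; summing over the groups W = cyc_in p puts this in the form of
   necklace_congruence. *)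
Definition theta (x : tens_prod S A) (U : S) (y : coset setT (val U) -> Y) (m : C) : int :=
  \sum_(p in stabU U y)
    mcoef mR m (psi mR #[p]%g (cf bM (cyc_label y (p := p)) (x (cyc_in p)))).

Definition dwork (x : tens_prod S A) : Prop :=
  H_fixed H x /\ forall U (y : coset setT (val U) -> Y) m,
    (#|stabU U y|%:Z %| theta x y m)%Z.

Section GhostDwork.
Variable c : ghost_choice H S.

Lemma reps_fin (V : reps c) : finite_set [set: coset setT (val V)].
Proof. exact: finite_coset (reps_open S_ V). Qed.

Lemma fixed_invs (V : reps c) (W D : set G) : fixed_cosets H (val V) W D ->
  forall a w, W w -> invs D a -> invs D (a * w)%g.
Proof.
move=> [h [_ -> WV]] a w Ww; have V_ := open_subgroupW (reps_open S_ V).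
rewrite invs_lcoset // !rcosetP !invgK => Vah.
have : val V (h^-1 * w * h)%g by apply: WV; apply/conjsP; rewrite invgK !mulgA mulgV mul1g mulgK.
by move=> /(subgroupM V_ Vah); rewrite !mulgA mulgK.
Qed.

Lemma fixed_invs_lc (V : reps c) (W D : set G) a : subgroup W ->
  fixed_cosets H (val V) W D -> (lcoset a W `<=` invs D) <-> invs D a.
Proof.
move=> W_ WD; split=> [|Da x]; first by apply; exact: lcoset_refl.
rewrite lcosetP => Wax; have := fixed_invs WD Wax Da.
by rewrite mulVKg.
Qed.

Lemma invs_inj (D D' : set G) : (forall a, invs D a <-> invs D' a) -> D = D'.
Proof.
by move=> DD'; apply/seteqP; split=> x; have := DD' x^-1%g; rewrite /invs /= invgK => -[].
Qed.

Lemma cf_ghost_term (V : reps c) (U : S) D (y : coset setT (val U) -> Y)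
    (n : tens A (coset setT (val V))) :
  fixed_cosets H (val V) (val U) D ->
  cf bM y (ghost_term (val U) D n) =
  \prod_(E \in [set E : coset setT (val U) | val E `<=` invs D])
    cf bM (fun C => y (comb (rep c (val V)) (C, E))) n.
Proof.
move=> UD; have U_ := trunc_subgroup U; apply: cf_term_subset => //.
- exact: reps_fin.
- exact: trunc_fin.
- exact: finite_coset (trunc_open S_ U).
- exact: fixed_comb_bij UD.
- by move=> a /(fixed_invs_lc a U_ UD).
Qed.

(** [necklace_congruence] applies with J = G/U, K the stabiliser of y, J' p = G/[cyc_in p], and QQ
    the sets of U-cosets that make up some V h^-1 with hV fixed by U. *)
Lemma ghost_term_congruence (V : reps c) (U : S) (n : tens A (coset setT (val V)))
    (y : coset setT (val U) -> Y) m :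
  (#|stabU U y|%:Z %| \sum_(p in stabU U y) mcoef mR m (psi mR #[p]%g
     (cf bM (cyc_label y (p := p))
       (\sum_(D \in fixed_cosets H (val V) (cycU U p)) ghost_term (cycU U p) D n))))%Z.
Proof.
have U_ := trunc_subgroup U; have V_ := open_subgroupW (reps_open S_ V).
(* The factor that the coset E contributes in [cf_ghost_term]; F' is its analogue over
   [cyc_in p]. *)
pose F (E : Jfin U) := cf bM (fun C => y (comb (rep c (val V)) (C, E))) n.
pose F' (p : {perm Jfin U}) (E : Jfin (cyc_in p)) :=
  cf bM (fun C => cyc_label y (p := p) (comb (rep c (val V)) (C, E))) n.
pose isD D (B : {set Jfin U}) := forall a, ((lc (val U) a : Jfin U) \in B) <-> invs D a.
pose QQ : {set {set Jfin U}} :=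
  [set B : {set Jfin U} | `[< exists2 D, fixed_cosets H (val V) (val U) D & isD D B >]]%SET.
have finC D : finite_set (fixed_cosets H (val V) D) by exact: finite_fixed_cosets.
pose pi (p : {perm Jfin U}) : Jfin U -> Jfin (cyc_in p) := @cyc_proj G H (val U) (trunc_fin U) p.
have piE (p : {perm Jfin U}) a : pi p (lc (val U) a) = lc (val (cyc_in p)) a.
  exact: (cyc_projE Hg U_ (@trunc_subH U)).
have sumE p : p \in stabU U y ->
    cf bM (cyc_label y (p := p))
       (\sum_(D \in fixed_cosets H (val V) (cycU U p)) ghost_term (cycU U p) D n) =
    \sum_(B : {set Jfin (cyc_in p)} | (pi p @^-1: B)%SET \in QQ) \prod_(k in B) F' p k.
  move=> py; pose W := cyc_in p; have W_ := trunc_subgroup W.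
  have UW : val U `<=` val W by exact: (sub_cyc U_ (@trunc_subH U) p).
  rewrite (morphD_fsum (cfD _ (trunc_fin W) _)); last exact: finC.
  pose dset D : {set Jfin W} := [set E : Jfin W | `[< val (E : coset setT (val W)) `<=` invs D >]]%SET.
  have dsetI D (E : Jfin W) :
      (E \in dset D) = `[< val (E : coset setT (val W)) `<=` invs D >] by rewrite inE.
  have dsetE D a : fixed_cosets H (val V) (val W) D -> ((lc (val W) a : Jfin W) \in dset D) <-> invs D a.
    move=> WD; rewrite /dset inE; split=> [/asboolP|Da]; first by move/(fixed_invs_lc a W_ WD).
    by apply/asboolP/(fixed_invs_lc a W_ WD).
  have bij : set_bij (fixed_cosets H (val V) (val W))
      [set B : {set Jfin W} | (pi p @^-1: B)%SET \in QQ] dset.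
    split=> [D WD /=|D D' /set_mem WD /set_mem WD' E|B /=].
    - rewrite inE; apply/asboolP; exists D; first exact: fixed_cosets_sub WD.
      by move=> a; rewrite inE piE; exact: dsetE.
    - by apply: invs_inj => a; rewrite -!dsetE // E.
    rewrite inE => /asboolP[D UD DB].
    have BE a : ((lc (val W) a : Jfin W) \in B) <-> invs D a by rewrite -DB inE piE.
    (* B lives on G/W, so V h^-1 is stable under right multiplication by W, which says that W fixes
       hV. *)
    have WD : fixed_cosets H (val V) (val W) D.
      have [h [Hh DE UV]] := UD; exists h; split=> // x /conjsP; rewrite invgK => Wx.
      have Dh : invs D h^-1%g.
        by rewrite /invs /= invgK DE; exact: lcoset_refl.
      have : invs D (h^-1 * (h * x * h^-1))%g.
        apply/BE; have -> : lc (val W) (h^-1 * (h * x * h^-1))%g = lc (val W) h^-1%g.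
          by apply/lc_eqP => //; rewrite invgM -mulgA mulVg mulg1; exact: subgroupV.
        exact/BE.
      by rewrite DE invs_lcoset // rcosetP invgK !mulgA mulVg mul1g mulgVK.
    exists D => //; apply/setP => E; have [a ->] := lcW (E : coset setT (val W)).
    by apply/idP/idP => [/(dsetE _ _ WD)/BE|/BE/(dsetE _ _ WD)].
  rewrite big_fsbig (reindex_fsbig _ _ _ _ bij).
  apply: eq_fsbigr => D /set_mem WD.
  rewrite (@cf_ghost_term V W) // big_fsbig; apply: eq_fsbigl.
  apply/seteqP; split=> E /= EA; first exact: etrans (dsetI D E) (asboolT EA).
  exact: asboolW (etrans (esym (dsetI D E)) EA).
have FE : forall (p : {perm Jfin U}) (E : Jfin U), p \in stabU U y -> F (p E) = F E.
  move=> p E /stabP[/weylP[h _ ph] yp]; have [a ->] := lcW (E : coset setT (val U)).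
  rewrite /F; congr cf; apply/funext => K.
  have -> : comb (rep c (val V)) (K, p (lc (val U) a)) =
      p (comb (rep c (val V)) (K, lc (val U) a)) :> coset setT (val U).
    have -> : comb (rep c (val V)) (K, lc (val U) a) = lc (val U) (rep c (val V) (val K) * a)%g.
      by apply: val_inj => /=; rewrite lcosetM.
    rewrite !ph; apply: val_inj => /=; by rewrite !lcosetM.
  exact: yp.
under eq_bigr => p py do rewrite sumE //.
apply: necklace_congruence => //.
- by move=> p E pK pE; apply: (weyl_free (stab_weyl pK) pE).
(* p is right translation by some h normalising U; it moves the set attached to D0 to that attached
   to h^-1 D0, which is fixed by U as well. *)
- move=> p D pK; rewrite inE => /asboolP[D0 UD DB]; rewrite inE; apply/asboolP.
  have /stabP[/weylP[h Hh ph] _] := pK.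
  have hU : conjs h^-1%g (val U) = val U := esym ((conjs_eq _ _ _).1 (esym (rtrans_conjs U_ ph))).
  have [+ _ _] := fixed_cosets_conjs H_ (val V) (val U) (subgroupV Hg Hh).
  rewrite hU => /(_ _ UD) hD0; exists (lcoset h^-1%g D0) => // a.
  have mE (E : Jfin U) : (E \in (p @: D)%SET) = (p^-1%g E \in D).
    by rewrite -{1}[E](permKV p) mem_imset //; exact: perm_inj.
  by rewrite mE (rtransV ph) DB /invs /= lcosetP invgM invgK.
- exact: FE.
- move=> p k _; have [a aE] := lcW (k : coset setT (val (cyc_in p))).
  by exists (lc (val U) a); rewrite piE.
- move=> p E E' pK.
  exact: (cyc_proj_eq (@trunc_subH U) E E' (stab_weyl pK)).
- move=> p E pK; have [a ->] := lcW (E : coset setT (val U)).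
  rewrite /F' piE /F; congr cf; apply/funext => K.
  have -> : comb (rep c (val V)) (K, lc (val (cyc_in p)) a) =
      lc (val (cyc_in p)) (rep c (val V) (val K) * a)%g.
    by apply: val_inj => /=; rewrite lcosetM.
  rewrite (cyc_labelE _ pK); congr y; apply: val_inj => /=; exact: lcosetM.
Qed.

(** The groups [cyc_in p] contain U, so the support at U serves for all p at once, and the
    congruence can be checked for each V separately. *)
Lemma dwork_ghost (n : tens_prod (reps c) A) : dwork (ghost n).
Proof.
split=> [|U y m]; first exact: ghost_fixed.
have finU := finite_ghost_supp G_compact H_ S_ c (trunc_open S_ U).
rewrite /theta.
have ghostW (p : {perm Jfin U}) : p \in stabU U y ->
    mcoef mR m (psi mR #[p]%g (cf bM (cyc_label y (p := p)) (ghost n (cyc_in p)))) =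
    \sum_(V \in ghost_supp c (val U)) mcoef mR m (psi mR #[p]%g
     (cf bM (cyc_label y (p := p)) (\sum_(D \in fixed_cosets H (val V) (cycU U p))
        ghost_term (cycU U p) D (n V)))).
  move=> _; rewrite (ghostE _ _ _ (U := cyc_in p) finU) //; last first.
    move=> V [D WD]; exists D; apply: fixed_cosets_sub WD.
    exact: (sub_cyc (trunc_subgroup U) (@trunc_subH U) p).
  rewrite (morphD_fsum (cfD _ (trunc_fin (cyc_in p)) _)) //.
  by rewrite (morphD_fsum (psiD mR _)) // (morphD_fsum (mcoefD mR m)).
under eq_bigr => p py do rewrite ghostW //.
under eq_bigr do rewrite fsbig_finite //.
rewrite exchange_big; apply: rpred_sum => V _.
exact: ghost_term_congruence.
Qed.

End GhostDwork.

Lemma dworkB x x' : dwork x -> dwork x' -> dwork (fun U => x U - x' U).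
Proof.
move=> [fx cx] [fx' cx']; split=> [h Hh U U' e|U y m].
  rewrite (fx _ Hh _ _ e) (fx' _ Hh _ _ e).
  by rewrite /tens_act (morphDB (tens_reindexD (coset_shift_bij e))).
have -> : theta (fun U => x U - x' U) y m = theta x y m - theta x' y m.
  rewrite /theta -sumrB; apply: eq_bigr => p _.
  rewrite (morphDB (cfD _ (trunc_fin (cyc_in p)) _)).
  by rewrite (morphDB (psiD mR _)) (morphDB (mcoefD mR m)).
exact: rpredB.
Qed.

End Dwork.

(** * Sums of translates and the solution of the congruences *)

Section Transfer.
Variables (R : comPzRingType) (M : lmodType R) (Y : choiceType).
Variable bM : module_basis M Y.
Variables (C : choiceType) (one : C) (op : Monoid.com_law one).
Variable mR : monoid_ring R op.

Lemma psi1 r : psi mR 1 r = r.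
Proof.
elim/(monom_ind mR): r => [|r s rE sE|r rE|c].
- exact: morphD0 (psiD mR 1).
- by rewrite psiD rE sE.
- by rewrite (morphDN (psiD mR 1)) rE.
- by rewrite psi_monom /= Monoid.mulm1.
Qed.

Variables (J : choiceType) (finJ : finite_set [set: J]).

Lemma mcoef_inj r s : (forall c, mcoef mR c r = mcoef mR c s) -> r = s.
Proof.
move=> rs; apply/eqP; rewrite -subr_eq0; apply/eqP.
have {rs} : forall c, mcoef mR c (r - s) = 0.
  by move=> c; rewrite (morphDB (mcoefD mR c)) rs subrr.
have /(_ (r - s)) [B] : forall r0 : R, exists B : {fset C},
    forall B' : {fset C}, {subset B <= B'} ->
    r0 = \sum_(c <- B') monom mR c *~ mcoef mR c r0.
  elim/(monom_ind mR) => [|r1 s1 [B rB] [B' sB']|r1 [B rB]|c].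
  - exists fset0 => B' _; rewrite big1 // => c _.
    by rewrite (morphD0 (mcoefD mR c)) mulr0z.
  - exists (B `|` B')%fset => D sD; under eq_bigr do rewrite mcoefD mulrzDr.
    by rewrite big_split /= -rB -?sB' // => c cB; apply: sD; rewrite inE cB ?orbT.
  - exists B => D /rB rD; rewrite {1}rD -sumrN.
    by apply: eq_bigr => c _; rewrite (morphDN (mcoefD mR c)) mulrNz.
  - exists [fset c]%fset => D /(_ c); rewrite inE eqxx => /(_ isT) cD.
    rewrite (big_fsetD1 c) //= mcoef_monom eqxx mulr1z big1_fset ?addr0 // => c'.
    by rewrite !inE => /andP[/negPf cc' _] _; rewrite mcoef_monom cc' mulr0z.
by move=> /(_ B (fun _ => id)) E rs; rewrite E big1 // => c _; rewrite rs mulr0z.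
Qed.

Lemma cf_inj (t u : tens M J) : (forall y, cf bM y t = cf bM y u) -> t = u.
Proof.
by move=> tu; apply: (tcoef_inj finJ (bM := bM) (mR := mR)) => b; rewrite /tcoef tu.
Qed.

(** The support of k lies in the finite support of t, so k is the coefficient function of a finite
    sum. *)
Lemma prescribe_coef (t : tens M J) (k : C * (J -> Y) -> int) :
  (forall b, tcoef bM mR b t = 0 -> k b = 0) ->
  exists d : tens M J, forall b, tcoef bM mR b d = k b.
Proof.
move=> k0; have [B /(_ B (fun _ => id)) tB] := basis_expand bM finJ mR t.
have sumE (f : C * (J -> Y) -> int) b :
    tcoef bM mR b (\sum_(b' <- B) tbasis bM mR b' *~ f b') = if b \in B then f b else 0.
  rewrite (morphD_sum (tcoefD bM finJ mR b)).
  have E b' : tcoef bM mR b (tbasis bM mR b' *~ f b') = (b == b')%:Z * f b'.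
    have MN z n : tcoef bM mR b (z *+ n) = tcoef bM mR b z *+ n.
      exact: morphD_mulrn (tcoefD bM finJ mR b) _ _.
    case: (f b') => i; first by rewrite -pmulrn MN tcoef_basis // -mulr_natr natz.
    rewrite NegzE mulrNz -pmulrn (morphDN (tcoefD bM finJ mR b)) MN tcoef_basis //.
    by rewrite mulrN -mulr_natr natz.
  under eq_bigr do rewrite E.
  case: ifP => [bB|bB].
    rewrite (big_fsetD1 b) //= eqxx mul1r big1_fset ?addr0 // => b'.
    by rewrite !inE eq_sym => /andP[/negPf -> _] _; rewrite mul0r.
  rewrite big1_fset // => b' b'B _; case: eqP => [E'|]; last by rewrite mul0r.
  by move: b'B; rewrite -E' bB.
exists (\sum_(b <- B) tbasis bM mR b *~ k b) => b; rewrite sumE.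
case: ifP => // bB; apply/esym/k0; rewrite tB sumE bB.
by [].
Qed.

End Transfer.

Section TransferGroup.
Variables (R : comPzRingType) (M : lmodType R) (Y : choiceType).
Variable bM : module_basis M Y.
Variables (C : choiceType) (one : C) (op : Monoid.com_law one).
Variable mR : monoid_ring R op.
Variables (J : finType) (K : {group {perm J}}).

Definition fixer (y : J -> Y) : {set {perm J}} :=
  [set p : {perm J} | (p \in K) && `[< forall j, y (p j) = y j >]]%SET.

(* The coefficients of d are those of t, divided by #|fixer y|, on one chosen
   label in every K-orbit of labels. *)
Lemma transfer_surj (t : tens M J) :
  (forall p y, p \in K -> cf bM (y \o p) t = cf bM y t) ->
  (forall y c, (#|fixer y|%:Z %| mcoef mR c (cf bM y t))%Z) ->
  exists d, forall y, \sum_(p in K) cf bM (y \o p) d = cf bM y t.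
Proof.
move=> tK t_div; have finJ : finite_set [set: J] by exact: finite_finset.
(* y0 is only a default for [xget]; without any label there is nothing to verify. *)
have [[y0 _]|noY] := pselect (exists y : J -> Y, True); last first.
  by exists 0 => y; case: noY; exists y.
pose orb (y : J -> Y) : set (J -> Y) := [set z | exists2 p, p \in K & z = y \o p].
(* The label is chosen from the orbit as a set, hence is the same for all members of the orbit. *)
pose r y := xget y0 (orb y).
have rP y : exists2 p, p \in K & r y = y \o p.
  suff : orb y (r y) by [].
  apply: (xgetI _ (x := y)); exists 1%g; first exact: group1.
  by apply/funext => j /=; rewrite perm1.
have rK p y : p \in K -> r (y \o p) = r y.
  move=> pK; congr (xget _ _); apply/seteqP; split=> z [q qK ->].
    exists (q * p)%g; first exact: groupM.
    by apply/funext => j /=; rewrite permM.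
  exists (q * p^-1)%g; first by rewrite groupM ?groupV.
  by apply/funext => j /=; rewrite permM permKV.
pose k (b : C * (J -> Y)) : int :=
  if b.2 == r b.2 then (tcoef bM mR b t %/ #|fixer b.2|%:Z)%Z else 0.
have [b|d dk] := @prescribe_coef _ _ _ bM _ _ _ mR _ finJ t k.
  by move=> b0; rewrite /k b0 div0z; case: ifP.
exists d => y; apply: (mcoef_inj (mR := mR)) => c; rewrite (morphD_sum (mcoefD mR c)).
have [p0 p0K rE] := rP y; pose z := r y.
transitivity (\sum_(p in [set p in K | `[< y \o p = z >]]%SET)
    (mcoef mR c (cf bM z t) %/ #|fixer z|%:Z)%Z).
  rewrite [RHS]big_mkcond [LHS]big_mkcond /=; apply: eq_bigr => p _.
  rewrite inE; case: (boolP (p \in K)) => //= pK.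
  have := dk (c, y \o p); rewrite /tcoef /k /= rK // => ->.
  by case: eqP => [yp|yp]; [rewrite asboolT // yp | rewrite asboolF].
(* The p carrying y to the chosen label z form a coset of the fixer of z, and its size cancels the
   division in k. *)
have -> : [set p in K | `[< y \o p = z >]]%SET = (fixer z :* p0)%g.
  apply/setP => p; rewrite mem_rcoset !inE groupMr ?groupV //.
  case: (boolP (p \in K)) => //= pK; apply/asboolP/asboolP => [yp j|zp].
    by rewrite permM /z rE /= permKV -/(((y \o p) j)) yp /z rE.
  apply/funext => j; rewrite -[RHS]zp permM /z rE /= permKV //.
rewrite sumr_const card_rcoset -mulr_natr natz divzK ?t_div //.
by congr (mcoef mR c _); rewrite /z rE tK.
Qed.

End TransferGroup.

Section Index.
Variable G : groupType.
Implicit Types U W : set G.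

Definition coset_index U (finU : finite_set [set: coset setT U]) : nat := #|fin_of finU|.

Lemma coset_index_le U W (finU : finite_set [set: coset setT U])
    (finW : finite_set [set: coset setT W]) :
  subgroup U -> subgroup W -> U `<=` W -> (coset_index finW <= coset_index finU)%N.
Proof.
move=> U_ W_ UW; pose s (E : fin_of finW) : fin_of finU :=
  lc U (xget 1%g (val (E : coset setT W))).
apply: (@leq_card _ _ s) => E E'.
have xgetW (K : coset setT W) : K = lc W (xget 1%g (val K)).
  have [a ->] := lcW K; apply/lc_eqP => //.
  by apply/lcosetP; exact: xget_lcoset.
move=> /(lc_eqP _ _ U_)/UW EE'; rewrite (xgetW E) (xgetW E').
exact/lc_eqP.
Qed.

(** A section of G/U -> G/W is injective, hence bijective between sets of equal finite size, which
    makes the projection injective. *)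
Lemma coset_index_eq U W (finU : finite_set [set: coset setT U])
    (finW : finite_set [set: coset setT W]) :
  subgroup U -> subgroup W -> U `<=` W -> coset_index finW = coset_index finU -> W = U.
Proof.
move=> U_ W_ UW idx; apply/seteqP; split=> // w Ww.
pose f (E : fin_of finU) : fin_of finW := lc W (xget 1%g (val (E : coset setT U))).
have fE a : f (lc U a) = lc W a.
  apply/lc_eqP => //; have := xget_lcoset U_ a; rewrite lcosetP => /UW Wx.
  by rewrite -subgroupVE // invgM invgK.
pose s (E : fin_of finW) : fin_of finU := lc U (xget 1%g (val (E : coset setT W))).
have fs : cancel s f.
  move=> E; rewrite fE; have [a ->] := lcW (E : coset setT W); apply/lc_eqP => //.
  have := xget_lcoset W_ a; rewrite lcosetP => Wx.
  by rewrite -subgroupVE // invgM invgK.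
have sB : bijective s by apply: inj_card_bij; [exact: can_inj fs | rewrite -/(coset_index finU) -idx].
have [g sg gs] := sB.
have f_inj : injective f by move=> x y; rewrite -(gs x) -(gs y) !fs => ->.
have : f (lc U w) = f (lc U 1) by rewrite !fE; apply/lc_eqP => //; rewrite mulg1; exact: subgroupV.
by move=> /f_inj/(lc_eqP _ _ U_); rewrite mulg1 subgroupVE.
Qed.

Lemma coset_index_conjs g U U' (finU : finite_set [set: coset setT U])
    (finU' : finite_set [set: coset setT U']) :
  U' = conjs g U -> coset_index finU' = coset_index finU.
Proof.
move=> e; have := coset_shift_bij e => shB.
exact: (@bij_eq_card (fin_of finU') (fin_of finU) (coset_shift e) shB).
Qed.

Lemma conjs_sub_eq g U : finite_set [set: coset setT U] ->
  finite_set [set: coset setT (conjs g U)] ->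
  subgroup U -> conjs g U `<=` U -> conjs g U = U.
Proof.
move=> finU finU' U_ gU; apply/esym.
apply: (coset_index_eq (finU := finU') (finW := finU)) => //.
  exact: subgroup_conjs.
by apply/esym; exact: (@coset_index_conjs g).
Qed.

End Index.

Section Solve.
Variables (G : topologicalGroupType) (H : set G) (S : set (set G)).
Hypotheses (G_compact : compact [set: G]) (H_ : open_subgroup H).
Hypothesis (S_ : truncation_set H S).
Variable c : ghost_choice H S.
Variables (A : Mod) (Y : choiceType) (bM : module_basis (module A) Y).
Variables (C : choiceType) (one : C) (op : Monoid.com_law one).
Variable mR : monoid_ring (base_ring A) op.

Let Hg := open_subgroupW H_.

Notation trunc_fin := (trunc_fin G_compact S_).
Notation trunc_subgroup := (trunc_subgroup S_).
Notation Jfin U := (cosets_fin (trunc_fin U)).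
Notation weylU U := (weyl Hg (trunc_subgroup U) (trunc_fin U)).
Notation dwork := (dwork G_compact H_ S_ bM mR).

Definition rep_in_S (V : reps c) : S :=
  exist _ (val V) (mem_set (reps_sub (set_mem (valP V)))).

(** The leading part of ghost coordinate V: what the component at V itself contributes. *)
Definition self_term (V : reps c) (d : tens A (coset setT (val V))) :
    tens A (coset setT (val V)) :=
  \sum_(D \in fixed_cosets H (val V) (val V)) ghost_term (val V) D d.

(** If V fixes hV, then h^-1 V h is contained in V and equals it by finiteness of the index, so
    these cosets correspond to N_H(V)/V. Moreover V h^-1 is then a single left coset of V, so no
    proper power of d occurs and each summand is a translate of d. *)
Lemma cf_self_term (V : reps c) (d : tens A (coset setT (val V)))
    (y : coset setT (val V) -> Y) :
  cf bM y (self_term d) = \sum_(p in weylU (rep_in_S V)) cf bM (y \o p) d.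
Proof.
pose U := rep_in_S V; have U_ := trunc_subgroup U; have finU := trunc_fin U.
rewrite /self_term (morphD_fsum (cfD bM finU y)); last exact: finite_fixed_cosets.
pose f (p : {perm Jfin U}) : set G := val (p^-1%g (lc (val U) 1) : coset setT (val U)).
have fE p h : rtrans p h -> f p = lcoset h^-1%g (val U).
  by move=> ph; rewrite /f (rtransV ph) mul1g.
have fB : set_bij [set p : {perm Jfin U} | p \in weylU U]
    (fixed_cosets H (val V) (val V)) f.
  split=> [p /= /weylP[h Hh ph]|p q /set_mem /= pN /set_mem /= qN|D DV].
  - rewrite (fE p h) //; exists h^-1%g; split=> //; first exact: subgroupV.
    by rewrite invgK (rtrans_conjs U_ ph).
  - have /weylP[h Hh ph] := pN; have /weylP[k Hk qk] := qN.
    rewrite (fE _ _ ph) (fE _ _ qk) => /(lcoset_eqP U_); rewrite invgK => Uhk.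
    apply/eqP; rewrite eq_mulgV1; apply/eqP.
    exact: rtrans_inj (rtransM ph (rtransV qk)) (rtrans1 U_ (trunc_fin U) Uhk).
  have [h [Hh -> UV]] := DV.
  have hU : conjs h^-1%g (val U) = val U.
    apply: conjs_sub_eq => //; apply: finite_coset => //;
      apply: open_subgroup_conjs; exact: (trunc_open S_ U).
  have [p ph] := rtrans_exists (trunc_fin U) hU.
  exists p; last by rewrite (fE _ _ ph) invgK.
  by apply/weylP; exists h^-1%g => //; exact: subgroupV.
rewrite big_fsbig (reindex_fsbig _ _ _ _ fB); apply: eq_fsbigr => p /set_mem pN.
have /weylP[h Hh ph] := pN; have [fp _ _] := fB; have {}fp := fp p pN.
rewrite (@cf_ghost_term _ _ _ _ _ _ _ _ _ V U) //.
have -> : [set E : coset setT (val U) | val E `<=` invs (f p)] = [set lc (val U) h].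
  apply/seteqP; split=> [E|E -> /=].
    have [a ->] := lcW E; move=> /(fixed_invs_lc S_ a U_ fp).
    rewrite (fE _ _ ph) invs_lcoset // invgK rcosetP => Uah.
    have : conjs h (val U) (a / h)%g by rewrite (rtrans_conjs U_ ph).
    rewrite conjsP !mulgA mulgVK => Uha.
    by apply/lc_eqP => //; rewrite -subgroupVE // invgM invgK.
  apply/(fixed_invs_lc S_ h U_ fp).
  by rewrite (fE _ _ ph) invs_lcoset // invgK rcosetP mulgV; exact: subgroup1.
rewrite fsbig_set1; congr cf; apply/funext => K /=; congr y.
have repK : K = lc (val V) (rep c (val V) (val K)).
  have [a ->] := lcW K; apply/lc_eqP => //.
  have /= := @rep_in _ _ _ c V (lcoset a (val V)).
  by move=> /(_ (ex_intro2 _ _ a I erefl)); rewrite lcosetP.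
rewrite {2}repK ph; apply: val_inj => /=.
by rewrite -lcosetM.
Qed.

(** All exponents are one by [cf_self_term]; this linearity of the leading part lets an error be
    corrected by adding to n V. *)
Lemma self_termD (V : reps c) : {morph @self_term V : d d' / d + d'}.
Proof.
move=> d d'; apply: (cf_inj (bM := bM) mR (trunc_fin (rep_in_S V))) => y.
have finU := trunc_fin (rep_in_S V).
rewrite (cfD bM finU) !cf_self_term -big_split; apply: eq_bigr => p _.
by rewrite (cfD bM finU).
Qed.

(** Both hypotheses of [transfer_surj] are verified: invariance under N_H(V)/V comes from [H_fixed],
    and divisibility from [theta], whose other terms vanish. *)
Lemma self_term_surj (V : reps c) (x : tens_prod S A) :
  dwork x ->
  (forall W : S, val V `<=` val W -> val W <> val V -> x W = 0) ->
  exists d, self_term d = x (rep_in_S V).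
Proof.
move=> [x_fix x_div] x0; pose U := rep_in_S V; have U_ := trunc_subgroup U.
have [p y|y m|d dE] := @transfer_surj _ _ _ bM _ _ _ mR (Jfin U) (weylU U) (x U).
- move=> /weylP[h Hh ph]; have hU := rtrans_conjs U_ ph.
  rewrite {1}(x_fix h Hh U U (esym hU)) /tens_act.
  have shE (E : Jfin U) : coset_shift (esym hU) E = p E.
    have [a ->] := lcW (E : coset setT (val U)); rewrite ph; apply: val_inj => /=.
    rewrite rcoset_lcoset; congr lcoset.
    exact: esym ((conjs_eq _ _ _).1 (esym hU)).
  pose q : coset setT (val U) -> coset setT (val U) := p^-1%g : {perm Jfin U}.
  have qK : cancel q (coset_shift (esym hU)) by move=> E; rewrite shE /q permKV.
  have Kq : cancel (coset_shift (esym hU)) q by move=> E; rewrite shE /q permK.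
  have finU := trunc_fin U.
  rewrite -(tens_bijE _ qK Kq) (cf_bij bM) //; last by exists (coset_shift (esym hU)).
  by congr cf; apply/funext => E /=; rewrite /q permKV.
- have := x_div U y m; rewrite /theta.
  (* For p other than 1 the group [cyc_in p] strictly contains V, and x vanishes there. *)
  rewrite (bigD1 1%g) ?group1 //= big1 ?addr0; last first.
    move=> p /andP[pK p1].
    have [h ch Uh] := cyc_proper (stab_weyl pK) p1.
    rewrite x0.
    + have finW := trunc_fin (@cyc_in G H S G_compact H_ S_ U p).
      by rewrite (morphD0 (cfD bM finW _)) (morphD0 (psiD mR _)) (morphD0 (mcoefD mR _)).
    + exact: (sub_cyc U_ (@trunc_subH _ _ _ S_ U)).
    + by move=> E; apply: Uh; exact: (eq_ind _ (fun Z : set G => Z h) ch _ E).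
  have e1 : @cyc_in G H S G_compact H_ S_ U 1%g = U.
    by apply: val_inj; exact: (cyc1 U_ (@trunc_subH _ _ _ S_ U)).
  rewrite order1 psi1; congr (_ %| mcoef mR m _)%Z.
  (* The type of x W depends on W, so the equality of [cyc_in 1] with U is substituted through a
     variable. *)
  have lE (W : S) : W = U -> cf bM
      (fun E : coset setT (val W) => y (lc (val U) (xget 1%g (val E)))) (x W) = cf bM y (x U).
    move=> ->; congr cf; apply/funext => E; congr y; have [a ->] := lcW E.
    apply/lc_eqP => //; have := xget_lcoset U_ a; rewrite lcosetP => Ux.
    by rewrite -subgroupVE // invgM invgK.
  exact: lE e1.
exists d; apply: (cf_inj (bM := bM) mR (trunc_fin U)) => y.
by rewrite cf_self_term dE.
Qed.

End Solve.

Section DworkSolve.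
Variables (G : topologicalGroupType) (H : set G) (S : set (set G)).
Hypotheses (G_compact : compact [set: G]) (H_ : open_subgroup H).
Hypothesis (S_ : truncation_set H S).
Variable c : ghost_choice H S.

Let Hg := open_subgroupW H_.

Notation trunc_fin := (trunc_fin G_compact S_).
Notation trunc_subgroup := (trunc_subgroup S_).

Definition rep_index (V : reps c) : nat := coset_index (trunc_fin (rep_in_S V)).

Lemma supp_refl (V : reps c) : ghost_supp c (val V) V.
Proof.
exists (lcoset 1%g (val V)); exists 1%g; split=> //; first exact: subgroup1.
by rewrite invg1 conjs1.
Qed.

Lemma supp_trans (U : set G) (V V' : reps c) :
  ghost_supp c U V -> ghost_supp c (val V) V' -> ghost_supp c U V'.
Proof.
move=> [_ [h [Hh _ UV]]] [_ [k [Hk _ VV']]].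
exists (lcoset (h * k)%g (val V')); exists (h * k)%g; split=> //.
  exact: subgroupM.
rewrite invgM conjsM => x [u Uu <-]; apply: VV'; exists u => //.
exact: UV.
Qed.

(** Makes the index a rank for induction: V' contains a conjugate of V, so its index is at most that
    of V, and equality makes them conjugate representatives. *)
Lemma supp_rank (V V' : reps c) : ghost_supp c (val V) V' ->
  (rep_index V' <= rep_index V)%N /\ (rep_index V' = rep_index V -> V' = V).
Proof.
move=> [_ [h [Hh _ VV']]].
have oV' : open_subgroup (conjs h^-1%g (val V)).
  by apply: open_subgroup_conjs; exact: (reps_open S_ V).
have fin' : finite_set [set: coset setT (conjs h^-1%g (val V))].
  exact: finite_coset oV'.
have idx : coset_index fin' = rep_index V by exact: (@coset_index_conjs _ h^-1%g).
have V'_ : subgroup (val V') by exact: (trunc_subgroup (rep_in_S V')).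
rewrite -idx; split; first exact: coset_index_le (open_subgroupW oV') V'_ VV'.
move=> /(coset_index_eq (open_subgroupW oV') V'_ VV') E.
apply: (reps_eq H_ S_ (h := 1%g) (h' := h^-1%g)).
- exact: subgroup1.
- exact: subgroupV.
- by rewrite conjs1.
Qed.

Lemma trunc_repr (W : S) : exists (V : reps c) h, H h /\ val W = conjs h (val V).
Proof.
have [V [[cV [h Hh VW]] _]] := reps_uniq c (set_mem (valP W)).
exists (exist _ V (mem_set cV)), h^-1%g; split; first exact: subgroupV.
exact: (conjs_eq _ _ _).1 VW.
Qed.

Variables (A : Mod).

Lemma ghost_change (n n' : tens_prod (reps c) A) (V : reps c) :
  (forall V', ghost_supp c (val V) V' -> V' <> V -> n' V' = n V') ->
  ghost n' (rep_in_S V) =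
  ghost n (rep_in_S V) + (self_term (n' V) - self_term (n V)).
Proof.
move=> nn'; have finV := finite_ghost_supp G_compact H_ S_ c (reps_open S_ V).
rewrite !(ghost_suppE G_compact H_ S_) /=.
rewrite !(@fsbigD1 _ _ _ _ V (ghost_supp c (val V))) //; try exact: supp_refl.
rewrite -!/(self_term _) [in RHS]addrC addrA subrK; congr (_ + _).
apply: eq_fsbigr => V' /set_mem [VV' /= V'V]; apply: eq_fsbigr => D _.
by rewrite nn'.
Qed.

Variables (Y : choiceType) (bM : module_basis (module A) Y).
Variables (C : choiceType) (one : C) (op : Monoid.com_law one).
Variable mR : monoid_ring (base_ring A) op.

Notation dwork := (dwork G_compact H_ S_ bM mR).

Section Iterate.
Variables (x : tens_prod S A) (x_dwork : dwork x).
Implicit Type n : tens_prod (reps c) A.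

Definition correct n (V : reps c) := ghost n (rep_in_S V) = x (rep_in_S V).

(* If n is correct at all V' < V, then by the divisibility of theta the error at V is
   the value of the self_term of some d, which transfer_surj provides. *)
Definition improve n : tens_prod (reps c) A := fun V =>
  if pselect (correct n V) then n V else
  n V + xget 0 [set d | self_term d = x (rep_in_S V) - ghost n (rep_in_S V)].

Lemma improve_correct n V : correct n V -> improve n V = n V.
Proof. by rewrite /improve; case: pselect. Qed.

(** Each W is conjugate to a representative of the same index, and z W is a translate of the value
    there. *)
Lemma fixed_zero (z : tens_prod S A) (k : nat) : H_fixed H z ->
  (forall V : reps c, (rep_index V < k)%N -> z (rep_in_S V) = 0) ->
  forall W : S, (coset_index (trunc_fin W) < k)%N -> z W = 0.
Proof.
move=> z_fix z0 W Wk; have [V [h [Hh e]]] := trunc_repr W.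
rewrite (z_fix h Hh (rep_in_S V) W e) z0; last first.
  by rewrite /rep_index -(coset_index_conjs (trunc_fin (rep_in_S V)) (trunc_fin W) e).
exact: morphD0 (tens_reindexD (coset_shift_bij e)).
Qed.

(** [improve] changes all wrong entries simultaneously, but for V of index at most k every other
    member of its support has smaller rank and is already correct, so only the entry at V itself can
    move. *)
Lemma improve_rank n k : (forall V, (rep_index V < k)%N -> correct n V) ->
  forall V, (rep_index V < k.+1)%N -> correct (improve n) V.
Proof.
move=> nk V; rewrite ltnS => Vk.
have same V' : ghost_supp c (val V) V' -> V' <> V -> improve n V' = n V'.
  move=> /supp_rank [le eq] V'V; apply: improve_correct; apply: nk.
  apply: leq_trans Vk; rewrite ltn_neqAle le andbT.
  by apply/eqP => /eq.
rewrite /correct (ghost_change same) /improve; case: pselect => [nV|nV].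
  by rewrite subrr addr0.
rewrite (self_termD G_compact H_ S_ bM mR) // addrAC subrr add0r.
case: xgetP => [d _ ->|/(_ _) no]; first by rewrite addrC subrK.
have rV : rep_index V = k.
  apply/eqP; rewrite eqn_leq Vk leqNgt; apply/negP => /nk; exact: nV.
(* The error satisfies the congruences and vanishes at all W of index below k, in particular
   strictly above V, as [self_term_surj] requires. *)
have z_dwork := dworkB x_dwork (dwork_ghost G_compact H_ S_ bM mR n).
have [W VW WV|d dE] := self_term_surj (V := V) z_dwork; last first.
  by case: (no d).
have [z_fix _] := z_dwork; apply: (fixed_zero z_fix (k := k)).
  by move=> V' /nk; rewrite /correct => ->; rewrite subrr.
rewrite -rV ltn_neqAle; apply/andP; split; last first.
  exact: (coset_index_le _ _ (trunc_subgroup (rep_in_S V)) (trunc_subgroup W) VW).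
apply/eqP => E; apply: WV.
exact: (coset_index_eq (trunc_subgroup (rep_in_S V)) (trunc_subgroup W) VW E).
Qed.

Lemma iter_correct n k V : (rep_index V < k)%N -> correct (iter k improve n) V.
Proof.
elim: k V => [|k IHk] V; first by rewrite ltn0.
by rewrite iterS; exact: improve_rank.
Qed.

Lemma iter_stable n k V : (rep_index V < k)%N ->
  iter k improve n V = iter (rep_index V).+1 improve n V.
Proof.
elim: k => [//|k IHk]; rewrite ltnS leq_eqVlt => /orP[/eqP -> //|Vk].
by rewrite iterS improve_correct ?IHk //; exact: iter_correct.
Qed.

(** Correct entries are never altered, so values of n0 whose whole support is correct survive. With
    F empty this gives existence; with F finite it gives openness of the ghost map. *)
Lemma dwork_solve (n0 : tens_prod (reps c) A) (F : set (reps c)) :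
  (forall V V', F V -> ghost_supp c (val V) V' -> correct n0 V') ->
  exists n, ghost n = x /\ forall V, F V -> n V = n0 V.
Proof.
(* The entry at V is final after [(rep_index V).+1] rounds by [iter_stable], so no bound on the
   index is needed across S. *)
move=> n0F; pose n : tens_prod (reps c) A := fun V => iter (rep_index V).+1 improve n0 V.
have keep k V V' : F V -> ghost_supp c (val V) V' -> iter k improve n0 V' = n0 V'.
  elim: k V' => [//|k IHk] V' FV VV'; rewrite iterS improve_correct ?IHk //.
  rewrite /correct -(n0F V V') //; apply: ghost_local => // V'' V'V''.
  by apply: IHk => //; exact: supp_trans V'V''.
exists n; split; last by move=> V FV; rewrite /n (keep _ V) //; exact: supp_refl.
have nV (V : reps c) : ghost n (rep_in_S V) = x (rep_in_S V).
  rewrite -(iter_correct n0 (ltnSn (rep_index V))).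
  apply: ghost_local => // V' /supp_rank [le _].
  by rewrite /n (iter_stable n0 (k := (rep_index V).+1)).
apply: functional_extensionality_dep => W; have [V [h [Hh e]]] := trunc_repr W.
have [x_fix _] := x_dwork; rewrite (x_fix h Hh (rep_in_S V) W e).
by rewrite (ghost_fixed G_compact H_ S_ n Hh (U := rep_in_S V) (U' := W) e) nV.
Qed.

End Iterate.

End DworkSolve.

(** * Polynomial rings and free modules as instances of the interface *)

Section PolynomialRing.
Variable X : choiceType.

Notation K := (cmonom X).
Notation T := (malg (cmonom X) int).

Definition cmonom_op : Monoid.com_law (@mone K) := @mmul K.

(** The Adams operation of Z[X]: each variable goes to its k-th power, and integer coefficients are
    kept. *)
Definition adams (k : nat) (r : T) : T :=
  mmap (@mkmalgU K int mone) (fun m => mkmalgU (iter k (mmul m) mone) 1 : T) r.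

Lemma malgU_nat (c : K) n : mkmalgU c n%:Z = mkmalgU c 1 *+ n :> T.
Proof. by rewrite -monalgUMn -mulr_natr mul1r natz. Qed.

Lemma polyZ_ind (P : T -> Prop) :
  P 0 -> (forall r s, P r -> P s -> P (r + s)) -> (forall r, P r -> P (- r)) ->
  (forall c, P (mkmalgU c 1)) -> forall r, P r.
Proof.
move=> P0 PD PN Pc r; rewrite [r]monalgE; elim/big_ind: _ => // m _.
have PU n : P (mkmalgU m n%:Z).
  rewrite malgU_nat; elim: n => [|n IHn]; first by rewrite mulr0n.
  by rewrite mulrS; exact: PD.
case: (mcoeff m r) => n; first exact: PU.
by rewrite NegzE monalgUN; exact: PN.
Qed.

Lemma malgU_mul (c c' : K) : mkmalgU (mmul c c') 1 = mkmalgU c 1 * mkmalgU c' 1 :> T.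
Proof. by rewrite malgM_def fgmulUU mulr1. Qed.

Lemma mcoeffU_int (c c' : K) : mcoeff c (mkmalgU c' 1 : T) = (c == c')%:Z.
Proof. by rewrite mcoeffU eq_sym natz. Qed.

Lemma adams_monom k (c : K) :
  adams k (mkmalgU c 1) = mkmalgU (iter k (mmul c) mone) 1.
Proof. by rewrite /adams mmapU mul1r. Qed.

Lemma adamsD k : {morph adams k : r s / r + s}.
Proof. by move=> r s; rewrite /adams raddfD. Qed.

Definition poly_monoid_ring : monoid_ring (polyZ X) cmonom_op :=
  @MonoidRing (polyZ X) K mone cmonom_op (fun c => mkmalgU c 1 : T) (@mcoeff K int)
    (@mcoeffD K int) mcoeffU_int (erefl _) malgU_mul polyZ_ind adams adamsD adams_monom.

Variable Y : choiceType.
Notation Q := (malg Y T).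

Lemma mcoeff_lin y (r : T) (a b : Q) :
  mcoeff y (r *: a + b) = r * mcoeff y a + mcoeff y b.
Proof. by rewrite mcoeffD mcoeffZ. Qed.

Lemma free_ind (P : Q -> Prop) : P 0 -> (forall a b, P a -> P b -> P (a + b)) ->
  (forall (r : T) y, P (r *: mkmalgU y 1)) -> forall a, P a.
Proof.
move=> P0 PD Pr a; rewrite [a]monalgE; elim/big_ind: _ => // y _.
have -> : mkmalgU y (mcoeff y a) = mcoeff y a *: mkmalgU y 1 by
  apply/malgP => z; rewrite mcoeffZ !mcoeffU mulrnAr mulr1.
exact: Pr.
Qed.

Lemma mcoeffU_ring (y y' : Y) : mcoeff y (mkmalgU y' 1 : Q) = (y == y')%:R.
Proof. by rewrite mcoeffU eq_sym. Qed.

Definition free_module_basis : module_basis (free_mod X Y) Y :=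
  @ModuleBasis (polyZ X) (free_mod X Y) Y (fun y => mkmalgU y 1 : Q) (@mcoeff Y T)
    mcoeff_lin mcoeffU_ring free_ind.

End PolynomialRing.

(** * Topological groups *)

Section DiscreteTensors.
Variables (R : comPzRingType) (M : lmodType R) (X : choiceType).

Lemma tens_sub_continuous :
  continuous (fun x : tens M X * tens M X => x.1 - x.2).
Proof.
move=> [t u] O /nbhs_singleton /= Otu.
exists ([set t], [set u]); first by split.
by move=> -[t' u'] /= [-> ->].
Qed.

HB.instance Definition _ :=
  PreTopologicalNmodule_isTopologicalZmodule.Build (tens M X) tens_sub_continuous.

End DiscreteTensors.

Section ProductGroup.
Variables (I : choiceType) (K : I -> topologicalZmodType).
Implicit Types x y z : prod_topology K.

Definition prod_add x y : prod_topology K := fun i => x i + y i.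
Definition prod_opp x : prod_topology K := fun i => - x i.
Definition prod_zero : prod_topology K := fun i => 0.

Fact prod_addA : associative prod_add.
Proof. by move=> x y z; apply: functional_extensionality_dep => i; rewrite /prod_add addrA. Qed.
Fact prod_addC : commutative prod_add.
Proof. by move=> x y; apply: functional_extensionality_dep => i; rewrite /prod_add addrC. Qed.
Fact prod_add0 : left_id prod_zero prod_add.
Proof. by move=> x; apply: functional_extensionality_dep => i; rewrite /prod_add add0r. Qed.
Fact prod_addN : left_inverse prod_zero prod_opp prod_add.
Proof. by move=> x; apply: functional_extensionality_dep => i; rewrite /prod_add addNr. Qed.

HB.instance Definition _ := GRing.isZmodule.Build (prod_topology K)
  prod_addA prod_addC prod_add0 prod_addN.

Fact prod_sub_continuous :
  continuous (fun x : prod_topology K * prod_topology K => x.1 - x.2).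
Proof.
move=> x0; apply/supremum_topology.cvg_sup => i.
pose f (x : prod_topology K * prod_topology K) :
  initial_topology.initial_topology (fun g : forall i, K i => g i) := x.1 - x.2.
suff : continuous f by exact.
apply: initial_topology.continuous_comp_initial => x.
have ci (w : prod_topology K) : (fun y : prod_topology K => y i) @ w --> w i.
  exact: (@proj_continuous I K i w).
have sc : (fun y : prod_topology K * prod_topology K => y.1 i - y.2 i) @ x --> x.1 i - x.2 i.
  apply: (@continuous_comp _ _ _ (fun y : prod_topology K * prod_topology K => (y.1 i, y.2 i))
    (fun z : K i * K i => z.1 - z.2)); last exact: sub_continuous.
  apply: cvg_pair.
    by apply: (@continuous_comp _ _ _ fst (fun y : prod_topology K => y i)); [exact: cvg_fst | exact: ci].
  by apply: (@continuous_comp _ _ _ snd (fun y : prod_topology K => y i)); [exact: cvg_snd | exact: ci].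
exact: sc.
Qed.

HB.instance Definition _ :=
  PreTopologicalNmodule_isTopologicalZmodule.Build (prod_topology K) prod_sub_continuous.

End ProductGroup.

(* The image of g modulo the closed subgroup N, with the quotient topology of P.
   Openness of g onto its image makes the subtraction continuous. *)
Section ImageQuotient.
Variables (P : topologicalType) (Z : topologicalZmodType) (g : P -> Z) (N : set Z).
Variable p0 : P.
Hypothesis g_cont : continuous g.
Hypothesis g_sub : forall x y, exists z, g z = g x - g y.
Hypothesis g_open : forall x (O : set P), nbhs x O ->
  exists2 O' : set Z, nbhs (g x) O' & forall z, O' (g z) -> exists2 y, O y & g y = g z.
Hypothesis N0 : N 0.
Hypothesis NB : forall z z', N z -> N z' -> N (z - z').
Hypothesis N_closed : closed N.

Let NN z : N z -> N (- z). Proof. by move=> Nz; rewrite -sub0r; exact: NB. Qed.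
Let ND z z' : N z -> N z' -> N (z + z').
Proof. by move=> Nz /NN Nz'; rewrite -[z']opprK; exact: NB. Qed.

Let g_zero : exists z, g z = 0.
Proof. by have [z zE] := g_sub p0 p0; exists z; rewrite zE subrr. Qed.

Let g_opp x : exists z, g z = - g x.
Proof. by have [z zE] := g_zero; have [y yE] := g_sub z x; exists y; rewrite yE zE sub0r. Qed.

Let g_add x y : exists z, g z = g x + g y.
Proof.
by have [z zE] := g_opp y; have [w wE] := g_sub x z; exists w; rewrite wE zE opprK.
Qed.

Definition iq_rel (x y : P) : bool := `[< N (g x - g y) >].

Fact iq_refl : reflexive iq_rel.
Proof. by move=> x; apply/asboolP; rewrite subrr. Qed.
Fact iq_sym : symmetric iq_rel.
Proof.
by move=> x y; apply/asboolP/asboolP => /NN; rewrite opprB.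
Qed.
Fact iq_trans : transitive iq_rel.
Proof.
move=> y x z /asboolP xy /asboolP yz; apply/asboolP.
by have := ND xy yz; rewrite addrA subrK.
Qed.

Canonical iq_equiv := EquivRel iq_rel iq_refl iq_sym iq_trans.

Definition iq : Type := quotient_topology {eq_quot iq_equiv}.

HB.instance Definition _ := Topological.on iq.
HB.instance Definition _ := Quotient.on iq.

Definition iq_pi (x : P) : iq := \pi_({eq_quot iq_equiv}) x.

Lemma iq_piP x y : iq_pi x = iq_pi y <-> N (g x - g y).
Proof. by split=> [/eqmodP/asboolP|Nxy] //; apply/eqmodP/asboolP. Qed.

Lemma iq_surj (a : iq) : exists x, iq_pi x = a.
Proof. by exists (repr (a : {eq_quot iq_equiv})); rewrite /iq_pi reprK. Qed.

Definition iq_repr (a : iq) : P := xget p0 [set x | iq_pi x = a].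

Lemma iq_reprK a : iq_pi (iq_repr a) = a.
Proof.
have [x xa] := iq_surj a.
suff : [set x | iq_pi x = a] (iq_repr a) by [].
exact: (xgetI p0 (x := x)).
Qed.

Definition iq_zero : iq := iq_pi (xget p0 [set z | g z = 0]).
Definition iq_opp (a : iq) : iq := iq_pi (xget p0 [set z | g z = - g (iq_repr a)]).
Definition iq_add (a b : iq) : iq :=
  iq_pi (xget p0 [set z | g z = g (iq_repr a) + g (iq_repr b)]).

Let g_repr x : N (g (iq_repr (iq_pi x)) - g x).
Proof. by apply/iq_piP; rewrite iq_reprK. Qed.

Lemma iq_zeroE z : g z = 0 -> iq_zero = iq_pi z.
Proof.
move=> z0; apply/iq_piP; case: xgetP => [w _ /= ->|/(_ z) //].
by rewrite z0 subrr.
Qed.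

Lemma iq_oppE x z : g z = - g x -> iq_opp (iq_pi x) = iq_pi z.
Proof.
move=> zE; apply/iq_piP; case: xgetP => [w _ /= ->|no].
  by rewrite zE -opprD; apply: NN; rewrite -[X in N X]opprK opprD opprK addrC;
     apply: NN; rewrite -[X in N X]opprB; apply: NN; exact: g_repr.
by have [w wE] := g_opp (iq_repr (iq_pi x)); case: (no w).
Qed.

Lemma iq_addE x y z : g z = g x + g y -> iq_add (iq_pi x) (iq_pi y) = iq_pi z.
Proof.
move=> zE; apply/iq_piP; case: xgetP => [w _ /= ->|no].
  by rewrite zE opprD addrACA; apply: ND; exact: g_repr.
by have [w wE] := g_add (iq_repr (iq_pi x)) (iq_repr (iq_pi y)); case: (no w).
Qed.

Fact iq_addA : associative iq_add.
Proof.
move=> a b c; have [x <-] := iq_surj a; have [y <-] := iq_surj b.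
have [z <-] := iq_surj c; have [u uE] := g_add y z; have [v vE] := g_add x y.
have [w wE] := g_add v z.
rewrite (iq_addE uE) (iq_addE vE) (iq_addE wE); apply: iq_addE.
by rewrite wE vE uE addrA.
Qed.

Fact iq_addC : commutative iq_add.
Proof.
move=> a b; have [x <-] := iq_surj a; have [y <-] := iq_surj b.
by have [z zE] := g_add x y; rewrite (iq_addE zE); apply/esym/iq_addE; rewrite addrC.
Qed.

Fact iq_add0 : left_id iq_zero iq_add.
Proof.
move=> a; have [x <-] := iq_surj a; have [z zE] := g_zero.
by rewrite (iq_zeroE zE); apply: iq_addE; rewrite zE add0r.
Qed.

Fact iq_addN : left_inverse iq_zero iq_opp iq_add.
Proof.
move=> a; have [x <-] := iq_surj a; have [z zE] := g_opp x.
have [w wE] := g_zero; rewrite (iq_oppE zE) (iq_zeroE wE); apply: iq_addE.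
by rewrite wE zE addNr.
Qed.

HB.instance Definition _ := GRing.isZmodule.Build iq iq_addA iq_addC iq_add0 iq_addN.

Lemma iq_piD x y z : g z = g x + g y -> iq_pi x + iq_pi y = iq_pi z.
Proof. exact: iq_addE. Qed.

Lemma iq_piB x y z : g z = g x - g y -> iq_pi x - iq_pi y = iq_pi z.
Proof.
move=> zE; apply/eqP; rewrite subr_eq; apply/eqP/esym/iq_piD.
by rewrite zE subrK.
Qed.

Lemma iq_openE (O : set iq) : open O <-> open (iq_pi @^-1` O).
Proof. by []. Qed.

(** Shifting by an element of N does not change classes: if g y - g x0 = n lies in N, points whose
    value minus n is in A' have the same classes as points with value in A'. *)
Lemma iq_nbhs x (A : set Z) : nbhs (g x) A ->
  nbhs (iq_pi x) (iq_pi @` (g @^-1` A)).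
Proof.
rewrite nbhsE => -[A' [oA' A'x] A'A].
rewrite nbhsE; exists (iq_pi @` (g @^-1` A')); last first.
  by move=> _ [y A'y <-]; exists y => //; exact: A'A.
split; last by exists x.
apply/iq_openE; rewrite openE => y [x0 A'x0 /iq_piP Nxy].
pose n := g y - g x0.
have gcn : continuous (fun y' => g y' - n).
  move=> y'; apply: (@continuous_comp _ _ _ (fun y' => (g y', n)) (fun z : Z * Z => z.1 - z.2)).
    by apply: cvg_pair; [exact: g_cont | exact: cvg_cst].
  exact: sub_continuous.
have : nbhs y ((fun y' => g y' - n) @^-1` A').
  apply: gcn; apply: open_nbhs_nbhs; split=> //=.
  by rewrite /n opprB addrC subrK.
apply: filterS => y' /= A'y'.
have [w wE] := g_sub y y; have [x1 x1E] := g_sub y x0.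
have [x2 x2E] := g_sub y' x1.
exists x2; first by rewrite /= x2E x1E.
by apply/iq_piP; rewrite x2E x1E addrAC subrr add0r opprB.
Qed.

Fact iq_sub_continuous : continuous (fun x : iq * iq => x.1 - x.2).
Proof.
move=> [a b] O /=; have [x <-] := iq_surj a; have [y <-] := iq_surj b => O_ab.
have [z zE] := g_sub x y; move: O_ab; rewrite (iq_piB zE) => /(pi_continuous (T := P)).
(* Openness of g moves the problem from P to Z, where subtraction is continuous. *)
rewrite /= => nbO; have [O' O'z O'P] := g_open (nbO : nbhs z (iq_pi @^-1` O)).
move: O'z; rewrite zE => O'xy.
have [[A B] /= [Ax By] ABO] : nbhs (g x, g y) ((fun w : Z * Z => w.1 - w.2) @^-1` O').
  exact: (@sub_continuous Z (g x, g y)).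
exists (iq_pi @` (g @^-1` A), iq_pi @` (g @^-1` B)).
  by split; exact: iq_nbhs.
move=> [_ _] /= [[x' Ax' <-] [y' By' <-]].
have [z' z'E] := g_sub x' y'; rewrite (iq_piB z'E).
have [|z2 Oz2 z2E] := O'P z'; first by rewrite z'E; exact: (ABO (g x', g y')).
suff <- : iq_pi z2 = iq_pi z' by [].
by apply/iq_piP; rewrite z2E subrr.
Qed.

HB.instance Definition _ :=
  PreTopologicalNmodule_isTopologicalZmodule.Build iq iq_sub_continuous.

Lemma iq_hausdorff : hausdorff_space iq.
Proof.
move=> a b; have [x <-] := iq_surj a; have [y <-] := iq_surj b => xy.
apply: contrapT => nxy; have nNxy : ~ N (g x - g y) by move=> /iq_piP.
have : nbhs (g x - g y) (~` N).
  by apply: open_nbhs_nbhs; split=> //; exact: closed_openC.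
move=> /(@sub_continuous Z (g x, g y)) [[A B] /= [Ax By] ABN].
have [_ [[x' Ax' <-] [y' By' /esym/iq_piP]]] := xy _ _ (iq_nbhs Ax) (iq_nbhs By).
exact: (ABN (g x', g y')).
Qed.

Definition iq_obj : ab_haus_obj := AbHausObj iq_hausdorff.

End ImageQuotient.

(** * Free objects and reflexive coequalisers of modules *)

Definition mk_rmorphism (R S : pzRingType) (f : R -> S)
    (fD : {morph f : x y / x + y}) (f1 : f 1 = 1) (fM : {morph f : x y / x * y}) :
    {rmorphism R -> S} :=
  HB.pack f (GRing.isZmodMorphism.Build R S f (morphDB fD))
            (GRing.isMonoidMorphism.Build R S f (conj f1 fM)).

Definition mk_additive (U V : zmodType) (f : U -> V)
    (fD : {morph f : x y / x + y}) : {additive U -> V} :=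
  HB.pack f (GRing.isZmodMorphism.Build U V f (morphDB fD)).

(** Both sides are biadditive in r and s, so additive generators suffice. *)
Lemma morphM_gen (R S : pzRingType) (K : Type) (u : K -> R) (f : R -> S) :
  (forall P : R -> Prop, P 0 -> (forall r s, P r -> P s -> P (r + s)) ->
    (forall r, P r -> P (- r)) -> (forall k, P (u k)) -> forall r, P r) ->
  {morph f : r s / r + s} -> (forall k l, f (u k * u l) = f (u k) * f (u l)) ->
  {morph f : r s / r * s}.
Proof.
move=> ind fD fM r s; have f0 := morphD0 fD; have fN := morphDN fD.
elim/ind: r => [|r r' rE r'E|r rE|k].
- by rewrite mul0r f0 mul0r.
- by rewrite mulrDl !fD rE r'E mulrDl.
- by rewrite mulNr !fN rE mulNr.
elim/ind: s => [|s s' sE s'E|s sE|l] //.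
- by rewrite mulr0 f0 mulr0.
- by rewrite mulrDr !fD sE s'E mulrDr.
- by rewrite mulrN !fN sE mulrN.
Qed.

Lemma morphZ_gen (R S : pzRingType) (M : lmodType R) (N : lmodType S)
    (Y : Type) (u : Y -> M) (alpha : R -> S) (f : M -> N) :
  (forall P : M -> Prop, P 0 -> (forall m n, P m -> P n -> P (m + n)) ->
    (forall r y, P (r *: u y)) -> forall m, P m) ->
  {morph alpha : r s / r * s} -> {morph f : m n / m + n} ->
  (forall r y, f (r *: u y) = alpha r *: f (u y)) ->
  forall r m, f (r *: m) = alpha r *: f m.
Proof.
move=> ind aM fD fZ r m; have f0 := morphD0 fD.
elim/ind: m => [|m n mE nE|s y]; first by rewrite scaler0 f0 scaler0.
- by rewrite scalerDr !fD mE nE scalerDr.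
by rewrite scalerA !fZ aM scalerA.
Qed.

Lemma eq_morphD_gen (U V : zmodType) (K : Type) (u : K -> U) (f g : U -> V) :
  (forall P : U -> Prop, P 0 -> (forall r s, P r -> P s -> P (r + s)) ->
    (forall r, P r -> P (- r)) -> (forall k, P (u k)) -> forall r, P r) ->
  {morph f : r s / r + s} -> {morph g : r s / r + s} ->
  (forall k, f (u k) = g (u k)) -> f =1 g.
Proof.
move=> ind fD gD fg r; have f0 := morphD0 fD; have g0 := morphD0 gD.
have fN := morphDN fD; have gN := morphDN gD.
elim/ind: r => [|r s rE sE|r rE|//]; first by rewrite f0 g0.
- by rewrite fD gD rE sE.
by rewrite fN gN rE.
Qed.

Section MalgExtension.
Variables (K : choiceType) (C : nzRingType) (V : zmodType) (f : K -> C -> V).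
Hypothesis fD : forall k, {morph f k : x y / x + y}.

Definition malg_ext (g : malg K C) : V := \sum_(k <- msupp g) f k (mcoeff k g).

Lemma malg_ext_wide (g : malg K C) (D : {fset K}) : {subset msupp g <= D} ->
  malg_ext g = \sum_(k <- D) f k (mcoeff k g).
Proof.
move=> /fsubsetP gD; apply: big_fset_incl => // k _ kg.
by rewrite mcoeff_outdom // (morphD0 (fD k)).
Qed.

Lemma malg_extD : {morph malg_ext : g h / g + h}.
Proof.
move=> g h; pose D := (msupp g `|` msupp h)%fset.
rewrite (malg_ext_wide (D := D)); last exact/fsubsetP/msuppD_le.
rewrite (malg_ext_wide (g := g) (D := D)); last by move=> k kg; rewrite inE kg.
rewrite (malg_ext_wide (g := h) (D := D)); last by move=> k kg; rewrite inE kg orbT.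
by rewrite -big_split; apply: eq_bigr => k _; rewrite mcoeffD fD.
Qed.

Lemma malg_extU k c : malg_ext (mkmalgU k c) = f k c.
Proof.
rewrite (malg_ext_wide (D := [fset k]%fset)).
  by rewrite big_seq_fset1 mcoeffUU.
by move=> k'; apply/fsubsetP: k'; exact: msuppU_le.
Qed.

End MalgExtension.

Definition gen_ring (X : choiceType) (x : X) : polyZ X := mkmalgU (ucm x) 1 : malg (cmonom X) int.
Definition gen_mod (X Y : choiceType) (y : Y) : free_mod X Y :=
  mkmalgU y 1 : malg Y (malg (cmonom X) int).

Section FreeLift.
Variables (X Y : choiceType) (A : Mod) (a : X -> base_ring A) (b : Y -> A).

Notation T := (malg (cmonom X) int).
Notation Q := (malg Y (malg (cmonom X) int)).

Definition mval (m : cmonom X) : base_ring A := \prod_(i <- finsupp m) a i ^+ m i.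

Lemma mval_wide (m : cmonom X) (D : {fset X}) : {subset finsupp m <= D} ->
  mval m = \prod_(i <- D) a i ^+ m i.
Proof.
move=> /fsubsetP mD; apply: big_fset_incl => // i _ im.
by rewrite fsfun_dflt // expr0.
Qed.

Lemma mvalM (m m' : cmonom X) : mval (mmul m m') = mval m * mval m'.
Proof.
pose D := (finsupp m `|` finsupp m')%fset.
rewrite (mval_wide (m := mmul m m') (D := D)); last by move=> i; rewrite mdomD.
rewrite (mval_wide (m := m) (D := D)); last by move=> i im; rewrite inE im.
rewrite (mval_wide (m := m') (D := D)); last by move=> i im; rewrite inE im orbT.
by rewrite -big_split; apply: eq_bigr => i _; rewrite cmM exprD.
Qed.

Lemma mval1 : mval mone = 1.
Proof. by rewrite /mval mdom1 big_seq_fset0. Qed.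

Lemma mvalU x : mval (ucm x) = a x.
Proof. by rewrite /mval mdomU big_seq_fset1 cmUU expr1. Qed.

Definition ring_lift (r : T) : base_ring A := malg_ext (fun m (k : int) => mval m *~ k) r.

Let mval_coefD m : {morph (fun k : int => mval m *~ k) : k l / k + l}.
Proof. by move=> k l; rewrite mulrzDr. Qed.

Lemma ring_liftD : {morph ring_lift : r s / r + s}.
Proof. exact: (malg_extD mval_coefD). Qed.

Lemma ring_liftU (m : cmonom X) : ring_lift (mkmalgU m 1) = mval m.
Proof. exact: (malg_extU mval_coefD). Qed.

Lemma ring_lift1 : ring_lift 1 = 1.
Proof. by rewrite -[1]/(mkmalgU mone 1) ring_liftU mval1. Qed.

Lemma ring_liftM : {morph ring_lift : r s / r * s}.
Proof.
apply: (morphM_gen (u := fun m => mkmalgU m 1 : T)) => [||m m'].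
- exact: polyZ_ind.
- exact: ring_liftD.
apply: etrans (congr1 ring_lift (esym (malgU_mul m m'))) _.
apply: etrans (ring_liftU _) (etrans (mvalM m m') _).
by apply: esym; congr (_ * _); exact: ring_liftU.
Qed.

Definition mod_lift (q : Q) : A := malg_ext (fun y (r : T) => ring_lift r *: b y) q.

Let mod_coefD y : {morph (fun r : T => ring_lift r *: b y) : r s / r + s}.
Proof. by move=> r s; rewrite ring_liftD scalerDl. Qed.

Lemma mod_liftD : {morph mod_lift : q q' / q + q'}.
Proof. exact: (malg_extD mod_coefD). Qed.

Lemma mod_liftU y (r : T) : mod_lift (mkmalgU y r) = ring_lift r *: b y.
Proof. exact: (malg_extU mod_coefD). Qed.

Lemma mod_liftZ (r : T) (q : Q) : mod_lift (r *: q) = ring_lift r *: mod_lift q.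
Proof.
have UE (s : T) y : s *: mkmalgU y 1 = mkmalgU y s :> Q.
  by apply/malgP => z; rewrite mcoeffZ !mcoeffU mulrnAr mulr1.
apply: (morphZ_gen (u := fun y => mkmalgU y 1 : Q)) => [|||s y].
- exact: free_ind.
- exact: ring_liftM.
- exact: mod_liftD.
apply: etrans (congr1 mod_lift (UE s y)) (etrans (mod_liftU _ _) _).
apply: (congr1 (fun z => ring_lift s *: z)).
by apply: esym; apply: etrans (mod_liftU _ _) _; rewrite ring_lift1 scale1r.
Qed.

Definition free_lift : mor (free_mod X Y) A :=
  @ModHom (free_mod X Y) A
    (@mk_rmorphism (polyZ X) (base_ring A) ring_lift ring_liftD ring_lift1 ring_liftM)
    (@mk_additive (free_mod X Y) A mod_lift mod_liftD) mod_liftZ.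

Lemma free_lift_ring x : ring_map free_lift (gen_ring x) = a x.
Proof. by rewrite -[LHS]/(ring_lift _) ring_liftU mvalU. Qed.

Lemma free_lift_mod y : module_map free_lift (gen_mod X y) = b y.
Proof. by rewrite -[LHS]/(mod_lift _) mod_liftU ring_lift1 scale1r. Qed.

End FreeLift.

Lemma free_lift_uniq (X Y : choiceType) (A : Mod) (f g : mor (free_mod X Y) A) :
  (forall x, ring_map f (gen_ring x) = ring_map g (gen_ring x)) ->
  (forall y, module_map f (gen_mod X y) = module_map g (gen_mod X y)) -> f = g.
Proof.
move=> fgR fgM.
have ringE : ring_map f =1 ring_map g.
  apply: (eq_morphD_gen (u := fun m => mkmalgU m 1 : malg (cmonom X) int)) => [|||m].
  - exact: polyZ_ind.
  - exact: (rmorphD (ring_map f)).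
  - exact: (rmorphD (ring_map g)).
  (* Induction on the degree, splitting off one variable i of the monomial. *)
  have [n] := ubnP (mdeg m); elim: n m => // n IHn m mn.
  have [m0|[i im]] := fset_0Vmem (finsupp m).
    have -> : m = mone.
      by apply/eqP; rewrite -mdeg_eq0 /mdeg m0 big_seq_fset0.
    exact: (etrans (rmorph1 (ring_map f)) (esym (rmorph1 (ring_map g)))).
  have mE : m = mmul (ucm i) (divcm m (ucm i)).
    apply/eqP/cmP => j; rewrite cmM divcmE cmU.
    case: eqP => [<-|_]; last by rewrite subn0.
    by rewrite subnKC // lt0n cmE_neq0.
  have -> : mkmalgU m 1 = gen_ring i * (mkmalgU (divcm m (ucm i)) 1 : polyZ X) :> polyZ X.
    by rewrite {1}mE; exact: malgU_mul.
  apply: etrans (rmorphM (ring_map f) _ _) (etrans _ (esym (rmorphM (ring_map g) _ _))).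
  apply: (congr2 *%R (fgR i) _); apply: IHn.
  by move: mn; rewrite {1}mE mdegM mdegU add1n ltnS.
apply: mod_hom_ext => //.
have ind (P : free_mod X Y -> Prop) : P 0 ->
    (forall m n, P m -> P n -> P (m + n)) ->
    (forall r y, P (r *: gen_mod X y)) -> forall m, P m by exact: free_ind.
apply: ind => [|q q' qE q'E|s y].
- exact: (etrans (raddf0 (module_map f)) (esym (raddf0 (module_map g)))).
- apply: etrans (raddfD (module_map f) _ _) (etrans _ (esym (raddfD (module_map g) _ _))).
  by congr (_ + _).
apply: etrans (module_mapZ f _ _) (etrans _ (esym (module_mapZ g _ _))).
by rewrite ringE fgM.
Qed.

Definition mod_surj (A B : Mod) (p : mor A B) : Prop :=
  (forall r, exists r', ring_map p r' = r) /\ (forall m, exists m', module_map p m' = m).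

Definition mod_ker_le (A B C : Mod) (p : mor A B) (h : mor A C) : Prop :=
  (forall r r', ring_map p r = ring_map p r' -> ring_map h r = ring_map h r') /\
  (forall m m', module_map p m = module_map p m' -> module_map h m = module_map h m').

Lemma mor_ring_ext (A B : Mod) (f g : mor A B) :
  f = g -> ring_map f =1 ring_map g.
Proof. by move=> ->. Qed.

Lemma mor_module_ext (A B : Mod) (f g : mor A B) :
  f = g -> module_map f =1 module_map g.
Proof. by move=> ->. Qed.

Lemma mod_surj_epi (A B C : Mod) (p : mor A B) (k k' : mor B C) :
  mod_surj p -> compc k p = compc k' p -> k = k'.
Proof.
move=> [pr pm] kk'; apply: mod_hom_ext => [r|m].
  by have [r' <-] := pr r; exact: (mor_ring_ext kk' r').
by have [m' <-] := pm m; exact: (mor_module_ext kk' m').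
Qed.

Lemma mod_factor (A B C : Mod) (p : mor A B) (h : mor A C) :
  mod_surj p -> mod_ker_le p h -> exists k : mor B C, compc k p = h.
Proof.
move=> [pr pm] [hr hm].
have [lr lrE] := choice pr; have [lm lmE] := choice pm.
pose kr r := ring_map h (lr r); pose km m := module_map h (lm m).
have krE r : kr (ring_map p r) = ring_map h r by apply: hr; rewrite lrE.
have kmE m : km (module_map p m) = module_map h m by apply: hm; rewrite lmE.
have krD : {morph kr : r s / r + s}.
  by move=> r s; rewrite -(lrE r) -(lrE s) -rmorphD !krE rmorphD.
have kr1 : kr 1 = 1 by rewrite -(rmorph1 (ring_map p)) krE rmorph1.
have krM : {morph kr : r s / r * s}.
  by move=> r s; rewrite -(lrE r) -(lrE s) -rmorphM !krE rmorphM.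
have kmD : {morph km : r s / r + s}.
  by move=> r s; rewrite -(lmE r) -(lmE s) -raddfD !kmE raddfD.
have kmZ r m : km (r *: m) = kr r *: km m.
  by rewrite -(lmE m) -(lrE r) -module_mapZ !kmE krE module_mapZ.
exists (@ModHom B C (mk_rmorphism krD kr1 krM) (mk_additive kmD) kmZ).
by apply: mod_hom_ext => [r|m]; [exact: krE | exact: kmE].
Qed.

Lemma mod_surj_coequaliser (A B Q : Mod) (f g : mor A B) (e : mor B Q) :
  mod_surj e -> compc e f = compc e g ->
  (forall (D : Mod) (h : mor B D), compc h f = compc h g -> mod_ker_le e h) ->
  is_coequaliser f g e.
Proof.
move=> e_surj efg ker; split=> // D h hfg.
have [k kE] := mod_factor e_surj (ker D h hfg).
by exists k; split=> // k' k'E; apply: (mod_surj_epi e_surj); rewrite kE k'E.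
Qed.

Section ModQuotient.
Variable B : Mod.
Notation R := (base_ring B).
Notation M := (module B).
Variable e : R -> R -> Prop.
Hypotheses (e_refl : forall r, e r r) (e_sym : forall r s, e r s -> e s r).
Hypothesis e_trans : forall r s t, e r s -> e s t -> e r t.
Hypothesis eD : forall r r' s s', e r r' -> e s s' -> e (r + s) (r' + s').
Hypothesis eN : forall r r', e r r' -> e (- r) (- r').
Hypothesis eM : forall r r' s s', e r r' -> e s s' -> e (r * s) (r' * s').

Definition rq_rel (r s : R) : bool := `[< e r s >].
Fact rq_refl : reflexive rq_rel. Proof. by move=> r; exact/asboolP. Qed.
Fact rq_sym : symmetric rq_rel.
Proof. by move=> r s; apply/asboolP/asboolP; exact: e_sym. Qed.
Fact rq_trans : transitive rq_rel.
Proof. by move=> s r t /asboolP rs /asboolP st; apply/asboolP; exact: e_trans st. Qed.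
Canonical rq_equiv := EquivRel rq_rel rq_refl rq_sym rq_trans.

Definition rq : Type := {eq_quot rq_equiv}.
HB.instance Definition _ := Choice.on rq.
Definition rq_pi (r : R) : rq := \pi_({eq_quot rq_equiv}) r.
Definition rq_repr (a : rq) : R := repr (a : {eq_quot rq_equiv}).

Lemma rq_reprK a : rq_pi (rq_repr a) = a. Proof. exact: reprK. Qed.
Lemma rq_piP r s : rq_pi r = rq_pi s <-> e r s.
Proof. by split=> [/eqmodP/asboolP|ers] //; apply/eqmodP/asboolP. Qed.
Lemma rq_repr_pi r : e (rq_repr (rq_pi r)) r.
Proof. by apply/rq_piP; rewrite rq_reprK. Qed.

Definition rq_add (a b : rq) := rq_pi (rq_repr a + rq_repr b).
Definition rq_opp (a : rq) := rq_pi (- rq_repr a).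
Definition rq_mul (a b : rq) := rq_pi (rq_repr a * rq_repr b).

Lemma rq_addE r s : rq_add (rq_pi r) (rq_pi s) = rq_pi (r + s).
Proof. by apply/rq_piP; apply: eD; exact: rq_repr_pi. Qed.
Lemma rq_oppE r : rq_opp (rq_pi r) = rq_pi (- r).
Proof. by apply/rq_piP; apply: eN; exact: rq_repr_pi. Qed.
Lemma rq_mulE r s : rq_mul (rq_pi r) (rq_pi s) = rq_pi (r * s).
Proof. by apply/rq_piP; apply: eM; exact: rq_repr_pi. Qed.

Fact rq_addA : associative rq_add.
Proof. by move=> a b c; rewrite -[a]rq_reprK -[b]rq_reprK -[c]rq_reprK !rq_addE addrA. Qed.
Fact rq_addC : commutative rq_add.
Proof. by move=> a b; rewrite -[a]rq_reprK -[b]rq_reprK !rq_addE addrC. Qed.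
Fact rq_add0 : left_id (rq_pi 0) rq_add.
Proof. by move=> a; rewrite -[a]rq_reprK rq_addE add0r. Qed.
Fact rq_addN : left_inverse (rq_pi 0) rq_opp rq_add.
Proof. by move=> a; rewrite -[a]rq_reprK rq_oppE rq_addE addNr. Qed.
Fact rq_mulA : associative rq_mul.
Proof. by move=> a b c; rewrite -[a]rq_reprK -[b]rq_reprK -[c]rq_reprK !rq_mulE mulrA. Qed.
Fact rq_mulC : commutative rq_mul.
Proof. by move=> a b; rewrite -[a]rq_reprK -[b]rq_reprK !rq_mulE mulrC. Qed.
Fact rq_mul1 : left_id (rq_pi 1) rq_mul.
Proof. by move=> a; rewrite -[a]rq_reprK rq_mulE mul1r. Qed.
Fact rq_mulD : left_distributive rq_mul rq_add.
Proof.
move=> a b c; rewrite -[a]rq_reprK -[b]rq_reprK -[c]rq_reprK.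
by rewrite !(rq_addE, rq_mulE) mulrDl.
Qed.

HB.instance Definition _ := GRing.isZmodule.Build rq rq_addA rq_addC rq_add0 rq_addN.
HB.instance Definition _ :=
  GRing.Zmodule_isComPzRing.Build rq rq_mulA rq_mulC rq_mul1 rq_mulD.

Definition rq_proj : {rmorphism R -> rq} :=
  mk_rmorphism (fun r s => esym (rq_addE r s)) (erefl : rq_pi 1 = 1)
    (fun r s => esym (rq_mulE r s)).

Variable d : M -> M -> Prop.
Hypotheses (d_refl : forall r, d r r) (d_sym : forall r s, d r s -> d s r).
Hypothesis d_trans : forall r s t, d r s -> d s t -> d r t.
Hypothesis dD : forall r r' s s', d r r' -> d s s' -> d (r + s) (r' + s').
Hypothesis dN : forall r r', d r r' -> d (- r) (- r').
Hypothesis dZ : forall r r' s s', e r r' -> d s s' -> d (r *: s) (r' *: s').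

Definition mq_rel (r s : M) : bool := `[< d r s >].
Fact mq_refl : reflexive mq_rel. Proof. by move=> r; exact/asboolP. Qed.
Fact mq_sym : symmetric mq_rel.
Proof. by move=> r s; apply/asboolP/asboolP; exact: d_sym. Qed.
Fact mq_trans : transitive mq_rel.
Proof. by move=> s r t /asboolP rs /asboolP st; apply/asboolP; exact: d_trans st. Qed.
Canonical mq_equiv := EquivRel mq_rel mq_refl mq_sym mq_trans.

Definition mq : Type := {eq_quot mq_equiv}.
HB.instance Definition _ := Choice.on mq.
Definition mq_pi (r : M) : mq := \pi_({eq_quot mq_equiv}) r.
Definition mq_repr (a : mq) : M := repr (a : {eq_quot mq_equiv}).

Lemma mq_reprK a : mq_pi (mq_repr a) = a. Proof. exact: reprK. Qed.
Lemma mq_piP r s : mq_pi r = mq_pi s <-> d r s.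
Proof. by split=> [/eqmodP/asboolP|ers] //; apply/eqmodP/asboolP. Qed.
Lemma mq_repr_pi r : d (mq_repr (mq_pi r)) r.
Proof. by apply/mq_piP; rewrite mq_reprK. Qed.

Definition mq_add (a b : mq) := mq_pi (mq_repr a + mq_repr b).
Definition mq_opp (a : mq) := mq_pi (- mq_repr a).
Definition mq_scale (a : rq) (b : mq) := mq_pi (rq_repr a *: mq_repr b).

Lemma mq_addE r s : mq_add (mq_pi r) (mq_pi s) = mq_pi (r + s).
Proof. by apply/mq_piP; apply: dD; exact: mq_repr_pi. Qed.
Lemma mq_oppE r : mq_opp (mq_pi r) = mq_pi (- r).
Proof. by apply/mq_piP; apply: dN; exact: mq_repr_pi. Qed.
Lemma mq_scaleE r s : mq_scale (rq_pi r) (mq_pi s) = mq_pi (r *: s).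
Proof. by apply/mq_piP; apply: dZ; [exact: rq_repr_pi | exact: mq_repr_pi]. Qed.

Fact mq_addA : associative mq_add.
Proof. by move=> a b c; rewrite -[a]mq_reprK -[b]mq_reprK -[c]mq_reprK !mq_addE addrA. Qed.
Fact mq_addC : commutative mq_add.
Proof. by move=> a b; rewrite -[a]mq_reprK -[b]mq_reprK !mq_addE addrC. Qed.
Fact mq_add0 : left_id (mq_pi 0) mq_add.
Proof. by move=> a; rewrite -[a]mq_reprK mq_addE add0r. Qed.
Fact mq_addN : left_inverse (mq_pi 0) mq_opp mq_add.
Proof. by move=> a; rewrite -[a]mq_reprK mq_oppE mq_addE addNr. Qed.

HB.instance Definition _ := GRing.isZmodule.Build mq mq_addA mq_addC mq_add0 mq_addN.

Definition mq_proj : {additive M -> mq} := mk_additive (fun r s => esym (mq_addE r s)).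

Fact mq_scaleA a b v : mq_scale a (mq_scale b v) = mq_scale (a * b) v.
Proof.
rewrite -[a]rq_reprK -[b]rq_reprK -[v]mq_reprK.
by rewrite -(rmorphM rq_proj) !mq_scaleE scalerA.
Qed.
Fact mq_scale1 : left_id 1 mq_scale.
Proof. by move=> v; rewrite -[v]mq_reprK -(rmorph1 rq_proj) mq_scaleE scale1r. Qed.
Fact mq_scaleDr : right_distributive mq_scale +%R.
Proof.
move=> a u v; rewrite -[a]rq_reprK -[u]mq_reprK -[v]mq_reprK.
rewrite -[mq_pi _ + _](raddfD mq_proj) !mq_scaleE scalerDr.
exact: (raddfD mq_proj).
Qed.
Fact mq_scaleDl v : {morph mq_scale^~ v : a b / a + b}.
Proof.
move=> a b; rewrite -[a]rq_reprK -[b]rq_reprK -[v]mq_reprK.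
rewrite -(rmorphD rq_proj) !mq_scaleE scalerDl.
exact: (raddfD mq_proj).
Qed.

HB.instance Definition _ :=
  GRing.Zmodule_isLmodule.Build rq mq mq_scaleA mq_scale1 mq_scaleDr mq_scaleDl.

Lemma mod_quotient : exists (Q : Mod) (p : mor B Q),
  [/\ mod_surj p, forall r s, ring_map p r = ring_map p s <-> e r s
    & forall m n, module_map p m = module_map p n <-> d m n].
Proof.
exists (@ModObj rq mq).
exists (@ModHom B (@ModObj rq mq) rq_proj mq_proj
  (fun r m => esym (mq_scaleE r m))).
split; [split | exact: rq_piP | exact: mq_piP].
- by move=> r; exists (rq_repr r); exact: rq_reprK.
- by move=> m; exists (mq_repr m); exact: mq_reprK.
Qed.

End ModQuotient.

Section ReflexivePair.
Variables (U V : zmodType) (f g : U -> V) (s : V -> U).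
Hypotheses (fD : {morph f : x y / x + y}) (gD : {morph g : x y / x + y}).
Hypotheses (fs : cancel s f) (gs : cancel s g).

Definition paired (v v' : V) : Prop := exists2 u, f u = v & g u = v'.

Lemma paired_refl v : paired v v. Proof. by exists (s v). Qed.

Lemma pairedD v v' w w' : paired v v' -> paired w w' -> paired (v + w) (v' + w').
Proof. by move=> [x <- <-] [y <- <-]; exists (x + y); rewrite ?fD ?gD. Qed.

Lemma pairedN v v' : paired v v' -> paired (- v) (- v').
Proof. by move=> [x <- <-]; exists (- x); rewrite ?(morphDN fD) ?(morphDN gD). Qed.

(* A reflexive relation closed under the group operations is an equivalence. *)
Lemma paired_sym v v' : paired v v' -> paired v' v.
Proof.
move=> vv'; have := pairedD (pairedD (paired_refl v) (pairedN vv')) (paired_refl v').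
by rewrite subrr add0r subrK.
Qed.

Lemma paired_trans v v' v'' : paired v v' -> paired v' v'' -> paired v v''.
Proof.
move=> vv' v'v''; have := pairedD (pairedD vv' (pairedN (paired_refl v'))) v'v''.
by rewrite subrK subrr add0r.
Qed.

End ReflexivePair.

Section ReflexiveCoequaliser.
Variables (A B Q : Mod) (f g : mor A B) (e : mor B Q) (s : mor B A).
Hypotheses (fs : compc f s = idc B) (gs : compc g s = idc B).
Hypothesis e_coeq : is_coequaliser f g e.

Let rfs : cancel (ring_map s) (ring_map f). Proof. exact: (mor_ring_ext fs). Qed.
Let rgs : cancel (ring_map s) (ring_map g). Proof. exact: (mor_ring_ext gs). Qed.
Let mfs : cancel (module_map s) (module_map f). Proof. exact: (mor_module_ext fs). Qed.
Let mgs : cancel (module_map s) (module_map g). Proof. exact: (mor_module_ext gs). Qed.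

(** The pairs (f z, g z) already form a congruence, so the quotient Q0 by them receives a map k from
    Q; elements with equal image in Q become equal in Q0 and are therefore paired. *)
Lemma reflexive_coequaliser_exact :
  [/\ mod_surj e,
      forall r r', ring_map e r = ring_map e r' ->
        paired (ring_map f) (ring_map g) r r'
    & forall m m', module_map e m = module_map e m' ->
        paired (module_map f) (module_map g) m m'].
Proof.
have rfD := rmorphD (ring_map f); have rgD := rmorphD (ring_map g).
have mfD := raddfD (module_map f); have mgD := raddfD (module_map g).
have [Q0 [p [p_surj pr pm]]] := @mod_quotient _ (paired (ring_map f) (ring_map g))
  (paired_refl rfs rgs) (paired_sym rfD rgD rfs rgs)
  (paired_trans rfD rgD rfs rgs) (pairedD rfD rgD) (pairedN rfD rgD)
  (fun r r' t t' rr' tt' => let: ex_intro2 x xr xr' := rr' in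
     let: ex_intro2 y yt yt' := tt' in
     ex_intro2 _ _ (x * y) (etrans (rmorphM (ring_map f) x y) (congr2 *%R xr yt))
      (etrans (rmorphM (ring_map g) x y) (congr2 *%R xr' yt')))
  (paired (module_map f) (module_map g))
  (paired_refl mfs mgs) (paired_sym mfD mgD mfs mgs)
  (paired_trans mfD mgD mfs mgs) (pairedD mfD mgD) (pairedN mfD mgD)
  (fun r r' t t' rr' tt' => let: ex_intro2 x xr xr' := rr' in
     let: ex_intro2 y yt yt' := tt' in
     ex_intro2 _ _ (x *: y) (etrans (module_mapZ f x y) (congr2 *:%R xr yt))
      (etrans (module_mapZ g x y) (congr2 *:%R xr' yt'))).
have [efg uni] := e_coeq.
have pfg : compc p f = compc p g.
  apply: mod_hom_ext => [z|z]; first by apply/pr; exists z.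
  by apply/pm; exists z.
have [k [kE _]] := uni Q0 p pfg.
have [j jE] : exists j : mor Q0 Q, compc j p = e.
  apply: mod_factor => //; split=> [r r' /pr [z <- <-]|m m' /pm [z <- <-]].
    exact: (mor_ring_ext efg).
  exact: (mor_module_ext efg).
(* Surjectivity of e follows: Q is a retract of Q0, onto which p is surjective. *)
have jk : compc j k = idc Q.
  have [i [_ iU]] := uni Q e efg.
  by rewrite -(iU (compc j k)) ?(iU (idc Q)) ?comp1c // -Defs.compA kE.
split.
- case: p_surj => psr psm; split=> x.
    have [r rE] := psr (ring_map k x); exists r.
    rewrite -[LHS](mor_ring_ext jE) -[RHS](mor_ring_ext jk) /=; exact: congr1.
  have [r rE] := psm (module_map k x); exists r.
  rewrite -[LHS](mor_module_ext jE) -[RHS](mor_module_ext jk) /=; exact: congr1.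
- move=> r r' /(congr1 (ring_map k)) kr; apply/pr.
  exact: etrans (esym (mor_ring_ext kE r)) (etrans kr (mor_ring_ext kE r')).
- move=> r r' /(congr1 (module_map k)) kr; apply/pm.
  exact: etrans (esym (mor_module_ext kE r)) (etrans kr (mor_module_ext kE r')).
Qed.

End ReflexiveCoequaliser.

(** * Exactness of tensor powers on reflexive coequalisers *)

Section TensorExact.
Variables (A B Q : Mod) (f g : mor A B) (e : mor B Q) (s : mor B A).
Hypotheses (fs : compc f s = idc B) (gs : compc g s = idc B).
Hypothesis e_surj : mod_surj e.
Hypothesis ring_exact : forall r r', ring_map e r = ring_map e r' ->
  paired (ring_map f) (ring_map g) r r'.
Hypothesis module_exact : forall m m', module_map e m = module_map e m' ->
  paired (module_map f) (module_map g) m m'.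
Variable X : choiceType.

Let tfs : cancel (@tens_map _ _ s X) (@tens_map _ _ f X).
Proof. by move=> t; rewrite -tens_map_comp fs tens_map_id. Qed.
Let tgs : cancel (@tens_map _ _ s X) (@tens_map _ _ g X).
Proof. by move=> t; rewrite -tens_map_comp gs tens_map_id. Qed.

Let tfD := @tens_mapD _ _ f X.
Let tgD := @tens_mapD _ _ g X.

Notation tpaired := (paired (@tens_map _ _ f X) (@tens_map _ _ g X)).

Let eval (l : tens_expr B X) : tens B X := \pi_(tens B X) l.
Let push (l : tens_expr B X) : tens_expr Q X :=
  [seq (ring_map e p.1, module_map e \o p.2) | p <- l].

Let push_surj l : exists l', push l' = l.
Proof.
case: e_surj => er em; elim: l => [|[r m] l [l' <-]]; first by exists [::].
have [r' r'E] := er r; have [m' m'E] := choice (fun x => em (m x)).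
exists ((r', m') :: l'); rewrite /push /= r'E; congr ((_, _) :: _).
exact/funext.
Qed.

Let eval_cat l l' : eval (l ++ l') = eval l + eval l'.
Proof. exact: esym (tens_addE _ _). Qed.

Let eval1 r m : eval [:: (r, m)] = r *: pure m.
Proof. by rewrite [RHS]tens_scaleE /expr_scale /= mulr1. Qed.

(** Entries with equal image are paired by some z and w x chosen over A, and the tensor built from
    these pairs the two terms in all factors at once. *)
Let push_eq l l' : push l = push l' -> tpaired (eval l) (eval l').
Proof.
elim: l l' => [|[r m] l IHl] [|[r' m'] l'] //=; first by move=> _; exact: paired_refl tfs tgs _.
move=> [] /ring_exact [z <- <-] mm' /IHl ll'.
rewrite -cat1s eval_cat -[_ :: l']cat1s eval_cat; apply: pairedD ll' => //.
have /choice[w wE] : forall x, exists w, module_map f w = m x /\ module_map g w = m' x.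
  move=> x; have [w <- <-] : paired (module_map f) (module_map g) (m x) (m' x).
    by apply: module_exact; exact: (congr1 (fun h => h x) mm').
  by exists w.
exists (z *: pure w); rewrite eval1 tens_mapZ tens_map_pure; congr (_ *: pure _);
  by apply/funext => x /=; case: (wE x).
Qed.

(** Quantifying over all lifts makes the induction work: intermediate expressions in a derivation
    over Q can be lifted arbitrarily, since different lifts are paired by [push_eq]. *)
Lemma tens_rel_paired (u v : tens_expr Q X) : tens_rel u v ->
  forall l l', push l = u -> push l' = v -> tpaired (eval l) (eval l').
Proof.
have ttrans := paired_trans tfD tgD tfs tgs; have tsym := paired_sym tfD tgD tfs tgs.
(* l0 and l0' lift a generating relation so that it holds over B itself; [push_eq] absorbs the
   difference from the given lifts. *)
have step l l' l0 l0' : tens_rel l0 l0' -> push l0 = push l -> push l0' = push l' ->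
    tpaired (eval l) (eval l').
  move=> /tens_piP l0E ll0 ll0'; apply: ttrans (push_eq (esym ll0)) _.
  by rewrite [eval l0]l0E; exact: push_eq.
have [er em] := e_surj.
have em_fun (m : X -> Q) : exists m', module_map e \o m' = m.
  by have [m' m'E] := choice (fun x => em (m x)); exists m'; exact/funext.
have push_dfwith (m : X -> B) x a :
    module_map e \o dfwith m x a = dfwith (module_map e \o m) x (module_map e a).
  by apply/funext => y /=; rewrite !dfwithE; case: ifP.
elim=> {u v}
  [u|u v _ IH|u v w _ IH1 _ IH2|u u' v v' _ IH1 _ IH2|u v|m|a b m|r m x a b|r m x d a] l l'.
- by move=> <- /esym; exact: push_eq.
- by move=> lv l'u; apply: tsym; exact: IH.
- move=> lu lw; have [k kv] := push_surj v.
  exact: ttrans (IH1 _ _ lu kv) (IH2 _ _ kv lw).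
- have [k1 k1E] := push_surj u; have [k2 k2E] := push_surj v.
  have [k1' k1'E] := push_surj u'; have [k2' k2'E] := push_surj v'.
  move=> lE l'E; apply: (ttrans _ (eval (k1 ++ k2))).
    by apply: push_eq; rewrite lE /push map_cat -k1E -k2E.
  apply: (ttrans _ (eval (k1' ++ k2'))); last first.
    by apply: push_eq; rewrite l'E /push map_cat -k1'E -k2'E.
  by rewrite !eval_cat; apply: pairedD => //; [exact: IH1 | exact: IH2].
- have [k <-] := push_surj u; have [k' <-] := push_surj v => lE l'E.
  by apply: (step _ _ _ _ (TensCatC k k')); rewrite ?lE ?l'E /push map_cat.
- have [m' <-] := em_fun m => lE l'E.
  by apply: (step _ _ _ _ (TensCoef0 m')); rewrite ?lE ?l'E /push /= ?rmorph0.
- have [a' <-] := er a; have [b' <-] := er b; have [m' <-] := em_fun m => lE l'E.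
  by apply: (step _ _ _ _ (TensCoefD a' b' m')); rewrite ?lE ?l'E /push /= ?rmorphD.
- have [r' <-] := er r; have [m' <-] := em_fun m.
  have [a' <-] := em a; have [b' <-] := em b => lE l'E.
  by apply: (step _ _ _ _ (TensFactorD r' m' x a' b'));
    rewrite ?lE ?l'E /push /= !push_dfwith ?raddfD.
have [r' <-] := er r; have [m' <-] := em_fun m.
have [d' <-] := er d; have [a' <-] := em a => lE l'E.
by apply: (step _ _ _ _ (TensFactorZ r' m' x d' a'));
  rewrite ?lE ?l'E /push /= !push_dfwith ?module_mapZ ?rmorphM.
Qed.

Lemma tens_map_exact (t t' : tens B X) : tens_map e t = tens_map e t' -> tpaired t t'.
Proof.
have [l ->] := tensW t; have [l' ->] := tensW t'.
have mapE k : tens_map e (\pi_(tens B X) k) = \pi_(tens Q X) (push k).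
  elim: k => [|[r m] k IHk]; first exact: (morphD0 (@tens_mapD _ _ e X)).
  rewrite -cat1s -[X in tens_map e X]/(eval _) eval_cat tens_mapD [eval k]/eval IHk.
  rewrite eval1 tens_mapZ tens_map_pure /push /= -cat1s -[RHS]tens_addE; congr (_ + _).
  by rewrite [LHS]tens_scaleE /expr_scale /= mulr1.
by rewrite !mapE => /tens_piP /tens_rel_paired; apply.
Qed.

End TensorExact.

(* The free object (Z[R]; Z[R](M)) on the elements of (R; M), kept abstract. *)
Record free_cover (A : Mod) := FreeCover {
  cov : Mod;
  cov_gen : base_ring A -> base_ring cov;
  cov_mgen : A -> cov;
  cov_lift : forall (B : Mod) (a : base_ring A -> base_ring B) (b : A -> B),
    exists f : mor cov B, (forall r, ring_map f (cov_gen r) = a r) /\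
      forall m, module_map f (cov_mgen m) = b m;
  cov_uniq : forall (B : Mod) (f g : mor cov B),
    (forall r, ring_map f (cov_gen r) = ring_map g (cov_gen r)) ->
    (forall m, module_map f (cov_mgen m) = module_map g (cov_mgen m)) -> f = g;
  cov_free : is_free cov;
  cov_monom : choiceType;
  cov_one : cov_monom;
  cov_op : Monoid.com_law cov_one;
  cov_monoid_ring : monoid_ring (base_ring cov) cov_op;
  cov_basis : choiceType;
  cov_module_basis : module_basis cov cov_basis
}.

Lemma free_cover_of (A : Mod) : free_cover A.
Proof.
pose X : choiceType := base_ring A; pose Y : choiceType := module A.
apply: (@FreeCover A (free_mod X Y) (@gen_ring X) (@gen_mod X Y) _ _ _ _ _ _
  (poly_monoid_ring X) _ (free_module_basis X Y)).
- move=> B a b; exists (free_lift (X := X) (Y := Y) a b).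
  by split=> [r|m]; [exact: free_lift_ring | exact: free_lift_mod].
- move=> B f g; exact: free_lift_uniq.
- by exists X, Y, (idc _), (idc _); split; rewrite comp1c.
Qed.

Definition freeM (A : Mod) : Mod := cov (free_cover_of A).
Definition genR (A : Mod) : base_ring A -> base_ring (freeM A) := @cov_gen A _.
Definition genM (A : Mod) : A -> freeM A := @cov_mgen A _.

Section FreeMod.
Variables (A B : Mod).

Lemma lift_exists (a : base_ring A -> base_ring B) (b : A -> B) :
  { f : mor (freeM A) B | (forall r, ring_map f (genR r) = a r) /\
      forall m, module_map f (genM m) = b m }.
Proof. exact/cid/cov_lift. Qed.

Definition lift_map (a : base_ring A -> base_ring B) (b : A -> B) : mor (freeM A) B :=
  sval (lift_exists a b).

Lemma lift_mapR a b r : ring_map (lift_map a b) (genR r) = a r.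
Proof. by rewrite /lift_map; case: (lift_exists _ _) => f [fr fm] /=; exact: fr. Qed.

Lemma lift_mapM a b m : module_map (lift_map a b) (genM m) = b m.
Proof. by rewrite /lift_map; case: (lift_exists _ _) => f [fr fm] /=; exact: fm. Qed.

Lemma freeM_ext (f g : mor (freeM A) B) :
  (forall r, ring_map f (genR r) = ring_map g (genR r)) ->
  (forall m, module_map f (genM m) = module_map g (genM m)) -> f = g.
Proof. exact: cov_uniq. Qed.

End FreeMod.

Definition freeM_map (A B : Mod) (f : mor A B) : mor (freeM A) (freeM B) :=
  lift_map (@genR B \o ring_map f) (@genM B \o module_map f).

Definition counit (A : Mod) : mor (freeM A) A := @lift_map A A id id.

Lemma freeM_mapR (A B : Mod) (f : mor A B) r :
  ring_map (freeM_map f) (genR r) = genR (ring_map f r).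
Proof. exact: lift_mapR. Qed.

Lemma freeM_mapM (A B : Mod) (f : mor A B) m :
  module_map (freeM_map f) (genM m) = genM (module_map f m).
Proof. exact: lift_mapM. Qed.

Lemma counitR (A : Mod) r : ring_map (counit A) (genR r) = r.
Proof. exact: lift_mapR. Qed.

Lemma counitM (A : Mod) m : module_map (counit A) (genM m) = m.
Proof. exact: lift_mapM. Qed.

Definition freeE := (freeM_mapR, freeM_mapM, counitR, counitM, lift_mapR, lift_mapM).

Lemma freeM_id (A : Mod) : freeM_map (idc A) = idc (freeM A).
Proof. by apply: freeM_ext => x; rewrite freeE. Qed.

Lemma freeM_comp (A B C : Mod) (f : mor A B) (g : mor B C) :
  freeM_map (compc g f) = compc (freeM_map g) (freeM_map f).
Proof. by apply: freeM_ext => x /=; rewrite !freeE. Qed.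

Lemma counit_natural (A B : Mod) (f : mor A B) :
  compc (counit B) (freeM_map f) = compc f (counit A).
Proof. by apply: freeM_ext => x /=; rewrite !freeE. Qed.

Lemma counit_surj (A : Mod) : mod_surj (counit A).
Proof. by split=> x; [exists (genR x) | exists (genM x)]; rewrite freeE. Qed.

Lemma freeM_split (A Q : Mod) (e : mor A Q) : mod_surj e ->
  exists s : mor (freeM Q) (freeM A), compc (freeM_map e) s = idc (freeM Q).
Proof.
move=> [/choice[r rE] /choice[m mE]].
exists (@lift_map Q (freeM A) (@genR A \o r) (@genM A \o m)).
by apply: freeM_ext => x /=; rewrite !freeE /= ?freeE ?rE ?mE.
Qed.

(** Each free generator is sent to the generator of [freeM A] that names it. *)
Lemma counit_split (A : Mod) : is_free A ->
  exists s : mor A (freeM A), compc (counit A) s = idc A.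
Proof.
move=> [X [Y [f [g [gf fg]]]]].
pose s := free_lift (X := X) (Y := Y) (A := freeM A) (@genR A \o ring_map g \o @gen_ring X)
  (@genM A \o module_map g \o @gen_mod X Y).
have sE : compc (counit A) s = g.
  apply: free_lift_uniq => x.
    apply: etrans (congr1 (ring_map (counit A)) (free_lift_ring _ _ x)) _.
      exact: counitR.
  apply: etrans (congr1 (module_map (counit A)) (free_lift_mod _ _ x)) _.
  exact: counitM.
by exists (compc s f); rewrite Defs.compA sE.
Qed.

Lemma bar_section (A : Mod) : exists s : mor (freeM A) (freeM (freeM A)),
  compc (counit (freeM A)) s = idc _ /\ compc (freeM_map (counit A)) s = idc _.
Proof.
exists (@lift_map A (freeM (freeM A)) (@genR _ \o @genR A) (@genM _ \o @genM A)).
by split; apply: freeM_ext => x /=; rewrite freeE /= freeE // freeE.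
Qed.

(** A map h that coequalises the pair satisfies h z = h (gen (counit z)) for every z, so it depends
    on the counit of z alone. *)
Lemma bar_coequaliser (A : Mod) :
  is_coequaliser (counit (freeM A)) (freeM_map (counit A)) (counit A).
Proof.
apply: mod_surj_coequaliser (counit_surj A) _ _; first by rewrite counit_natural.
move=> D h hE; split=> x y xy.
  have E z : ring_map h z = ring_map h (genR (ring_map (counit A) z)).
    by have := mor_ring_ext hE (genR z); rewrite /= !freeE.
  by rewrite E xy -E.
have E z : module_map h z = module_map h (genM (module_map (counit A) z)).
  by have := mor_module_ext hE (genM z); rewrite /= !freeE.
by rewrite E xy -E.
Qed.

(** * The functor W *)

Section ClosedSpan.
Variables (Z : topologicalZmodType) (gens : set Z).

Inductive zspan : Z -> Prop :=
| zspan0 : zspan 0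
| zspan_gen z : gens z -> zspan z
| zspanB z z' : zspan z -> zspan z' -> zspan (z - z').

Definition cspan : set Z := closure zspan.

Lemma cspan_gen z : gens z -> cspan z.
Proof. by move=> Nz; apply: subset_closure; exact: zspan_gen. Qed.

Lemma cspan0 : cspan 0.
Proof. by apply: subset_closure; exact: zspan0. Qed.

Lemma cspanB z z' : cspan z -> cspan z' -> cspan (z - z').
Proof.
move=> Nz Nz' O /(@sub_continuous Z (z, z')) [[A B] /= [Az Bz'] ABO].
have [a [Na Aa]] := Nz _ Az; have [b [Nb Bb]] := Nz' _ Bz'.
by exists (a - b); split; [exact: zspanB | exact: (ABO (a, b))].
Qed.

Lemma cspan_closed : closed cspan. Proof. exact: closed_closure. Qed.

Lemma cspan_nbhs z O : cspan z -> nbhs z O -> exists2 w, zspan w & O w.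
Proof. by move=> Nz /Nz [w []]; exists w. Qed.

End ClosedSpan.

Lemma cspan_map (Z Z' : topologicalZmodType) (gens : set Z) (gens' : set Z') (f : Z -> Z') :
  continuous f -> {morph f : x y / x + y} ->
  (forall z, gens z -> cspan gens' (f z)) ->
  forall z, cspan gens z -> cspan gens' (f z).
Proof.
move=> fc fD fgen z Nz.
have spanf z' : zspan gens z' -> cspan gens' (f z').
  elim=> [|y /fgen //|y y' _ IH _ IH']; first by rewrite (morphD0 fD); exact: cspan0.
  by rewrite (morphDB fD); exact: cspanB.
apply: cspan_closed => O /fc /= /Nz [y [/spanf Ny Oy]].
by exists (f y); split.
Qed.

Lemma hausdorff_eq (T : topologicalType) (x y : T) : hausdorff_space T ->
  (forall O, nbhs x O -> O y) -> x = y.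
Proof.
move=> hT xy; apply: hT => A B Ax By; exists y; split; first exact: xy.
exact: nbhs_singleton.
Qed.

Lemma cspan_kernel (Z : topologicalZmodType) (Z' : topologicalZmodType) (gens : set Z) (f : Z -> Z') :
  hausdorff_space Z' -> continuous f -> {morph f : x y / x + y} ->
  (forall z, gens z -> f z = 0) -> forall z, cspan gens z -> f z = 0.
Proof.
move=> hZ' fc fD fgen z Nz; apply: (hausdorff_eq hZ') => O /fc /= /Nz [y [Ny Oy]].
suff <- : f y = 0 by [].
elim: Ny {Oy} => [|t /fgen //|t t' _ IH _ IH']; first exact: morphD0 fD.
by rewrite (morphDB fD) IH IH' subrr.
Qed.

Section TensProd.
Variables (G : topologicalGroupType) (T : set (set G)).

Lemma tens_prod_mapD (A B : Mod) (f : mor A B) :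
  {morph @tens_prod_map G T A B f : x y / x + y}.
Proof. by move=> x y; apply: functional_extensionality_dep => V; exact: tens_mapD. Qed.

Lemma tens_prod_map_id (A : Mod) x : @tens_prod_map G T A A (idc A) x = x.
Proof. by apply: functional_extensionality_dep => V; exact: tens_map_id. Qed.

Lemma tens_prod_map_comp (A B C : Mod) (f : mor A B) (g : mor B C) x :
  @tens_prod_map G T A C (compc g f) x = tens_prod_map g (tens_prod_map f x).
Proof. by apply: functional_extensionality_dep => V; exact: tens_map_comp. Qed.

Lemma tens_prod_map_continuous (A B : Mod) (f : mor A B) :
  continuous (@tens_prod_map G T A B f).
Proof.
apply: coord_continuous => [U z|U]; first by [].
apply: (@local_continuous _ _ _ _ _ [set U]) => [V z||n n' nn'] //.
by rewrite /tens_prod_map nn'.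
Qed.

Lemma tens_prod_map_surj (A B : Mod) (f : mor A B) : mod_surj f ->
  forall y, exists x, @tens_prod_map G T A B f x = y.
Proof.
move=> [fr fm] y.
pose x : tens_prod T A := fun V => sval (cid (tens_map_surj fr fm (y V))).
exists x; apply: functional_extensionality_dep => V.
by rewrite /tens_prod_map /x; case: cid.
Qed.

(** Coordinates are independent: x is kept on the finite set F, and any lift of y is taken
    elsewhere. *)
Lemma tens_prod_map_open (A B : Mod) (f : mor A B) : mod_surj f ->
  forall x (O : set (tens_prod T A)), nbhs x O -> nbhs (tens_prod_map f x) (tens_prod_map f @` O).
Proof.
move=> f_surj x O /nbhs_box [F finF FO].
have K_discrete (V : T) (z : tens B (coset setT (val V))) : nbhs z [set z] by [].
apply: filterS (box_nbhs K_discrete (tens_prod_map f x) finF) => y xy.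
have [x' x'E] := tens_prod_map_surj f_surj y.
exists (fun V => if pselect (F V) then x V else x' V).
  by apply: FO => V FV; case: pselect.
apply: functional_extensionality_dep => V; rewrite /tens_prod_map.
by case: (pselect (F V)) => FV; [rewrite xy | rewrite -x'E].
Qed.

Lemma tens_prod_hausdorff (A : Mod) : hausdorff_space (@tens_prod G T A).
Proof.
move=> x y xy; apply: functional_extensionality_dep => V.
have K_discrete (W : T) (z : tens A (coset setT (val W))) : nbhs z [set z] by [].
have finV := finite_set1 V.
have [z [<- // <-//]] := xy _ _ (box_nbhs K_discrete x finV) (box_nbhs K_discrete y finV).
Qed.

End TensProd.

Section WittFunctor.
Variables (G : topologicalGroupType) (H : set G) (S : set (set G)).
Hypotheses (G_compact : compact [set: G]) (H_ : open_subgroup H).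
Hypothesis (S_ : truncation_set H S).
Variable c : ghost_choice H S.

Definition free_dwork (A : Mod) : tens_prod S (freeM A) -> Prop :=
  dwork G_compact H_ S_ (cov_module_basis (free_cover_of A))
    (cov_monoid_ring (free_cover_of A)).

(** The left side does not mention c: this is why the image is a group and why it is common to all
    choices. *)
Lemma free_dworkP (A : Mod) (x : tens_prod S (freeM A)) :
  free_dwork x <-> exists n : tens_prod (reps c) (freeM A), ghost n = x.
Proof.
split=> [x_dwork|[n <-]].
  have [n [nx _]] := dwork_solve x_dwork (c := c) (n0 := fun _ => 0) (F := set0)
    (fun _ _ f => False_ind _ f).
  by exists n.
exact: (dwork_ghost G_compact H_ S_ _ _ n).
Qed.

Lemma ghost_sub (A : Mod) (x y : tens_prod (reps c) (freeM A)) :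
  exists z : tens_prod (reps c) (freeM A), ghost z = ghost x - ghost y.
Proof.
have ghostP (n : tens_prod (reps c) (freeM A)) : free_dwork (ghost n).
  by apply/free_dworkP; exists n.
exact: (free_dworkP _).1 (dworkB (ghostP x) (ghostP y)).
Qed.

(** If ghost z agrees with ghost x on the supports of F, then x is a partial solution for ghost z,
    and [dwork_solve] completes it without touching F. *)
Lemma ghost_open (A : Mod) (x : tens_prod (reps c) (freeM A))
    (O : set (tens_prod (reps c) (freeM A))) : nbhs x O ->
  exists2 O' : set (tens_prod S (freeM A)), nbhs (ghost x) O' &
    forall z : tens_prod (reps c) (freeM A), O' (ghost z) ->
      exists2 y, O y & ghost y = ghost z.
Proof.
move=> /nbhs_box [F finF FO].
pose F' : set S := [set rep_in_S V' | V' in \bigcup_(V in F) ghost_supp c (val V)].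
have finF' : finite_set F'.
  apply: finite_image; apply: bigcup_finite => // V _.
  by apply: finite_ghost_supp => //; exact: (reps_open S_ V).
have K_discrete (V : S) (z : tens (freeM A) (coset setT (val V))) : nbhs z [set z] by [].
exists (box (ghost x) F'); first exact: (box_nbhs K_discrete).
move=> z zx; have z_dwork : free_dwork (ghost z) by apply/free_dworkP; exists z.
have [y [yz yx]] := dwork_solve z_dwork (n0 := x) (F := F)
  (fun V V' FV VV' => esym (zx _ (ex_intro2 _ _ V' (ex_intro2 _ _ V FV VV') erefl))).
by exists y => //; exact: FO.
Qed.

Definition witt_gens (A : Mod) : set (tens_prod S (freeM A)) :=
  [set z | exists x y : tens_prod (reps c) (freeM A),
     tens_prod_map (counit A) x = tens_prod_map (counit A) y /\ z = ghost x - ghost y].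

Notation P A := (tens_prod (reps c) (freeM A)).

(* The image of the ghost map of freeM A modulo witt_gens A; it is opaque because
   conversion checks must not unfold its topology. *)
Record image_quotient (A : Mod) := ImageQuotient {
  witt_obj_of :> ab_haus_obj;
  witt_pi_of : P A -> witt_obj_of;
  witt_piP_of : forall x y, witt_pi_of x = witt_pi_of y <->
    cspan (@witt_gens A) (ghost x - ghost y);
  witt_surj_of : forall a, exists x, witt_pi_of x = a;
  witt_piD_of : forall x y z, ghost z = ghost x + ghost y ->
    witt_pi_of x + witt_pi_of y = witt_pi_of z;
  witt_openE_of : forall O, open O <-> open (witt_pi_of @^-1` O)
}.

Lemma image_quotient_of (A : Mod) : image_quotient A.
Proof.
pose W := @iq_obj (P A) (tens_prod S (freeM A)) (@ghost G H S c (freeM A))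
    (cspan (@witt_gens A)) (fun _ => 0) (ghost_continuous G_compact H_ S_ (A := freeM A))
    (@ghost_sub A) (@ghost_open A) (cspan0 _) (@cspanB _ _) (@cspan_closed _ _).
apply: (@ImageQuotient A W (iq_pi _ _ _)).
- exact: iq_piP.
- exact: iq_surj.
- exact: iq_piD.
- exact: iq_openE.
Qed.

Definition witt_obj (A : Mod) : AbHaus := witt_obj_of (image_quotient_of A).
Definition witt_pi (A : Mod) : P A -> witt_obj A := @witt_pi_of A _.

Lemma witt_piP (A : Mod) (x y : P A) :
  witt_pi x = witt_pi y <-> cspan (@witt_gens A) (ghost x - ghost y).
Proof. exact: witt_piP_of. Qed.

Lemma witt_surj (A : Mod) (a : witt_obj A) : exists x, witt_pi x = a.
Proof. exact: witt_surj_of. Qed.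

Lemma witt_piD (A : Mod) (x y z : P A) : ghost z = ghost x + ghost y ->
  witt_pi x + witt_pi y = witt_pi z.
Proof. exact: witt_piD_of. Qed.

Lemma witt_openE (A : Mod) (O : set (witt_obj A)) : open O <-> open (@witt_pi A @^-1` O).
Proof. exact: witt_openE_of. Qed.

Lemma witt_pi_continuous (A : Mod) : continuous (@witt_pi A).
Proof. by apply/continuousP => O /witt_openE. Qed.

Lemma ghost_add (A : Mod) (x y : P A) : exists z : P A, ghost z = ghost x + ghost y.
Proof.
have [o oE] := ghost_sub x x; have [y' y'E] := ghost_sub o y.
by have [z zE] := ghost_sub x y'; exists z; rewrite zE y'E oE subrr sub0r opprK.
Qed.

Lemma witt_pi_counit (A : Mod) (x y : P A) :
  tens_prod_map (counit A) x = tens_prod_map (counit A) y -> witt_pi x = witt_pi y.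
Proof. by move=> xy; apply/witt_piP; apply: cspan_gen; exists x, y. Qed.

(** Additivity is expressed through ghost values because componentwise addition on P A is not the
    addition of W. *)
Lemma witt_descend (A : Mod) (D : ab_haus_obj) (k : P A -> D) :
  continuous k -> (forall x y z, ghost z = ghost x + ghost y -> k z = k x + k y) ->
  (forall x y, witt_pi x = witt_pi y -> k x = k y) ->
  { h : ab_haus_hom (witt_obj A) D | forall x, h (witt_pi x) = k x }.
Proof.
move=> kc kD kpi; have [lift liftK] := choice (@witt_surj A).
have hE x : k (lift (witt_pi x)) = k x by apply: kpi; rewrite liftK.
have hD : {morph k \o lift : a b / a + b}.
  move=> a b /=; have [x <-] := witt_surj a; have [y <-] := witt_surj b.
  by have [z zE] := ghost_add x y; rewrite (witt_piD zE) !hE; exact: kD.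
have hc : continuous (k \o lift).
  apply/continuousP => O oO; apply/witt_openE; rewrite -comp_preimage.
  suff -> : (k \o lift) \o @witt_pi A = k by exact: (continuousP _).1 kc _ oO.
  by apply/funext.
by exists (@AbHausHom (witt_obj A) D (mk_additive hD) hc).
Qed.

Section WittMap.
Variables (A B : Mod) (f : mor A B).

Let k (x : P A) : witt_obj B := witt_pi (tens_prod_map (freeM_map f) x).

Let ghost_map (x : P A) : ghost (tens_prod_map (freeM_map f) x) =
  tens_prod_map (freeM_map f) (ghost x).
Proof. exact: (ghost_natural G_compact H_ S_). Qed.

Lemma witt_map_sig : { h : mor (witt_obj A) (witt_obj B) |
  forall x, ab_map h (witt_pi x) = witt_pi (tens_prod_map (freeM_map f) x) }.
Proof.
apply: (@witt_descend A (witt_obj B) k).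
- move=> x; apply: continuous_comp; first exact: tens_prod_map_continuous.
  exact: witt_pi_continuous.
- by move=> x y z zE; apply/esym/witt_piD; rewrite !ghost_map zE tens_prod_mapD.
move=> x y /witt_piP xy; apply/witt_piP; rewrite !ghost_map.
rewrite -(morphDB (@tens_prod_mapD _ _ _ _ _)); apply: cspan_map xy.
- exact: tens_prod_map_continuous.
- exact: tens_prod_mapD.
move=> _ [x' [y' [x'y' ->]]]; apply: cspan_gen.
exists (tens_prod_map (freeM_map f) x'), (tens_prod_map (freeM_map f) y').
split; last by rewrite (morphDB (@tens_prod_mapD _ _ _ _ _)) !ghost_map.
by rewrite -!tens_prod_map_comp counit_natural !tens_prod_map_comp x'y'.
Qed.

Definition witt_map : mor (witt_obj A) (witt_obj B) := sval witt_map_sig.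

Lemma witt_mapE x : ab_map witt_map (witt_pi x) = witt_pi (tens_prod_map (freeM_map f) x).
Proof. exact: (svalP witt_map_sig). Qed.

End WittMap.

Lemma witt_hom_ext (A : Mod) (D : ab_haus_obj) (h h' : mor (witt_obj A) D) :
  (forall x : P A, ab_map h (witt_pi x) = ab_map h' (witt_pi x)) -> h = h'.
Proof.
move=> hh'; apply: ab_haus_hom_ext => a; have [x <-] := witt_surj a; exact: hh'.
Qed.

Definition witt : functor Mod AbHaus.
Proof.
apply: (@Functor Mod AbHaus witt_obj witt_map) => [A|A B C f g].
  by apply: witt_hom_ext => x; rewrite witt_mapE freeM_id tens_prod_map_id.
by apply: witt_hom_ext => x /=; rewrite !witt_mapE freeM_comp tens_prod_map_comp.
Defined.

Section WittQ.
Variable A : Mod.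

Lemma counit_lift_sig (n : tens_prod (reps c) A) :
  { x : P A | tens_prod_map (counit A) x = n }.
Proof. exact/cid/tens_prod_map_surj/counit_surj. Qed.

Definition witt_q (n : tens_prod (reps c) A) : witt A := witt_pi (sval (counit_lift_sig n)).

Lemma witt_q_counit (x : P A) : witt_q (tens_prod_map (counit A) x) = witt_pi x.
Proof. by apply: witt_pi_counit; exact: svalP (counit_lift_sig _). Qed.

(** [witt_q] involves a discontinuous choice of lifts; continuity is tested after
    [tens_prod_map (counit A)], which is open and surjective. *)
Lemma witt_q_continuous : continuous witt_q.
Proof.
move=> n O; have [x <-] := tens_prod_map_surj (counit_surj A) n.
rewrite witt_q_counit => /witt_pi_continuous /= nO.
apply: filterS (tens_prod_map_open (counit_surj A) nO) => _ [y Oy <-].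
by rewrite /= witt_q_counit.
Qed.

Lemma witt_q_quotient : quotient_map witt_q.
Proof.
split=> [a|O].
  by have [x <-] := witt_surj a; exists (tens_prod_map (counit A) x); exact: witt_q_counit.
split=> [oO|oO]; first exact: (continuousP _).1 witt_q_continuous _ oO.
apply/witt_openE; have -> : @witt_pi A = witt_q \o @tens_prod_map G (reps c) _ _ (counit A).
  by apply/funext => x /=; rewrite witt_q_counit.
rewrite comp_preimage.
exact: (continuousP _).1 (@tens_prod_map_continuous _ (reps c) _ _ (counit A)) _ oO.
Qed.

Lemma witt_w_sig : { w : ab_haus_hom (witt A) (AbHausObj (@tens_prod_hausdorff G S A)) |
  forall x, w (witt_pi x) = tens_prod_map (counit A) (ghost x) }.
Proof.
apply: (@witt_descend A (AbHausObj (@tens_prod_hausdorff G S A))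
  (fun x => tens_prod_map (counit A) (ghost x))).
- move=> x; apply: continuous_comp; first exact: ghost_continuous.
  exact: tens_prod_map_continuous.
- by move=> x y z ->; exact: tens_prod_mapD.
move=> x y /witt_piP xy; apply/eqP; rewrite -subr_eq0; apply/eqP.
rewrite -(morphDB (@tens_prod_mapD _ _ _ _ _)); apply: cspan_kernel xy.
- exact: tens_prod_hausdorff.
- exact: tens_prod_map_continuous.
- exact: tens_prod_mapD.
move=> _ [x' [y' [x'y' ->]]]; rewrite (morphDB (@tens_prod_mapD _ _ _ _ _)).
by rewrite -!(ghost_natural G_compact H_ S_) x'y' subrr.
Qed.

Definition witt_w : witt A -> tens_prod S A := ab_map (sval witt_w_sig).

Lemma witt_wE (x : P A) : witt_w (witt_pi x) = tens_prod_map (counit A) (ghost x).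
Proof. exact: (svalP witt_w_sig). Qed.

Lemma witt_w_continuous : continuous witt_w.
Proof. exact: (@ab_continuous _ _ (sval witt_w_sig)). Qed.

Lemma witt_wD : {morph witt_w : a b / a + b}.
Proof. exact: (raddfD (sval witt_w_sig)). Qed.

(** Replacing x by its image under the composite of s and the counit keeps [witt_pi x], while its
    ghost vector becomes a function of [witt_w (witt_pi x)]. So [witt_w] recovers the class. *)
Lemma witt_w_embedding : is_free A -> embedding witt_w.
Proof.
move=> /counit_split [s sK].
have ghost_map x : ghost (tens_prod_map (compc s (counit A)) x : P A) =
    tens_prod_map s (witt_w (witt_pi x)).
  by rewrite (ghost_natural G_compact H_ S_) tens_prod_map_comp witt_wE.
have pi_map x : witt_pi (tens_prod_map (compc s (counit A)) x) = witt_pi x.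
  by apply: witt_pi_counit; rewrite -!tens_prod_map_comp Defs.compA sK comp1c.
have pi_ghost (x y : P A) : ghost x = ghost y -> witt_pi x = witt_pi y.
  by move=> xy; apply/witt_piP; rewrite xy subrr; exact: cspan0.
split=> [a b|O].
  have [x <-] := witt_surj a; have [y <-] := witt_surj b => xy.
  by rewrite -pi_map -[RHS]pi_map; apply: pi_ghost; rewrite !ghost_map xy.
split=> [oO|[O' oO' ->]]; last exact: (continuousP _).1 witt_w_continuous _ oO'.
(* The largest candidate is taken, so that only one suitable open set around each point of O has to
   be found. *)
exists (\bigcup_(U in [set U : set (tens_prod S A) | open U /\ witt_w @^-1` U `<=` O]) U).
  by apply: bigcup_open => U [].
apply/seteqP; split=> [a Oa|a [U [_ UO] /UO //]].
have [x xa] := witt_surj a; pose x' := tens_prod_map (compc s (counit A)) x.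
have nO : nbhs x' (@witt_pi A @^-1` O).
  apply: open_nbhs_nbhs; split; first exact/witt_openE.
  by rewrite /= pi_map xa.
have [U Ux' UO] := ghost_open nO.
move: Ux'; rewrite ghost_map => /tens_prod_map_continuous /=.
rewrite nbhsE => -[V [oV Vx] VU]; exists V; last by rewrite /= -xa.
split=> // b Vb; have [y yb] := witt_surj b; rewrite -yb -pi_map.
have [|z Oz zy] := UO (tens_prod_map (compc s (counit A)) y).
  by rewrite ghost_map; apply: VU; rewrite yb.
by rewrite -(pi_ghost _ _ zy).
Qed.

End WittQ.

Lemma witt_q_natural (A B : Mod) (f : mor A B) n :
  witt_q (tens_prod_map f n) = ab_map (witt_map f) (witt_q n).
Proof.
have [x <-] := tens_prod_map_surj (counit_surj A) n.
rewrite witt_q_counit witt_mapE -tens_prod_map_comp -counit_natural tens_prod_map_comp.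
exact: witt_q_counit.
Qed.

Section WittCoequaliser.
Variables (A B Q : Mod) (f g : mor A B) (e : mor B Q) (s : mor B A).
Hypotheses (fs : compc f s = idc B) (gs : compc g s = idc B).
Hypothesis e_coeq : is_coequaliser f g e.
Variables (D : ab_haus_obj) (h : mor (witt B) D).
Hypothesis hfg : compc h (witt_map f) = compc h (witt_map g).

Let e_surj : mod_surj e.
Proof. by have [] := reflexive_coequaliser_exact fs gs e_coeq. Qed.

(** By exactness of tensor powers, n and n' are the two images of one z over A, chosen coordinate by
    coordinate, and h identifies these images. *)
Lemma coequaliser_kernel (n n' : tens_prod (reps c) B) :
  tens_prod_map e n = tens_prod_map e n' ->
  ab_map h (witt_q n) = ab_map h (witt_q n').
Proof.
have [_ re me] := reflexive_coequaliser_exact fs gs e_coeq.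
move=> nn'; have zP (V : reps c) : exists z, tens_map f z = n V /\ tens_map g z = n' V.
  have [|z zf zg] := tens_map_exact fs gs e_surj re me (t := n V) (t' := n' V).
    exact: (congr1 (fun x : tens_prod (reps c) Q => x V) nn').
  by exists z.
pose z : tens_prod (reps c) A := fun V => sval (cid (zP V)).
have <- : tens_prod_map f z = n.
  by apply: functional_extensionality_dep => V; rewrite /tens_prod_map /z; case: cid => ? [].
have <- : tens_prod_map g z = n'.
  by apply: functional_extensionality_dep => V; rewrite /tens_prod_map /z; case: cid => ? [].
rewrite !witt_q_natural.
exact: (congr1 (fun k : mor (witt A) D => ab_map k (witt_q z)) hfg).
Qed.

Lemma witt_coequaliser_factor : exists k : mor (witt Q) D, compc k (witt_map e) = h.
Proof.
(* t lifts generators arbitrarily and does not come from a section of e; [coequaliser_kernel] makes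
   h insensitive to that. *)
have [t tK] := freeM_split e_surj.
pose k (x : P Q) := ab_map h (witt_pi (tens_prod_map t x)).
have ghost_map (x : P Q) : ghost (tens_prod_map t x : P B) = tens_prod_map t (ghost x).
  exact: (ghost_natural G_compact H_ S_).
have k_cont : continuous k.
  move=> x; apply: (@continuous_comp _ _ _ (fun x => witt_pi (tens_prod_map t x))).
    apply: continuous_comp; first exact: tens_prod_map_continuous.
    exact: witt_pi_continuous.
  exact: (@ab_continuous _ _ h).
have kD x y z : ghost z = ghost x + ghost y -> k z = k x + k y.
  move=> zE; rewrite /k -(raddfD (ab_map h)); congr (ab_map h _); apply/esym/witt_piD.
  by rewrite !ghost_map zE tens_prod_mapD.
have k0 (x y : P Q) : tens_prod_map (counit Q) x = tens_prod_map (counit Q) y -> k x = k y.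
  move=> xy; rewrite /k -!witt_q_counit; apply: coequaliser_kernel.
  have E (z : P Q) : tens_prod_map e (tens_prod_map (counit B) (tens_prod_map t z)) =
      tens_prod_map (counit Q) z.
    by rewrite -!tens_prod_map_comp -counit_natural -Defs.compA tK compc1.
  by rewrite !E.
have kB x y z : ghost z = ghost x - ghost y -> k z = k x - k y.
  by move=> zE; apply/eqP; rewrite eq_sym subr_eq; apply/eqP/kD; rewrite zE subrK.
(* Only the algebraic span is handled: each of its elements is a ghost vector, and k vanishes on
   every preimage of it. *)
have k_span w : zspan (@witt_gens Q) w ->
    (exists x : P Q, ghost x = w) /\ forall x : P Q, ghost x = w -> k x = 0.
  elim=> [|_ [x [y [xy ->]]]|v v' _ [[x xE] vk] _ [[y yE] v'k]].
  - have [o oE] := ghost_sub (0 : P Q) 0; rewrite subrr in oE; split; first by exists o.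
    by move=> x xE; rewrite (kB o o) ?subrr // oE xE.
  - split=> [|z zE]; first exact: ghost_sub.
    by rewrite (kB _ _ _ zE) (k0 _ _ xy) subrr.
  split=> [|z zE]; first by rewrite -xE -yE; exact: ghost_sub.
  by rewrite (kB x y) ?(vk x) ?(v'k y) ?subrr // zE xE yE.
have k_pi x y : witt_pi x = witt_pi y -> k x = k y.
  move=> /witt_piP; have [z zE] := ghost_sub x y; rewrite -zE => Nz.
  apply/eqP; rewrite -subr_eq0 -(kB _ _ _ zE); apply/eqP.
  (* For the closure: z is changed into a nearby v whose ghost vector lies in the span, so k v = 0
     lies in each neighbourhood O of k z. *)
  apply: hausdorff_eq (@ab_hausdorff D) _ => O /k_cont kO.
  have [O' O'z O'k] := ghost_open kO.
  have [w Nw O'w] := cspan_nbhs Nz O'z; have [[u uE] wk] := k_span w Nw.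
  have [v Ov vE] := O'k u (eq_ind_r O' O'w uE).
  by rewrite -(wk v (etrans vE uE)).
have [kk kkE] := witt_descend k_cont kD k_pi.
exists kk; apply: witt_hom_ext => x /=; rewrite witt_mapE kkE /k -!witt_q_counit.
(* x and its image under e followed by t are different lifts with the same image over Q. *)
apply: coequaliser_kernel.
have etK : compc (freeM_map e) (compc t (freeM_map e)) = freeM_map e.
  by rewrite Defs.compA tK comp1c.
by rewrite -!tens_prod_map_comp -counit_natural -!Defs.compA etK.
Qed.

End WittCoequaliser.

Lemma witt_map_surj (A B : Mod) (e : mor A B) : mod_surj e ->
  forall b, exists a, ab_map (witt_map e) a = b.
Proof.
move=> e_surj b; have [n <-] := (witt_q_quotient B).1 b.
have [n' <-] := tens_prod_map_surj e_surj n.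
by exists (witt_q n'); rewrite witt_q_natural.
Qed.

Lemma witt_coequalisers : preserves_reflexive_coequalisers witt.
Proof.
move=> A B Q f g e [s [fs gs]] e_coeq; split.
  by rewrite -!funct_comp (e_coeq.1).
move=> D h hfg; have [k kE] := witt_coequaliser_factor fs gs e_coeq hfg.
exists k; split=> // k' k'E; apply: ab_haus_hom_ext => b.
have [e_surj _ _] := reflexive_coequaliser_exact fs gs e_coeq.
have [a <-] := witt_map_surj e_surj b.
exact: (congr1 (fun k : mor (witt B) D => ab_map k a) (etrans kE (esym k'E))).
Qed.

Lemma witt_is_witt : is_witt witt_q witt_w.
Proof.
have w_q A n : witt_w (witt_q n) = ghost n :> tens_prod S A.
  have [x <-] := tens_prod_map_surj (counit_surj A) n.
  by rewrite witt_q_counit witt_wE (ghost_natural G_compact H_ S_).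
split.
- exact: witt_q_quotient.
- exact: witt_q_natural.
- exact: w_q.
- by move=> A a; have [n <-] := (witt_q_quotient A).1 a; rewrite w_q; exact: ghost_fixed.
- by move=> A a b U; rewrite witt_wD.
- exact: witt_w_continuous.
- move=> A B f a; have [n <-] := (witt_q_quotient A).1 a.
  by rewrite -[ab_map _ _]witt_q_natural !w_q (ghost_natural G_compact H_ S_).
- exact: witt_w_embedding.
- exact: witt_coequalisers.
Qed.

End WittFunctor.

(** * Uniqueness *)

Lemma nat_trans_ext (C D : category) (F F' : functor C D) (u u' : nat_trans F F') :
  (forall A, u A = u' A) -> u = u'.
Proof.
case: u => u uP; case: u' => u' u'P /= uu'.
have E : u = u' by exact: functional_extensionality_dep.
by case: _ / E in u'P *; congr NatTrans; exact: Prop_irrelevance.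
Qed.

Section Comparison.
Variables (G : topologicalGroupType) (H : set G) (S : set (set G)).
Hypotheses (G_compact : compact [set: G]) (H_ : open_subgroup H).
Hypothesis (S_ : truncation_set H S).

Lemma freeM_free (A : Mod) : is_free (freeM A). Proof. exact: cov_free. Qed.

Section OneWitt.
Variables (c : ghost_choice H S) (W : functor Mod AbHaus).
Variables (q : forall A : Mod, tens_prod (reps c) A -> W A).
Variables (w : forall A : Mod, W A -> tens_prod S A).
Hypothesis W_ : is_witt q w.

Lemma is_witt_map_surj (A B : Mod) (e : mor A B) : mod_surj e ->
  forall b : W B, exists a : W A, ab_map (funct_map W e) a = b.
Proof.
move=> e_surj b; have [n <-] := (q_quotient W_ B).1 b.
have [m <-] := tens_prod_map_surj e_surj n.
by exists (q m); rewrite (q_natural W_).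
Qed.

(** Any two solutions, for whatever choices, thus have the same image on the ghost side of
    [freeM A]. *)
Lemma is_witt_image (A : Mod) (x : tens_prod S (freeM A)) :
  free_dwork G_compact H_ S_ x <-> exists a : W (freeM A), w a = x.
Proof.
split=> [/(free_dworkP _ _ _ c) [n <-]|[a <-]].
  by exists (q n); rewrite (w_ghost W_).
have [n <-] := (q_quotient W_ _).1 a.
by apply/(free_dworkP _ _ _ c); exists n; rewrite (w_ghost W_).
Qed.

Lemma is_witt_inj (A : Mod) : injective (@w (freeM A)).
Proof. exact: (w_embedding W_ (freeM_free A)).1. Qed.

Lemma is_witt_wD (A : Mod) (a b : W A) : w (a + b) = w a + w b.
Proof. by apply: functional_extensionality_dep => U; exact: (w_additive W_). Qed.

Lemma is_witt_bar (A : Mod) : is_coequaliser (funct_map W (counit (freeM A)))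
  (funct_map W (freeM_map (counit A))) (funct_map W (counit A)).
Proof. exact: (W_coequalisers W_ (bar_section A) (bar_coequaliser A)). Qed.

End OneWitt.

Variables (c c' : ghost_choice H S) (W W' : functor Mod AbHaus).
Variables (q : forall A : Mod, tens_prod (reps c) A -> W A).
Variables (q' : forall A : Mod, tens_prod (reps c') A -> W' A).
Variables (w : forall A : Mod, W A -> tens_prod S A).
Variables (w' : forall A : Mod, W' A -> tens_prod S A).
Hypotheses (W_ : is_witt q w) (W'_ : is_witt q' w').

(** Equal images give the map, injectivity of w' its additivity, and the embedding property of w'
    its continuity. *)
Lemma comparison_free (A : Mod) :
  { v : mor (W (freeM A)) (W' (freeM A)) | forall a, w' (ab_map v a) = w a }.
Proof.
have vP (a : W (freeM A)) : exists b : W' (freeM A), w' b = w a.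
  by apply/(is_witt_image W'_)/(is_witt_image W_); exists a.
have [v vE] := choice vP.
have vD : {morph v : a b / a + b}.
  move=> a b; apply: (is_witt_inj W'_).
  by rewrite (is_witt_wD W'_) !vE (is_witt_wD W_).
have v_cont : continuous v.
  apply/continuousP => O /((w_embedding W'_ (freeM_free A)).2 O) [O' oO' ->].
  rewrite -comp_preimage (_ : _ \o v = @w (freeM A)); last exact/funext.
  exact: (continuousP _).1 (w_continuous W_ (A := freeM A)) _ oO'.
by exists (@AbHausHom (W (freeM A)) (W' (freeM A)) (mk_additive vD) v_cont).
Qed.

Notation v A := (sval (comparison_free A)).

Lemma comparison_freeE (A : Mod) a : w' (ab_map (v A) a) = w a.
Proof. exact: (svalP (comparison_free A)). Qed.

Lemma comparison_free_natural (A B : Mod) (f : mor (freeM A) (freeM B)) :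
  compc (v B) (funct_map W f) = compc (funct_map W' f) (v A).
Proof.
apply: ab_haus_hom_ext => a; apply: (is_witt_inj W'_) => /=.
by rewrite comparison_freeE (w_natural W_) (w_natural W'_) comparison_freeE.
Qed.

Lemma comparison_sig (A : Mod) :
  { u : mor (W A) (W' A) | compc u (funct_map W (counit A)) = compc (funct_map W' (counit A)) (v A) }.
Proof.
apply: cid; have [_ bar] := is_witt_bar W_ A; have [bar'E _] := is_witt_bar W'_ A.
have [|u [uE _]] := bar _ (compc (funct_map W' (counit A)) (v A)).
  rewrite -!Defs.compA !comparison_free_natural.
  rewrite [LHS]Defs.compA [RHS]Defs.compA; exact: (congr1 (fun k => compc k _)).
by exists u.
Qed.

Lemma comparison_exists : exists u : nat_trans W W',
  forall (A : Mod) (x : W A), w' (ab_map (u A) x) = w x.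
Proof.
pose u A := sval (comparison_sig A).
have uE A (a : W (freeM A)) : ab_map (u A) (ab_map (funct_map W (counit A)) a) =
    ab_map (funct_map W' (counit A)) (ab_map (v A) a).
  exact: (congr1 (fun k : mor (W (freeM A)) (W' A) => ab_map k a) (svalP (comparison_sig A))).
have funct_mapE (F : functor Mod AbHaus) (A B C : Mod) (f : mor A B) (g : mor B C) a :
    ab_map (funct_map F g) (ab_map (funct_map F f) a) = ab_map (funct_map F (compc g f)) a.
  by rewrite funct_comp.
have u_nat A B (f : mor A B) : compc (u B) (funct_map W f) = compc (funct_map W' f) (u A).
  apply: ab_haus_hom_ext => x; have [a <-] := is_witt_map_surj W_ (counit_surj A) x.
  rewrite /= uE !funct_mapE -!counit_natural -!funct_mapE uE; congr (ab_map _ _).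
  exact: (congr1 (fun k : mor (W (freeM A)) (W' (freeM B)) => ab_map k a)
    (comparison_free_natural (freeM_map f))).
exists (NatTrans u_nat) => A x /=; have [a <-] := is_witt_map_surj W_ (counit_surj A) x.
by rewrite uE (w_natural W'_) (w_natural W_) comparison_freeE.
Qed.

(** On [freeM A] the values are forced by injectivity of w', and naturality along the counit, which
    W makes surjective, forces them on A. *)
Lemma comparison_uniq (u u' : nat_trans W W') :
  (forall (A : Mod) (x : W A), w' (ab_map (u A) x) = w x) ->
  (forall (A : Mod) (x : W A), w' (ab_map (u' A) x) = w x) -> u = u'.
Proof.
move=> uP u'P; apply: nat_trans_ext => A; apply: ab_haus_hom_ext => x.
have [a <-] := is_witt_map_surj W_ (counit_surj A) x.
have natE (t : nat_trans W W') : ab_map (t A) (ab_map (funct_map W (counit A)) a) =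
    ab_map (funct_map W' (counit A)) (ab_map (t (freeM A)) a).
  exact: (congr1 (fun k : mor (W (freeM A)) (W' A) => ab_map k a) (ntc_nat t (counit A))).
by rewrite !natE; congr (ab_map _ _); apply: (is_witt_inj W'_); rewrite uP u'P.
Qed.

End Comparison.

Lemma nat_trans_comp_proof (C D : category) (F F' F'' : functor C D)
    (u : nat_trans F F') (u' : nat_trans F' F'') A B (f : mor A B) :
  compc (compc (u' B) (u B)) (funct_map F f) = compc (funct_map F'' f) (compc (u' A) (u A)).
Proof. by rewrite -Defs.compA ntc_nat Defs.compA ntc_nat Defs.compA. Qed.

Definition nat_trans_comp (C D : category) (F F' F'' : functor C D)
    (u' : nat_trans F' F'') (u : nat_trans F F') : nat_trans F F'' :=
  NatTrans (nat_trans_comp_proof u u').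

Lemma nat_trans_id_proof (C D : category) (F : functor C D) A B (f : mor A B) :
  compc (idc (F B)) (funct_map F f) = compc (funct_map F f) (idc (F A)).
Proof. by rewrite comp1c compc1. Qed.

Definition nat_trans_id (C D : category) (F : functor C D) : nat_trans F F :=
  NatTrans (@nat_trans_id_proof C D F).

Theorem theorem3p5 (G : topologicalGroupType) (H : set G) (S : set (set G)) :
  profinite G -> open_subgroup H -> truncation_set H S ->
  (forall c : ghost_choice H S,
     exists (W : functor Mod AbHaus)
            (q : forall A : Mod, tens_prod (reps c) A -> W A)
            (w : forall A : Mod, W A -> tens_prod S A),
       is_witt q w) /\
  (forall (c c' : ghost_choice H S) (W W' : functor Mod AbHaus)
          (q : forall A : Mod, tens_prod (reps c) A -> W A)
          (q' : forall A : Mod, tens_prod (reps c') A -> W' A)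
          (w : forall A : Mod, W A -> tens_prod S A)
          (w' : forall A : Mod, W' A -> tens_prod S A),
     is_witt q w -> is_witt q' w' ->
     exists! u : nat_trans W W',
       is_nat_iso u /\ forall (A : Mod) (x : W A), w' A (u A x) = w A x).
Proof.
move=> [G_compact _ _] H_ S_; split=> [c|c c' W W' q q' w w' W_ W'_].
  by exists (witt G_compact H_ S_ c); do 2!eexists; exact: witt_is_witt.
have [u uP] := comparison_exists G_compact H_ S_ W_ W'_.
have [u' u'P] := comparison_exists G_compact H_ S_ W'_ W_.
(* Both sides are compatible with w, so uniqueness for W compared with itself makes them equal. *)
have u'u : nat_trans_comp u' u = nat_trans_id W.
  by apply: (comparison_uniq W_ W_) => A x //=; rewrite u'P uP.
have uu' : nat_trans_comp u u' = nat_trans_id W'.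
  by apply: (comparison_uniq W'_ W'_) => A x //=; rewrite uP u'P.
exists u; split=> [|t [_ tP]]; last exact: (comparison_uniq W_ W'_).
split=> // A; exists (u' A); split.
  exact: (congr1 (fun k : nat_trans W W => k A) u'u).
exact: (congr1 (fun k : nat_trans W' W' => k A) uu').
Qed.
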